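(* Let $f$ be a convex normal integrand on $\mathbb{R}^n\times\Omega$ with $\operatorname{dom}Ef\cap\mathcal N^\infty\neq\emptyset$, and let $\mathcal A:=\operatorname{aff}(\operatorname{dom}Ef\cap L^\infty)$. Assume: (1) for every $z\in\operatorname{dom}Ef\cap L^\infty$ and every $t=0,\ldots,T$ there exists $\hat z\in\operatorname{dom}Ef\cap L^\infty$ such that $E_tz^t=\hat z^t$; (2) there exists $\rho\in\mathbb{R}$ such that for every $z\in\mathcal A$ there exists $x\in\mathcal A\cap\mathcal N^\infty$ with $\|x-z\|\le\rho\|{}^az-z\|$; (3) $Ef$ is strongly continuous at a point of $\mathcal N^\infty$ relative to $\mathcal A$, i.e. there is $\bar x\in\mathcal A\cap\mathcal N^\infty$ at which $Ef$ is finite and at which the restriction of $Ef$ to $\mathcal A$ is continuous with respect to the $L^\infty$-norm. Then $$(Ef)^*(x^* )=\inf_{v\in\mathcal N^\perp}Ef^*(x^*+v)\quad\forall x^*\in\mathcal N^1,$$ where the infimum is attained, and, for every $x\in\mathcal N^\infty$, $$\partial Ef(x)={}^aL^1(\partial f(x)).$$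
   Context: $(\Omega,\mathcal F,P)$ is a probability space with a filtration $(\mathcal F_t)_{t=0}^T$ (sub-$\sigma$-algebras of $\mathcal F$; $\mathcal F_T$ need not equal $\mathcal F$), and $n=n_0+\cdots+n_T$. $L^p:=L^p(\Omega,\mathcal F,P;\mathbb{R}^n)$ for $p\in\{0,1,\infty\}$; $\|\cdot\|$ is the $L^\infty$-norm. $\mathcal N=\{(x_t)_{t=0}^T \mid x_t\in L^0(\Omega,\mathcal F_t,P;\mathbb{R}^{n_t})\}$, $\mathcal N^\infty:=\mathcal N\cap L^\infty$, $\mathcal N^1:=\mathcal N\cap L^1$, $\mathcal N^\perp:=\{v\in L^1\mid E(z\cdot v)=0\ \forall z\in\mathcal N^\infty\}$. For $x=(x_0,\ldots,x_T)$, $x^t:=(x_0,\ldots,x_t)$. $E_t$ is the conditional expectation given $\mathcal F_t$, and the adapted projection ${}^av$ of $v\in L^1$ (in particular of $v\in L^\infty$) is $({}^av)_t=E_tv_t$. A normal integrand is a function $f:\mathbb{R}^n\times\Omega\to[-\infty,\infty]$ such that $\omega\mapsto\{(\xi,\alpha)\mid f(\xi,\omega)\le\alpha\}$ is a closed-valued $\mathcal F$-measurable set-valued mapping; it is convex if $f(\cdot,\omega)$ is convex for every $\omega$. $Ef(x)$ is the expectation of $f(x):\omega\mapsto f(x(\omega),\omega)$, where the expectation of a measurable function is defined as $+\infty$ unless its positive part is integrable; $\operatorname{dom}Ef=\{x\mid Ef(x)<\infty\}$. $\operatorname{aff}$ is the (algebraic) affine hull. $f^*(\cdot,\omega)$ is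 the conjugate of $f(\cdot,\omega)$, and $Ef^*(v)$ is the expectation of $f^*(v)$. $(Ef)^*$ and $\partial Ef$ are with respect to the pairing $E(x\cdot x^* )$ of $\mathcal N^\infty$ with $\mathcal N^1$: $(Ef)^*(x^* )=\sup_{x\in\mathcal N^\infty}\{E(x\cdot x^* )-Ef(x)\}$ and $\partial Ef(x)=\{x^*\in\mathcal N^1\mid Ef(x')\ge Ef(x)+E[(x'-x)\cdot x^*]\ \forall x'\in\mathcal N^\infty\}$. Here $\partial f(x)$ is the mapping $\omega\mapsto\partial f(x(\omega),\omega)$, the convex subdifferential of $f(\cdot,\omega)$ at $x(\omega)$. By convention every subdifferential at a point is empty unless the function is finite at that point. $L^1(\partial f(x))=\{v\in L^1\mid v(\omega)\in\partial f(x(\omega),\omega)\ \text{a.s.}\}$ and ${}^aL^1(\partial f(x))=\{{}^av\mid v\in L^1(\partial f(x))\}$. *)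

(* Defs.v *)
From HB Require Import structures.
From mathcomp Require Import all_boot all_order all_algebra.
From mathcomp Require Import all_classical all_reals all_analysis.

Set Implicit Arguments.
Unset Strict Implicit.
Unset Printing Implicit Defensive.
Import Order.TTheory GRing.Theory Num.Theory.
Import numFieldNormedType.Exports.

Local Open Scope classical_set_scope.
Local Open Scope ring_scope.
Local Open Scope ereal_scope.

(* Conventions.
   - n = n_0 + ... + n_T and R^n is 'rV[R]_(\sum_t n_ t); coordinate i belongs
     to the block n_t with t = stage i.
   - Elements of L^p are represented by functions Om -> 'rV[R]_n (not by
     classes modulo P-null sets); conditional expectations are unique only
     almost surely, so E_t and the adapted projection are relations "w is a
     version of ...".  Elements of N are represented by functions whose t-th
     block is F_t-measurable (each class in N contains such functions). *)

Definition dot (R : realType) (m : nat) (a b : 'rV[R]_m) : R :=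
  (\sum_(i < m) a ord0 i * b ord0 i)%R.

Definition eucl_norm (R : realType) (m : nat) (a : 'rV[R]_m) : R :=
  Num.sqrt (dot a a).

Definition aff_hull (R : realType) (E : lmodType R) (S : set E) : set E :=
  [set x | exists (k : nat) (l : 'I_k -> R) (y : 'I_k -> E),
     [/\ forall i, S (y i), (\sum_(i < k) l i)%R = 1%R &
         x = (\sum_(i < k) l i *: y i)%R] ].

Section integrands.
Context {d : measure_display} {Om : measurableType d} {R : realType} {m : nat}.
Variable f : 'rV[R]_m -> Om -> \bar R.

Definition epi (w : Om) : set ('rV[R]_m * R^o)%type :=
  [set p | f p.1 w <= p.2%:E].

Definition normal_integrand : Prop :=
  (forall w, closed (epi w)) /\
  (forall O : set ('rV[R]_m * R^o)%type, open O ->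
     measurable [set w | epi w `&` O !=set0]).

Definition convex_integrand : Prop := forall w, convex_set (epi w).

Definition conj_integrand (v : 'rV[R]_m) (w : Om) : \bar R :=
  ereal_sup [set (dot xi v)%:E - f xi w | xi in [set: 'rV[R]_m]].

Definition subdiff_integrand (xi : 'rV[R]_m) (w : Om) : set 'rV[R]_m :=
  [set v | f xi w \is a fin_num /\
     forall xi', f xi' w >= f xi w + (dot (xi' - xi)%R v)%:E].

End integrands.

Section probability_space.
Context {d : measure_display} {Om : measurableType d} {R : realType}.
Variable P : probability Om R.

(* The test on the positive part is needed because the library's integral
   takes the value -oo, not +oo, when both parts have infinite integral. *)
Definition ext_expectation (X : Om -> \bar R) : \bar R :=
  if \int[P]_w X^\+ w < +oo then \int[P]_w X w else +oo.

Definition is_cond_exp (G : set (set Om)) (v w : Om -> R) : Prop :=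
  [/\ measurable_fun [set: g_sigma_algebraType G] w, w \in Lfun P 1 &
      forall A, G A -> \int[P]_(x in A) (w x)%:E = \int[P]_(x in A) (v x)%:E].

Section random_vectors.
Context {m : nat}.
Implicit Type x : Om -> 'rV[R]_m.

Definition L1 : set (Om -> 'rV[R]_m) :=
  [set x | forall i, (fun w => x w ord0 i) \in Lfun P 1].

Definition Loo : set (Om -> 'rV[R]_m) :=
  [set x | forall i, (fun w => x w ord0 i) \in Lfun P +oo].

Definition Loo_norm x : \bar R := 'N[P]_+oo[(fun w => (eucl_norm (x w))%:E)].

Definition pairing x (v : Om -> 'rV[R]_m) : \bar R :=
  'E_P[(fun w => dot (x w) (v w))].

Definition int_functional (f : 'rV[R]_m -> Om -> \bar R) x : \bar R :=
  ext_expectation (fun w => f (x w) w).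

Definition dom_Loo (f : 'rV[R]_m -> Om -> \bar R) : set (Om -> 'rV[R]_m) :=
  [set x | Loo x /\ int_functional f x < +oo].

Definition L1_subdiff (f : 'rV[R]_m -> Om -> \bar R) x :
    set (Om -> 'rV[R]_m) :=
  [set v | L1 v /\ {ae P, forall w, subdiff_integrand f (x w) w (v w)}].

(* The values of h are compared in the topology of the extended reals. *)
Definition Loo_continuous_at (A : set (Om -> 'rV[R]_m))
    (h : (Om -> 'rV[R]_m) -> \bar R) (xb : Om -> 'rV[R]_m) : Prop :=
  forall V : set (\bar R), nbhs (h xb) V ->
    exists2 delta : R, (0 < delta)%R &
      forall z, A z -> Loo_norm (z - xb)%R < delta%:E -> V (h z).

End random_vectors.
End probability_space.

Section filtered_space.
Context {d : measure_display} {Om : measurableType d} {R : realType}.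
Variables (P : probability Om R) (T : nat) (n_ : 'I_T.+1 -> nat).
Variable F : 'I_T.+1 -> set (set Om).

Local Notation n := (\sum_(t < T.+1) n_ t)%N.
Implicit Types (x z v : Om -> 'rV[R]_n).

Definition stage (i : 'I_n) : 'I_T.+1 := tagnat.sig1 i.

Definition filtration : Prop :=
  [/\ forall t, sigma_algebra [set: Om] (F t),
      forall t, F t `<=` measurable &
      forall s t : 'I_T.+1, (s <= t)%N -> F s `<=` F t].

Definition adapted x : Prop := forall i : 'I_n,
  measurable_fun [set: g_sigma_algebraType (F (stage i))]
    (fun w => x w ord0 i).

Definition Noo : set (Om -> 'rV[R]_n) := [set x | adapted x /\ Loo P x].

Definition N1 : set (Om -> 'rV[R]_n) := [set x | adapted x /\ L1 P x].

Definition Nperp : set (Om -> 'rV[R]_n) :=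
  [set v | L1 P v /\ forall z, Noo z -> pairing P z v = 0].

Definition is_adapted_proj v (av : Om -> 'rV[R]_n) : Prop := forall i : 'I_n,
  is_cond_exp P (F (stage i)) (fun w => v w ord0 i) (fun w => av w ord0 i).

(* E_t z^t = zh^t, where z^t = (z_0, ..., z_t). *)
Definition cond_exp_upto (t : 'I_T.+1) z (zh : Om -> 'rV[R]_n) : Prop :=
  forall i : 'I_n, (stage i <= t)%N ->
    is_cond_exp P (F t) (fun w => z w ord0 i) (fun w => zh w ord0 i).

Definition conj_functional (h : (Om -> 'rV[R]_n) -> \bar R)
    (xs : Om -> 'rV[R]_n) : \bar R :=
  ereal_sup [set pairing P x xs - h x | x in Noo].

Definition subdiff_functional (h : (Om -> 'rV[R]_n) -> \bar R) x :
    set (Om -> 'rV[R]_n) :=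
  [set xs | [/\ N1 xs, h x \is a fin_num &
     forall x', Noo x' -> h x' >= h x + pairing P (x' - x)%R xs] ].

Definition adapted_proj_set (S : set (Om -> 'rV[R]_n)) :
    set (Om -> 'rV[R]_n) :=
  [set av | exists2 v, S v & is_adapted_proj v av].

End filtered_space.

(* Main.v *)
(* Fix [xs] in N^1 with [c := (Ef)^*(xs)] finite. Condition (2) and the continuity
   of Ef yield the exact penalty bound
     Ef z - E[z.xs] + c >= - K |az - z|   on dom Ef,
   so Hahn-Banach provides a bounded linear functional p on L^oo that agrees with
   E[. xs] on N^oo and satisfies p - Ef <= c on dom Ef. Its countably additive part
   y and its singular part s satisfy E[z.y] - Ef z + s z' <= c for all z, z' in
   dom Ef, as one sees by patching z and z' on small sets carrying s. Condition (1)
   therefore allows s to be replaced by z |-> s(E_t z^t). On the stage t this is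
   absolutely continuous, since s(x) = E[x.xs] - E[x.y] on N^oo, and it ignores
   the later stages. Going backwards from t = T to t = 0 removes the singular part
   altogether and leaves y in L^1 with y - xs in N^perp and E[z.y] - Ef z <= c on
   dom Ef; interchanging supremum and expectation gives Ef^*(y) <= c. The
   subdifferential formula is the equality case of Fenchel's inequality. *)

Require Import Defs.
From HB Require Import structures.
From mathcomp Require Import all_boot all_order all_algebra.
From mathcomp Require Import all_classical all_reals all_analysis.
From mathcomp Require Import measurable_realfun ess_sup_inf lra ring.
Import Order.TTheory GRing.Theory Num.Theory.
Import numFieldNormedType.Exports.
Set Implicit Arguments.
Unset Strict Implicit.
Unset Printing Implicit Defensive.
Local Open Scope classical_set_scope.
Local Open Scope ring_scope.

(** * Hahn-Banach theorem *)

(** The argument lives in L^oo and not in N^oo because pasting two vectors along an F-measurable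
    set, on which both the separation of [y] from [s] and the interchange rest, destroys
    adaptedness. The price is a dual space with singular elements. They cannot be removed in one
    stroke: E_t z^t is adapted only in its stage t, since its earlier stages are merely
    F_t-measurable, so each step identifies [s] on a single stage. The order is backwards because
    condition (1) prescribes the stages up to t and leaves the later ones free. Condition (2) serves
    the penalty: it supplies an adapted point at distance proportional to |az - z|, which makes K
    independent of z. The bound on Ef near [xb] is used twice: in that estimate and, by
    extrapolation beyond [xb], to show that Ef is never -oo on its domain, on which the real-valued
    calculus with [phi] relies. If (Ef)^*(xs) = +oo, v = 0 serves; the value -oo is excluded by the
    point of dom Ef in N^oo. *)

Section hahn_banach.
Context {R : realType} {E : lmodType R}.
Variable S : set E.
Hypothesis S_lin : forall (a : R) u v, S u -> S v -> S (a *: u + v).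
Hypothesis S0 : S 0.

(** Relative to [S] because L^oo is a subset of the space of all functions [Om -> 'rV[R]_m], and
    functionals are total functions with arbitrary values outside it. Homogeneity is stated as an
    inequality; applied to t and to its inverse, it gives equality. *)
Definition sublinear_on (p : E -> R) :=
  (forall u v, S u -> S v -> p (u + v) <= p u + p v) /\
  (forall (t : R) u, 0 < t -> S u -> p (t *: u) <= t * p u).

Definition linear_on (p : E -> R) :=
  forall (a : R) u v, S u -> S v -> p (a *: u + v) = a * p u + p v.

Lemma subspace_add u v : S u -> S v -> S (u + v).
Proof. by move=> Su Sv; rewrite -[u]scale1r; exact: S_lin. Qed.

Lemma subspace_scale (a : R) u : S u -> S (a *: u).
Proof. by move=> Su; rewrite -[_ *: _]addr0; exact: S_lin. Qed.

Lemma subspace_opp u : S u -> S (- u).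
Proof. by move=> Su; rewrite -scaleN1r; exact: subspace_scale. Qed.

Lemma sublinear_on0 p : sublinear_on p -> p 0 = 0.
Proof.
move=> [_ pZ]; have := pZ 2 0 (ltr0n R 2) S0; have := pZ 2^-1 0 _ S0.
by rewrite !scaler0 invr_gt0 ltr0n => /(_ isT); lra.
Qed.

Lemma sublinear_onN p u : sublinear_on p -> S u -> - p (- u) <= p u.
Proof.
move=> pS Su; have := pS.1 u (- u) Su (subspace_opp Su).
by rewrite subrr (sublinear_on0 pS); lra.
Qed.

Lemma sublinear_on_linear p : sublinear_on p ->
  (forall u v, S u -> S v -> p u + p v <= p (u + v)) -> linear_on p.
Proof.
move=> pS pD.
have pDE u v : S u -> S v -> p (u + v) = p u + p v.
  by move=> Su Sv; apply/eqP; rewrite eq_le pD// pS.1.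
have pN u : S u -> p (- u) = - p u.
  move=> Su; have := pDE u (- u) Su (subspace_opp Su).
  by rewrite subrr (sublinear_on0 pS); lra.
have pZ (t : R) u : 0 < t -> S u -> p (t *: u) = t * p u.
  move=> t0 Su; apply/eqP; rewrite eq_le pS.2//=.
  rewrite -ler_pdivlMl//; have := pS.2 t^-1 (t *: u).
  rewrite invr_gt0 scalerA mulVf ?gt_eqF// scale1r => -> //.
  exact: subspace_scale.
move=> a u v Su Sv; rewrite pDE//; last exact: subspace_scale.
congr (_ + _); have [a0|a0|->] := ltgtP a 0; last 2 first.
- exact: pZ.
- by rewrite scale0r (sublinear_on0 pS) mul0r.
have := pZ (- a) u; rewrite oppr_gt0 => /(_ a0 Su).
rewrite scaleNr pN; first by lra.
exact: subspace_scale.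
Qed.

Variable q : E -> R.
Hypothesis q_sub : sublinear_on q.

Let T := {p : E -> R | sublinear_on p /\ forall u, S u -> p u <= q u}.
(** The order is reversed, so that a maximal element in Zorn's lemma is a minimal sublinear
    functional. *)
Let le_T : rel T := fun a b => `[< forall u, S u -> sval b u <= sval a u >].

Let T_lb (a : T) u : S u -> - q (- u) <= sval a u.
Proof.
move=> Su; apply: le_trans (sublinear_onN (svalP a).1 Su).
by rewrite lerN2 (svalP a).2//; exact: subspace_opp.
Qed.

(** The bound is the pointwise infimum, finite because every member lies above [- q (- u)]. It is
    subadditive since, of two members of a chain, the smaller one serves both summands. *)
Let chain_bound (A : set T) : total_on A le_T ->
  exists t, forall s, A s -> le_T s t.
Proof.
move=> totA; have [[a0 Aa0]|A0] := pselect (A !=set0); last first.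
  have qT : sublinear_on q /\ forall u, S u -> q u <= q u by [].
  by exists (exist _ q qT) => s As; case: A0; exists s.
pose V u := [set sval a u | a in A].
pose t u := inf (V u).
have V0 u : V u !=set0 by exists (sval a0 u); exists a0.
have Vlb u : S u -> has_lbound (V u).
  by move=> Su; exists (- q (- u)) => _ [a _ <-]; exact: T_lb.
have tle a u : A a -> S u -> t u <= sval a u.
  by move=> Aa Su; apply: ge_inf; [exact: Vlb|exists a].
have tS : sublinear_on t.
  split=> [u v Su Sv|r u r0 Su].
    rewrite -lerBlDr; apply: lb_le_inf => // _ [a Aa <-].
    rewrite lerBlDr -lerBlDl; apply: lb_le_inf => // _ [b Ab <-].
    rewrite lerBlDl; have Suv := subspace_add Su Sv.
    have [/asboolP ab|/asboolP ba] := totA a b Aa Ab.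
      apply: (le_trans (tle b _ Ab Suv)); apply: (le_trans ((svalP b).1.1 _ _ Su Sv)).
      by rewrite lerD2r ab.
    apply: (le_trans (tle a _ Aa Suv)); apply: (le_trans ((svalP a).1.1 _ _ Su Sv)).
    by rewrite lerD2l ba.
  rewrite -ler_pdivrMl//; apply: lb_le_inf => // _ [a Aa <-].
  rewrite ler_pdivrMl//; apply: le_trans (tle a _ Aa (subspace_scale r Su)) _.
  exact: (svalP a).1.2.
have tq u : S u -> t u <= q u.
  by move=> Su; apply: le_trans (tle a0 u Aa0 Su) _; exact: (svalP a0).2.
exists (exist _ t (conj tS tq)) => s As; apply/asboolP => u Su; exact: tle.
Qed.

(* A minimal sublinear functional [p] is linear: minimality applied to
   [x |-> inf_{t >= 0} p (x + t y) - t p y] gives [p x + p y <= p (x + y)]. *)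
Lemma hahn_banach : exists2 p, linear_on p & forall u, S u -> p u <= q u.
Proof.
have qT : sublinear_on q /\ forall u, S u -> q u <= q u by [].
have le_refl t : le_T t t by apply/asboolP.
have le_trans' r s t : le_T r s -> le_T s t -> le_T r t.
  move=> /asboolP rs /asboolP st; apply/asboolP => u Su.
  by apply: le_trans (st u Su) _; exact: rs.
have [] := ZL_preorder (exist _ q qT) le_refl le_trans' chain_bound.
move=> [p [pS pq]] pmin; exists p => //.
apply: sublinear_on_linear => // x y Sx Sy.
pose V x := [set p (x + t *: y) - t * p y | t in [set t : R | 0 <= t]].
pose r x := inf (V x).
have pZ (t : R) u : 0 <= t -> S u -> p (t *: u) <= t * p u.
  rewrite le_eqVlt => /predU1P[<- _|t0 Su]; last exact: pS.2.
  by rewrite scale0r (sublinear_on0 pS) mul0r.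
have Sxt z (t : R) : S z -> S (z + t *: y).
  by move=> Sz; apply: subspace_add => //; exact: subspace_scale.
have V0 z : V z !=set0 by exists (p (z + 0 *: y) - 0 * p y), 0 => /=.
have Vlb z : S z -> has_lbound (V z).
  move=> Sz; exists (- p (- z)) => _ [t /= t0 <-].
  have := pS.1 (z + t *: y) (- z) (Sxt z t Sz) (subspace_opp Sz).
  rewrite addrAC subrr add0r.
  have [->|tn0] := eqVneq t 0.
    by rewrite scale0r (sublinear_on0 pS); lra.
  have tp : 0 < t by rewrite lt_neqAle eq_sym tn0.
  have := pS.2 t^-1 (t *: y).
  rewrite invr_gt0 scalerA mulVf// scale1r => /(_ tp (subspace_scale _ Sy)).
  rewrite -ler_pdivrMl ?invr_gt0// invrK; lra.
have rle z (t : R) : S z -> 0 <= t -> r z <= p (z + t *: y) - t * p y.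
  by move=> Sz t0; apply: ge_inf; [exact: Vlb|exists t].
have rS : sublinear_on r.
  split=> [u v Su Sv|t u t0 Su].
    rewrite -lerBlDr; apply: lb_le_inf => // _ [t /= t0 <-].
    rewrite lerBlDr -lerBlDl; apply: lb_le_inf => // _ [s /= s0 <-].
    rewrite lerBlDl; have := rle (u + v) (t + s) (subspace_add Su Sv) (addr_ge0 t0 s0).
    have := pS.1 (u + t *: y) (v + s *: y) (Sxt _ _ Su) (Sxt _ _ Sv).
    by rewrite addrACA -scalerDl; lra.
  rewrite -ler_pdivrMl//; apply: lb_le_inf => // _ [s /= s0 <-].
  rewrite ler_pdivrMl//.
  have := rle (t *: u) (t * s) (subspace_scale t Su) (mulr_ge0 (ltW t0) s0).
  have := pS.2 t (u + s *: y) t0 (Sxt _ _ Su).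
  by rewrite scalerDr scalerA; lra.
have rp u : S u -> r u <= p u.
  by move=> Su; have := rle u 0 Su (lexx 0); rewrite scale0r mul0r addr0 subr0.
have rq u : S u -> r u <= q u.
  by move=> Su; exact: le_trans (rp u Su) (pq u Su).
have := pmin (exist _ r (conj rS rq)).
have -> : le_T (exist _ p (conj pS pq)) (exist _ r (conj rS rq)).
  by apply/asboolP.
move=> /(_ erefl) /asboolP /= /(_ x Sx).
have := rle x 1 Sx ler01; rewrite scale1r mul1r; lra.
Qed.

End hahn_banach.

Section sandwich.
Context {R : realType} {E : lmodType R}.
Variable S : set E.
Hypothesis S_lin : forall (a : R) u v, S u -> S v -> S (a *: u + v).
Hypothesis S0 : S 0.
Variables (N psi : E -> R) (D : set E).
Hypothesis N_sub : sublinear_on S N.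
Hypothesis DS : D `<=` S.
Hypothesis D0 : D !=set0.
Hypothesis psi_convex : forall (a : R) u v, 0 <= a -> a <= 1 -> D u -> D v ->
  D (a *: u + (1 - a) *: v) /\
  psi (a *: u + (1 - a) *: v) <= a * psi u + (1 - a) * psi v.
Hypothesis psi_lb : forall u, D u -> - N (- u) <= psi u.

(* Hahn-Banach for [q u = inf_{t >= 0, z in D} (t psi z + N (u - t z))]. *)
Lemma linear_sandwich : exists p, [/\ linear_on S p,
  forall u, S u -> p u <= N u & forall u, D u -> p u <= psi u].
Proof.
have [z0 Dz0] := D0.
pose V u := [set a | exists (t : R) z, [/\ 0 <= t, D z & a = t * psi z + N (u - t *: z)]].
pose q u := inf (V u).
have N0 := sublinear_on0 S0 N_sub.
have SN u := @subspace_opp _ _ S S_lin S0 u.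
have SZ t u := @subspace_scale _ _ S S_lin S0 t u.
have SD u v := @subspace_add _ _ S S_lin u v.
have NZge (t : R) u : 0 <= t -> S u -> t * N u <= N (t *: u).
  rewrite le_eqVlt => /predU1P[<- _|t0 Su]; first by rewrite scale0r N0 mul0r.
  have := N_sub.2 t^-1 (t *: u); rewrite invr_gt0 scalerA mulVf ?gt_eqF//.
  by rewrite scale1r -ler_pdivrMl ?invr_gt0// invrK; apply => //; exact: SZ.
have V0 u : V u !=set0.
  by exists (0 * psi z0 + N (u - 0 *: z0)), 0, z0.
have Vlb u : S u -> has_lbound (V u).
  (* Here [psi_lb] is what keeps the infimum finite: t psi(z) >= - N(- t z), and subadditivity of
     [N] does the rest. *)
  move=> Su; exists (- N (- u)) => _ [t [z [t0 Dz ->]]].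
  have Sz := DS Dz.
  have h1 : t * - N (- z) <= t * psi z by apply: ler_wpM2l => //; exact: psi_lb.
  have h2 := NZge t (- z) t0 (SN _ Sz).
  have := N_sub.1 (u - t *: z) (- u) (SD _ _ Su (SN _ (SZ _ _ Sz))) (SN _ Su).
  by rewrite addrAC subrr add0r -scalerN; lra.
have qle u (t : R) z : S u -> 0 <= t -> D z -> q u <= t * psi z + N (u - t *: z).
  by move=> Su t0 Dz; apply: ge_inf; [exact: Vlb|exists t, z].
have q_sub : sublinear_on S q.
  split=> [u v Su Sv|r u r0 Su].
    rewrite -lerBlDr; apply: lb_le_inf => // _ [t [z [t0 Dz ->]]].
    rewrite lerBlDr -lerBlDl; apply: lb_le_inf => // _ [s [w [s0 Dw ->]]].
    rewrite lerBlDl.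
    have Sz := DS Dz; have Sw := DS Dw.
    have NN := N_sub.1 (u - t *: z) (v - s *: w)
      (SD _ _ Su (SN _ (SZ _ _ Sz))) (SD _ _ Sv (SN _ (SZ _ _ Sw))).
    have [ts0|tsn0] := eqVneq (t + s) 0.
      have [t00 s00] : t = 0 /\ s = 0 by split; lra.
      have := qle (u + v) 0 z0 (SD _ _ Su Sv) (lexx _) Dz0.
      by move: NN; rewrite t00 s00 !scale0r !subr0; lra.
    have tsp : 0 < t + s by rewrite lt_neqAle eq_sym tsn0 addr_ge0.
    (* With these weights (t + s) X = t z + s w, so [X] with factor t + s is admissible in the
       infimum for u + v. *)
    have := @psi_convex (t / (t + s)) z w.
    rewrite ler_pdivrMr// mul1r lerDl s0 divr_ge0 ?(ltW tsp)//.
    have -> : 1 - t / (t + s) = s / (t + s) by field.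
    move=> /(_ isT isT Dz Dw) [Dzw].
    set X := (X in psi X) => h.
    have {}h : (t + s) * psi X <= t * psi z + s * psi w.
      rewrite -ler_pdivlMl//; apply: (le_trans h); rewrite le_eqVlt.
      by apply/orP; left; apply/eqP; field.
    have := qle (u + v) (t + s) X (SD _ _ Su Sv) (ltW tsp) Dzw.
    rewrite /X scalerDr !scalerA.
    have -> : (t + s) * (t / (t + s)) = t by field.
    have -> : (t + s) * (s / (t + s)) = s by field.
    by rewrite opprD addrACA; move: h; rewrite /X; lra.
  rewrite -ler_pdivrMl//; apply: lb_le_inf => // _ [t [z [t0 Dz ->]]].
  rewrite ler_pdivrMl//.
  have := qle (r *: u) (r * t) z (SZ _ _ Su) (mulr_ge0 (ltW r0) t0) Dz.
  have := N_sub.2 r (u - t *: z) r0 (SD _ _ Su (SN _ (SZ _ _ (DS Dz)))).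
  by rewrite scalerBr scalerA; lra.
have [p plin pq] := hahn_banach S_lin S0 q_sub.
exists p; split => // u Su.
  apply: (le_trans (pq u Su)); have := qle u 0 z0 Su (lexx _) Dz0.
  by rewrite scale0r mul0r add0r subr0.
have Su' := DS Su; apply: (le_trans (pq u Su')).
by have := qle u 1 u Su' ler01 Su; rewrite scale1r mul1r subrr N0 addr0.
Qed.

End sandwich.

(** * Essentially bounded random vectors *)

Section row_vectors.
Context {R : realType} {m : nat}.
Implicit Types a b : 'rV[R]_m.

Lemma coord_le_norm a i : `|a ord0 i| <= `|a|.
Proof.
rewrite /Num.norm/= mx_normrE; apply: (le_trans _ (le_bigmax _ _ (ord0, i))) => //=.
Qed.

Lemma norm_le_coord a (c : R) : 0 <= c -> (forall i, `|a ord0 i| <= c) ->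
  `|a| <= c.
Proof.
move=> c0 ac; rewrite /Num.norm/= mx_normrE; apply: bigmax_le => // -[j i] _ /=.
by rewrite (ord1 j).
Qed.

Lemma dotDl a a' b : dot (a + a') b = dot a b + dot a' b.
Proof. by rewrite /dot -big_split; apply: eq_bigr => i _; rewrite mxE mulrDl. Qed.

Lemma dotZl (k : R) a b : dot (k *: a) b = k * dot a b.
Proof. by rewrite /dot mulr_sumr; apply: eq_bigr => i _; rewrite mxE mulrA. Qed.

Lemma dotC a b : dot a b = dot b a.
Proof. by apply: eq_bigr => i _; rewrite mulrC. Qed.

Lemma dotDr a b b' : dot a (b + b') = dot a b + dot a b'.
Proof. by rewrite dotC dotDl !(dotC a). Qed.

Lemma dotZr (k : R) a b : dot a (k *: b) = k * dot a b.
Proof. by rewrite dotC dotZl dotC. Qed.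

Lemma dotBl a a' b : dot (a - a') b = dot a b - dot a' b.
Proof. by rewrite dotDl -scaleN1r dotZl mulN1r. Qed.

Lemma norm_le_eucl a : `|a| <= eucl_norm a.
Proof.
apply: norm_le_coord => [|i]; first exact: sqrtr_ge0.
rewrite -sqrtr_sqr ler_sqrt; last by apply: sumr_ge0 => j _; rewrite -expr2 sqr_ge0.
rewrite /dot (bigD1 i)//= expr2 lerDl.
by apply: sumr_ge0 => j _; rewrite -expr2 sqr_ge0.
Qed.

(** The theorem measures vectors by the Euclidean norm, the proof by the sup norm. The constant [m]
    is cruder than its square root, but any constant will do. *)
Lemma eucl_le_norm a : eucl_norm a <= m%:R * `|a|.
Proof.
have [m0|m0] := posnP m.
  rewrite /eucl_norm /dot big1 ?sqrtr0 ?mulr_ge0// => i _.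
  by have := ltn_ord i; rewrite [X in (_ < X)%N]m0.
rewrite -[leRHS]ger0_norm ?mulr_ge0// -sqrtr_sqr ler_sqrt ?sqr_ge0//.
apply: (@le_trans _ _ (\sum_(i < m) `|a| ^+ 2)).
  apply: ler_sum => i _; rewrite -expr2 -real_normK ?num_real//.
  by rewrite lerXn2r ?nnegrE// coord_le_norm.
rewrite sumr_const card_ord exprMn -[leLHS]mulr_natl ler_wpM2r ?sqr_ge0//.
by rewrite expr2 -natrM ler_nat leq_pmulr.
Qed.

End row_vectors.

Section random_vectors.
Context {d : measure_display} {Om : measurableType d} {R : realType}.
Variable P : probability Om R.

Lemma probT_gt0 : (0 < P [set: Om])%E.
Proof. by rewrite probability_setT lte01. Qed.

Lemma Lfun_ooP (g : Om -> R) : g \in Lfun P +oo%E <->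
  measurable_fun setT g /\ exists c : R, {ae P, forall w, `|g w| <= c}.
Proof.
rewrite inE; split=> [/andP[/[!inE]/= mg]|[mg [c gc]]].
  rewrite /finite_norm unlock probT_gt0 => ng; split=> //.
  exists (fine (ess_sup P (abse \o (EFin \o g)))).
  have := ess_sup_ge P (abse \o (EFin \o g)).
  have N0 : (0 <= ess_sup P (abse \o (EFin \o g)))%E.
    by apply: ess_sup_gee; [exact: probT_gt0|by apply: aeW => w /=; rewrite lee_fin].
  by apply: filterS => w /=; rewrite -lee_fin fineK// ge0_fin_numE.
apply/andP; split; rewrite inE//= /finite_norm unlock probT_gt0.
apply: (@le_lt_trans _ _ c%:E); last exact: ltry.
by apply/ess_supP; move: gc; apply: filterS => w /=; rewrite lee_fin.
Qed.

Context {m : nat}.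
Implicit Types x z v : Om -> 'rV[R]_m.

Definition coord x (i : 'I_m) := fun w => x w ord0 i.

Lemma LooP x : Loo P x <-> (forall i, measurable_fun setT (coord x i)) /\
  exists c : R, {ae P, forall w, `|x w| <= c}.
Proof.
split=> [Lx|[mx [c xc]] i]; last first.
  apply/Lfun_ooP; split; first exact: mx.
  by exists c; apply: filterS xc => w; apply: le_trans; exact: coord_le_norm.
split=> [i|]; first by have /Lfun_ooP[] := Lx i.
have /choice[c xc] : forall i : 'I_m, exists c : R, {ae P, forall w, `|coord x i w| <= c}.
  by move=> i; have /Lfun_ooP[] := Lx i.
exists (\sum_i `|c i|).
have : {ae P, forall w, forall i : 'I_m, `|coord x i w| <= c i}.
  exact: filter_forall.
apply: filterS => w xw; apply: norm_le_coord => [|i].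
  by apply: sumr_ge0 => i _.
rewrite (bigD1 i)//=; apply: (le_trans (xw i)); apply: (le_trans (ler_norm _)).
by rewrite lerDl; apply: sumr_ge0.
Qed.

Lemma L1P v : L1 P v <-> forall i, P.-integrable setT (EFin \o coord v i).
Proof. by split=> Lv i; apply/Lfun1_integrable; exact: Lv. Qed.

Lemma LooS (a : R) x z : Loo P x -> Loo P z -> Loo P (a *: x + z).
Proof.
move=> /LooP[mx [c xc]] /LooP[mz [e ze]]; apply/LooP; split=> [i|].
  rewrite (_ : coord _ i = (fun w => a * coord x i w + coord z i w)).
    by apply: measurable_funD => //; apply: measurable_funM.
  by apply/funext => w; rewrite /coord /= !mxE.
exists (`|a| * c + e); move: xc ze; apply: filterS2 => w xw zw.
apply: (le_trans (ler_normD _ _)); apply: lerD => //.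
by rewrite normrZ ler_wpM2l.
Qed.

Lemma Loo0 : Loo P (0 : Om -> 'rV[R]_m).
Proof.
apply/LooP; split=> [i|]; last by exists 0; apply: aeW => w; rewrite normr0.
rewrite (_ : coord _ i = cst 0); first exact: measurable_cst.
by apply/funext => w; rewrite /coord mxE.
Qed.

Lemma LooD x z : Loo P x -> Loo P z -> Loo P (x + z).
Proof. exact: subspace_add (@LooS) x z. Qed.

Lemma LooZ (a : R) x : Loo P x -> Loo P (a *: x).
Proof. exact: subspace_scale (@LooS) Loo0 a x. Qed.

Lemma LooN x : Loo P x -> Loo P (- x).
Proof. exact: subspace_opp (@LooS) Loo0 x. Qed.

Lemma LooB x z : Loo P x -> Loo P z -> Loo P (x - z).
Proof. by move=> Lx Lz; apply: LooD => //; exact: LooN. Qed.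

Lemma L1S (a : R) x z : L1 P x -> L1 P z -> L1 P (a *: x + z).
Proof.
move=> /L1P Lx /L1P Lz; apply/L1P => i.
rewrite (_ : _ \o _ = (fun w => (a%:E * (coord x i w)%:E + (coord z i w)%:E)%E)).
  by apply: integrableD => //; [apply: integrableZl => //; exact: Lx|exact: Lz].
by apply/funext => w /=; rewrite /coord /= !mxE EFinD EFinM.
Qed.

Lemma Loo_L1 x : Loo P x -> L1 P x.
Proof.
move=> Lx i; have PT : P setT \is a fin_num by rewrite probability_setT.
exact: (Lfun_subset (lexx _) (leey _) PT (leey _) (Lx i)).
Qed.

Lemma L10 : L1 P (0 : Om -> 'rV[R]_m). Proof. exact: Loo_L1 Loo0. Qed.

Lemma L1D x z : L1 P x -> L1 P z -> L1 P (x + z).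
Proof. exact: subspace_add (@L1S) x z. Qed.

Lemma L1N x : L1 P x -> L1 P (- x).
Proof. exact: subspace_opp (@L1S) L10 x. Qed.

Lemma L1B x z : L1 P x -> L1 P z -> L1 P (x - z).
Proof. by move=> Lx Lz; apply: L1D => //; exact: L1N. Qed.

(* The L^oo norm built on the sup norm of R^m; it is [0] on vectors that are
   not essentially bounded. *)
Definition nrm x : R := fine (ess_sup P (fun w => `|x w|%:E)).

Lemma nrm_ess_sup x : Loo P x -> (nrm x)%:E = ess_sup P (fun w => `|x w|%:E).
Proof.
move=> /LooP[_ [c xc]]; rewrite fineK// ge0_fin_numE.
  apply: (@le_lt_trans _ _ c%:E); last exact: ltry.
  by apply/ess_supP; apply: filterS xc => w; rewrite lee_fin.
by apply: ess_sup_gee; [exact: probT_gt0|exact: aeW].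
Qed.

Lemma nrm_ge0 x : 0 <= nrm x.
Proof. by apply/fine_ge0/ess_sup_gee; [exact: probT_gt0|exact: aeW]. Qed.

Lemma nrm_ae x : Loo P x -> {ae P, forall w, `|x w| <= nrm x}.
Proof.
move=> Lx; have := ess_sup_ge P (fun w => `|x w|%:E).
by apply: filterS => w; rewrite -nrm_ess_sup.
Qed.

Lemma nrm_le x (c : R) : Loo P x -> {ae P, forall w, `|x w| <= c} -> nrm x <= c.
Proof.
move=> Lx xc; rewrite -lee_fin nrm_ess_sup//; apply/ess_supP.
by apply: filterS xc => w; rewrite lee_fin.
Qed.

Lemma nrmD x z : Loo P x -> Loo P z -> nrm (x + z) <= nrm x + nrm z.
Proof.
move=> Lx Lz; apply: nrm_le; first exact: LooD.
have := nrm_ae Lz; have := nrm_ae Lx; apply: filterS2 => w xw zw.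
by apply: (le_trans (ler_normD _ _)); exact: lerD.
Qed.

Lemma nrmZ (a : R) x : Loo P x -> nrm (a *: x) <= `|a| * nrm x.
Proof.
move=> Lx; apply: nrm_le; first exact: LooZ.
have := nrm_ae Lx; apply: filterS => w xw.
by rewrite normrZ ler_wpM2l.
Qed.

Lemma nrmN x : Loo P x -> nrm (- x) = nrm x.
Proof.
move=> Lx; apply: le_anti; apply/andP; split.
  by have := nrmZ (-1) Lx; rewrite scaleN1r normrN1 mul1r.
by have := nrmZ (-1) (LooN Lx); rewrite scaleN1r opprK normrN1 mul1r.
Qed.

Lemma ae_nrm_eq0 x : Loo P x -> {ae P, forall w, x w = 0} -> nrm x = 0.
Proof.
move=> Lx x0; apply: le_anti; rewrite nrm_ge0 andbT; apply: nrm_le => //.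
by apply: filterS x0 => w ->; rewrite normr0.
Qed.

Lemma nrm_Loo_norm x : Loo P x -> ((nrm x)%:E <= Loo_norm P x)%E.
Proof.
move=> Lx; rewrite nrm_ess_sup// /Loo_norm unlock probT_gt0.
apply: le_ess_sup; apply: aeW => w /=; rewrite lee_fin.
by apply: le_trans (norm_le_eucl _) (ler_norm _).
Qed.

Lemma Loo_norm_nrm x : Loo P x -> (Loo_norm P x <= (m%:R * nrm x)%:E)%E.
Proof.
move=> Lx; rewrite /Loo_norm unlock probT_gt0; apply/ess_supP.
have := nrm_ae Lx; apply: filterS => w xw /=; rewrite lee_fin.
rewrite ger0_norm ?sqrtr_ge0//; apply: (le_trans (eucl_le_norm _)).
by rewrite ler_wpM2l.
Qed.

Lemma ae_le_integrable (f g : Om -> R) : measurable_fun setT f ->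
  P.-integrable setT (EFin \o g) -> {ae P, forall w, `|f w| <= `|g w|} ->
  P.-integrable setT (EFin \o f).
Proof.
move=> mf /integrableP[mg ig] fg; apply/integrableP; split; first exact/measurable_EFinP.
apply: le_lt_trans ig; apply: ae_ge0_le_integral => //=.
- by apply/measurable_EFinP; apply: measurableT_comp.
- apply/measurable_EFinP/measurableT_comp => //; exact/measurable_EFinP.
- by apply: filterS fg => w ? _; rewrite lee_fin.
Qed.

Lemma integrable_dot x v : Loo P x -> L1 P v ->
  P.-integrable setT (EFin \o (fun w => dot (x w) (v w))).
Proof.
move=> /LooP[mx [c xc]] /L1P Lv.
have -> : EFin \o (fun w => dot (x w) (v w)) =
    (fun w => (\sum_(i < m) (coord x i w * coord v i w)%:E)%E).
  by apply/funext => w /=; rewrite /dot sumEFin.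
apply: integrable_sum => // i _; apply: (@ae_le_integrable _ (fun w => c * coord v i w)).
- apply: measurable_funM => //.
  by apply/measurable_EFinP; exact: (measurable_int P (Lv i)).
- by rewrite (_ : _ \o _ = (fun w => c%:E * (coord v i w)%:E)%E)//; apply: integrableZl => //; exact: Lv.
- apply: filterS xc => w xw; rewrite !normrM ler_wpM2r//.
  apply: (le_trans (coord_le_norm _ _)); exact: (le_trans xw (ler_norm _)).
Qed.

End random_vectors.

(** * Absolutely continuous functionals have densities *)

Section bounded_scalars.
Context {d : measure_display} {T : measurableType d} {R : realType}.

Definition bounded_by (g : T -> R) (c : R) := forall w, `|g w| <= c.

(* Bisection: [g - c/2 (1_{g > 0} - 1_{g <= 0})] is bounded by [c/2]. *)
Lemma bounded_linear_eq0 (q : (T -> R) -> R) (K : R) :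
  (forall (a b : R) g h c e, measurable_fun setT g -> measurable_fun setT h ->
     bounded_by g c -> bounded_by h e ->
     q (fun w => a * g w + b * h w) = a * q g + b * q h) ->
  (forall g c, measurable_fun setT g -> bounded_by g c -> `|q g| <= K * c) ->
  (forall A, measurable A -> q \1_A = 0) ->
  forall g c, measurable_fun setT g -> bounded_by g c -> q g = 0.
Proof.
move=> qlin qK q1.
have b1 (A : set T) : bounded_by (\1_A : T -> R) 1.
  by move=> w; rewrite indicE; case: (w \in A); rewrite ?normr1 ?normr0.
have key n : forall g c, measurable_fun setT g -> bounded_by g c ->
    `|q g| <= K * (c / 2 ^+ n).
  elim: n => [|n IH] g c mg gc; first by rewrite expr0 divr1; exact: qK.
  pose A := [set w | 0 < g w].
  have mA : measurable A.
    rewrite (_ : A = g @^-1` `]0, +oo[).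
      by rewrite -[X in measurable X]setTI; exact: mg.
    by apply/seteqP; split => w /=; rewrite in_itv/= andbT.
  pose s := fun w => (c / 2) * \1_A w + (- (c / 2)) * \1_(~` A) w.
  have ms : measurable_fun setT s.
    apply: measurable_funD; apply: measurable_funM => //.
    by apply: measurable_indic; exact: measurableC.
  have qs : q s = 0.
    have mAC := measurableC mA.
    have mi : measurable_fun setT (\1_A : T -> R) by exact: measurable_indic.
    have miC : measurable_fun setT (\1_(~` A) : T -> R) by exact: measurable_indic.
    by rewrite (qlin _ _ _ _ 1 1 mi miC) ?q1 ?mulr0 ?addr0.
  have sE w : s w = if 0 < g w then c / 2 else - (c / 2).
    rewrite /s !indicE in_setC; case: ifPn => gw.
      by rewrite mem_set//= mulr1 mulr0 addr0.
    by rewrite memNset ?mulr0 ?mulr1 ?add0r//=; apply/negP.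
  have sc : bounded_by s (c / 2).
    move=> w; rewrite sE; have c0 : 0 <= c by apply: le_trans (gc w).
    by case: ifP => _; rewrite ?normrN ger0_norm// divr_ge0.
  have gs : bounded_by (fun w => 1 * g w + (- 1) * s w) (c / 2).
    move=> w; rewrite sE; have := gc w; rewrite !ler_norml => /andP[g1 g2].
    by case: ifPn => [gw|]; [|rewrite -leNgt => gw]; apply/andP; split; lra.
  have -> : q g = q (fun w => 1 * g w + (- 1) * s w).
    by rewrite (qlin _ _ _ _ c (c / 2))// qs mulr0 addr0 mul1r.
  have -> : c / 2 ^+ n.+1 = c / 2 / 2 ^+ n by rewrite exprS invfM mulrA.
  apply: IH => //.
  by apply: measurable_funD; apply: measurable_funM.
move=> g c mg gc; apply/eqP; rewrite -normr_le0; apply/ler_addgt0Pl => e e0.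
rewrite addr0; set C := `|K * c| + 1.
have C0 : 0 < C by rewrite ltr_wpDl.
have eC0 : 0 < e / C by rewrite divr_gt0.
have [n _ /(_ n (leqnn n)) /= ne] := near_infty_natSinv_expn_lt (PosNum eC0).
apply: (le_trans (key n _ _ mg gc)); rewrite mulrA.
move: ne; rewrite ltr_pdivlMr// => /ltW; apply: le_trans.
rewrite mulrC div1r ler_wpM2l ?invr_ge0 ?exprn_ge0//.
by rewrite /C; apply: (le_trans (ler_norm _)); rewrite lerDl.
Qed.

End bounded_scalars.

Section density.
Context {d : measure_display} {T : measurableType d} {R : realType}.
Variables (mu : probability T R) (la : set T -> R).
Hypothesis la_add : forall A B, measurable A -> measurable B ->
  A `&` B = set0 -> la (A `|` B) = la A + la B.
Hypothesis la_ac : forall e : R, 0 < e -> exists2 del : R, 0 < del &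
  forall A, measurable A -> (mu A < del%:E)%E -> `|la A| <= e.

Let nu (A : set T) : \bar R := (la A)%:E.

Let la0 : la set0 = 0.
Proof.
have := la_add measurable0 measurable0 (setI0 set0).
by rewrite setU0 => /eqP; rewrite -subr_eq0 opprD addrA subrr sub0r oppr_eq0 => /eqP.
Qed.

Let nu0 : nu set0 = 0%E. Proof. by rewrite /nu la0. Qed.

Let nu_fin A : measurable A -> nu A \is a fin_num. Proof. by []. Qed.

(** By finite additivity the error of the n-th partial sum is [la] of the tail [G n]. The tails
    decrease to the empty set, so their measure tends to 0 and absolute continuity makes the error
    vanish. *)
Let nu_sigma : semi_sigma_additive nu.
Proof.
move=> F mF tF mUF.
pose U n := \big[setU/set0]_(i < n) F i.
have mU n : measurable (U n) by apply: bigsetU_measurable.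
pose G n := (\bigcup_i F i) `\` U n.
have mG n : measurable (G n) by apply: measurableD.
have US n : U n.+1 = U n `|` F n by rewrite /U big_ord_recr.
have UF n : U n `&` F n = set0.
  rewrite /U big_distrl /= big1// => i _.
  by move/trivIsetP : tF; apply => //; rewrite ltn_eqF.
have sumE n : (\sum_(0 <= i < n) nu (F i))%E = (la (U n))%:E.
  elim: n => [|n IH]; first by rewrite big_nil /U big_ord0 la0.
  by rewrite big_nat_recr//= IH US la_add.
have laG n : la (\bigcup_i F i) = la (U n) + la (G n).
  rewrite -la_add//; last by rewrite /G setDE setICA setICr setI0.
  rewrite /G setDUK//; rewrite /U -bigcup_mkord; by apply: bigcup_sub => i _; exact: bigcup_sup.
have G0 : \bigcap_n G n = set0.
  apply/seteqP; split => // w /= Gw.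
  have [[i _ Fiw] _] := Gw 0%N I.
  have [_ +] := Gw i.+1 I; apply; rewrite US; by right.
have muG : mu \o G @ \oo --> mu set0.
  rewrite -G0; apply: nonincreasing_cvg_mu => //.
  - by apply: (le_lt_trans (probability_le1 mu (mG 0%N))); exact: ltry.
  - by rewrite G0.
  - move=> n k nk; apply/subsetPset => w [Fw nUw]; split => // Uw; apply: nUw.
    by apply: subset_bigsetU nk _ Uw.
rewrite [X in X @ \oo --> _](_ : _ = (fun n => (la (U n))%:E)); last exact/funext.
apply/fine_cvgP; split; first exact: nearW.
apply/cvgrPdist_le => e e0 /=.
have [del del0 lad] := la_ac e0.
have : \forall n \near \oo, (mu (G n) < del%:E)%E.
  move: muG; rewrite measure0 => /fine_cvgP[_ /cvgrPdist_lt /(_ _ del0)].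
  apply: filterS => n /=; rewrite sub0r normrN ger0_norm ?fine_ge0// => h.
  by rewrite -(@fineK _ (mu (G n))) ?lte_fin// fin_num_measure.
apply: filterS => n muGn.
by rewrite (laG n) addrAC subrr add0r; exact: lad.
Qed.

HB.instance Definition _ := isCharge.Build _ _ _ nu nu0 nu_fin nu_sigma.

Lemma ac_density : exists2 y : T -> R, mu.-integrable setT (EFin \o y) &
  forall A, measurable A -> (la A)%:E = (\int[mu]_(w in A) (y w)%:E)%E.
Proof.
have numu : nu `<< mu.
  apply/null_content_dominatesP => A mA muA; rewrite /nu; congr EFin.
  apply/eqP; rewrite -normr_le0; apply/ler_addgt0Pl => e e0; rewrite addr0.
  by have [del del0 lad] := la_ac e0; apply: lad => //; rewrite muA lte_fin.
pose y := Radon_Nikodym nu mu.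
have yE : EFin \o (fine \o y) = y.
  by apply/funext => w /=; rewrite fineK//; exact: Radon_Nikodym_fin_num.
exists (fine \o y) => [|A mA]; first by rewrite yE; exact: Radon_Nikodym_integrable.
rewrite -[LHS]/(nu A) (Radon_Nikodym_integral numu mA).
by apply: eq_integral => w _; rewrite /= fineK//; exact: Radon_Nikodym_fin_num.
Qed.

End density.

(** * Real-valued integrals *)

Section real_integral.
Context {d : measure_display} {Om : measurableType d} {R : realType}.
Variable P : probability Om R.
Implicit Types f g : Om -> R.

(** Being [fine] of the extended integral, it takes a junk value when that is infinite; hence the
    companion predicate [integr]. *)
Definition rint f : R := \int[P]_w f w.

Definition integr f := P.-integrable setT (EFin \o f).

Lemma integr_meas f : integr f -> measurable_fun setT f.
Proof. by move=> /(measurable_int P) /measurable_EFinP. Qed.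

Lemma rintE f : integr f -> (\int[P]_w (f w)%:E)%E = (rint f)%:E.
Proof.
by move=> If; rewrite /rint /Rintegral fineK//; exact: integrable_fin_num.
Qed.

Lemma integrD f g : integr f -> integr g -> integr (fun w => f w + g w).
Proof. by move=> If Ig; exact: integrableD measurableT _ _ If Ig. Qed.

Lemma integrZ (a : R) f : integr f -> integr (fun w => a * f w).
Proof. by move=> If; exact: integrableZl measurableT a _ If. Qed.

Lemma integrN f : integr f -> integr (fun w => - f w).
Proof. by move=> /(integrZ (-1)); under eq_fun do rewrite mulN1r. Qed.

Lemma integrB f g : integr f -> integr g -> integr (fun w => f w - g w).
Proof. by move=> If /integrN; exact: integrD. Qed.

Lemma integr_cst (c : R) : integr (cst c).
Proof. exact: finite_measure_integrable_cst. Qed.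

Lemma integr_ae_eq f g : measurable_fun setT g -> integr f ->
  {ae P, forall w, f w = g w} -> integr g.
Proof.
move=> mg If fg; apply: (ae_le_integrable mg If).
by apply: filterS fg => w ->.
Qed.

Lemma integr_indic f (A : set Om) : measurable A -> integr f ->
  integr (fun w => \1_A w * f w).
Proof.
move=> mA If; apply: (ae_le_integrable _ If).
  by apply: measurable_funM; [exact: measurable_indic|exact: integr_meas].
apply: aeW => w; rewrite indicE; case: (w \in A); first by rewrite mul1r.
by rewrite mul0r normr0.
Qed.

Lemma integr_bddM f g (c : R) : measurable_fun setT g ->
  {ae P, forall w, `|g w| <= c} -> integr f -> integr (fun w => g w * f w).
Proof.
move=> mg gc If; apply: (ae_le_integrable _ (integrZ c If)).
  by apply: measurable_funM => //; exact: integr_meas.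
apply: filterS gc => w gc; rewrite !normrM ler_wpM2r//.
exact: le_trans gc (ler_norm c).
Qed.

Lemma rintD f g : integr f -> integr g ->
  rint (fun w => f w + g w) = rint f + rint g.
Proof. by move=> If Ig; exact: RintegralD. Qed.

Lemma rintZ (a : R) f : integr f -> rint (fun w => a * f w) = a * rint f.
Proof. by move=> If; exact: RintegralZl. Qed.

Lemma rintB f g : integr f -> integr g ->
  rint (fun w => f w - g w) = rint f - rint g.
Proof. by move=> If Ig; exact: RintegralB. Qed.

Lemma rint_cst (c : R) : rint (cst c) = c.
Proof.
transitivity (c * fine (P setT)); first exact: Rintegral_cst.
by rewrite probability_setT mulr1.
Qed.

Lemma rint_ae_eq f g : integr f -> integr g ->
  {ae P, forall w, f w = g w} -> rint f = rint g.
Proof.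
move=> If Ig fg; rewrite /rint /Rintegral; congr fine.
apply: ae_eq_integral => //.
- exact: measurable_int If.
- exact: measurable_int Ig.
- by apply: filterS fg => w ->.
Qed.

Lemma rint_ae_le f g : integr f -> integr g ->
  {ae P, forall w, f w <= g w} -> rint f <= rint g.
Proof.
(* The minimum of [f] and [g] is a.e. equal to [f] and everywhere below [g]: it turns the a.e.
   inequality into a pointwise one. *)
move=> If Ig fg; have mm : measurable_fun setT (fun w => Num.min (f w) (g w)).
  by apply: measurable_minr; exact: integr_meas.
have fm : {ae P, forall w, f w = Num.min (f w) (g w)}.
  by apply: filterS fg => w fgw; rewrite min_l.
rewrite (rint_ae_eq If (integr_ae_eq mm If fm) fm).
apply: le_Rintegral => //; first exact: integr_ae_eq fm.
by move=> w _; rewrite ge_min lexx orbT.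
Qed.

Lemma rint_ge0 f : (forall w, 0 <= f w) -> 0 <= rint f.
Proof. by move=> f0; exact: Rintegral_ge0. Qed.

Lemma le_norm_rint f : integr f -> `|rint f| <= rint (fun w => `|f w|).
Proof. by move=> If; exact: le_normr_Rintegral. Qed.

Lemma rint_ae_eq0 f : integr f -> {ae P, forall w, 0 <= f w} -> rint f <= 0 ->
  {ae P, forall w, f w = 0}.
Proof.
move=> If f0 fle0; have In : integr (fun w => `|f w|) by exact: integrable_norm.
have fn : {ae P, forall w, f w = `|f w|}.
  by apply: filterS f0 => w fw0; rewrite ger0_norm.
have e0 : rint (fun w => `|f w|) = 0.
  by apply: le_anti; rewrite rint_ge0// andbT -(rint_ae_eq If In fn).
have : (\int[P]_w `|(f w)%:E| = 0)%E by rewrite -[RHS]/(0%:E) -e0 -rintE.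
move/(ae_eq_integral_abs P measurableT (measurable_int P If)).
by apply: filterS => w /(_ I) [].
Qed.

Lemma rint_dominated (f_ : nat -> Om -> R) f g :
  (forall k, measurable_fun setT (f_ k)) -> measurable_fun setT f -> integr g ->
  {ae P, forall w, f_ ^~ w @ \oo --> f w} ->
  {ae P, forall w, forall k, `|f_ k w| <= g w} ->
  rint (f_ k) @[k --> \oo] --> rint f.
Proof.
move=> mf_ mf Ig f_f f_g.
have me k : measurable_fun setT (EFin \o f_ k) by exact/measurable_EFinP.
have mfe : measurable_fun setT (EFin \o f) by exact/measurable_EFinP.
have ce : {ae P, forall w, setT w -> EFin (f_ k w) @[k --> \oo] --> EFin (f w)}.
  by apply: filterS f_f => w fw _; apply: cvg_EFin fw; exact: nearW.
have be : {ae P, forall w, forall k, setT w -> (`|EFin (f_ k w)| <= EFin (g w))%E}.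
  by apply: filterS f_g => w fg k _; rewrite lee_fin.
have [If _ cvgf] := dominated_convergence measurableT me mfe ce Ig be.
have If_ k : integr (f_ k).
  apply: (ae_le_integrable (mf_ k) Ig); apply: filterS f_g => w fg.
  exact: le_trans (fg k) (ler_norm _).
have fE : (\int[P]_w (EFin \o f) w)%E = (rint f)%:E by exact: rintE.
by move: cvgf; rewrite fE => /fine_cvgP[_]; apply.
Qed.

Lemma rint_set f (A : set Om) : measurable A -> integr f ->
  (\int[P]_(w in A) (f w)%:E)%E = (rint (fun w => \1_A w * f w))%:E.
Proof.
move=> mA If; rewrite -rintE; last exact: integr_indic.
rewrite integral_mkcond; apply: eq_integral => w _ /=.
by rewrite patchE indicE; case: (w \in A); rewrite ?mul1r ?mul0r.
Qed.

End real_integral.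

(** * Bounded linear functionals on L^oo *)

Section functionals.
Context {d : measure_display} {Om : measurableType d} {R : realType}.
Variable P : probability Om R.
Context {m : nat}.
Implicit Types (x y z v : Om -> 'rV[R]_m) (p : (Om -> 'rV[R]_m) -> R).

Definition cut (A : set Om) z : Om -> 'rV[R]_m := fun w => \1_A w *: z w.

Definition inj_coord (i : 'I_m) (g : Om -> R) : Om -> 'rV[R]_m :=
  fun w => g w *: delta_mx ord0 i.

Definition epr x v : R := rint P (fun w => dot (x w) (v w)).

(** Boundedness against the seminorm [nrm] makes [p] blind to null sets ([bf_ae]), so it amounts to
    an element of the dual of L^oo although it acts on representatives. *)
Definition bounded_functional p := linear_on (Loo P) p /\
  exists K : R, forall z, Loo P z -> `|p z| <= K * nrm P z.

Lemma norm_cut A z w : `|cut A z w| <= `|z w|.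
Proof.
rewrite /cut normrZ indicE; case: (w \in A); rewrite ?normr1 ?mul1r//.
by rewrite normr0 mul0r.
Qed.

Lemma coord_cut A z i : coord (cut A z) i = fun w => \1_A w * coord z i w.
Proof. by apply/funext => w; rewrite /coord /cut mxE. Qed.

Lemma coord_inj_coord i j (g : Om -> R) : coord (inj_coord i g) j = fun w => g w * (j == i)%:R.
Proof. by apply/funext => w; rewrite /coord /inj_coord !mxE eqxx. Qed.

Lemma Loo_cut A z : measurable A -> Loo P z -> Loo P (cut A z).
Proof.
move=> mA /LooP[mz [c zc]]; apply/LooP; split=> [i|].
  by rewrite coord_cut; apply: measurable_funM => //; exact: measurable_indic.
by exists c; apply: filterS zc => w; apply: le_trans; exact: norm_cut.
Qed.

Lemma nrm_cut A z : measurable A -> Loo P z -> nrm P (cut A z) <= nrm P z.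
Proof.
move=> mA Lz; apply: nrm_le; first exact: Loo_cut.
have := nrm_ae Lz; apply: filterS => w; apply: le_trans; exact: norm_cut.
Qed.

Lemma norm_inj_coord i (g : Om -> R) w : `|inj_coord i g w| <= `|g w|.
Proof.
apply: norm_le_coord => // j.
have := coord_inj_coord i j g; rewrite /coord => /(congr1 (fun h => h w)) ->.
by rewrite normrM; case: (j == i); rewrite ?normr1 ?normr0 ?mulr1 ?mulr0.
Qed.

Lemma Loo_inj_coord i (g : Om -> R) (c : R) : measurable_fun setT g ->
  {ae P, forall w, `|g w| <= c} -> Loo P (inj_coord i g).
Proof.
move=> mg gc; apply/LooP; split=> [j|].
  by rewrite coord_inj_coord; apply: measurable_funM.
by exists c; apply: filterS gc => w; apply: le_trans; exact: norm_inj_coord.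
Qed.

Lemma nrm_inj_coord i (g : Om -> R) (c : R) : measurable_fun setT g ->
  {ae P, forall w, `|g w| <= c} -> nrm P (inj_coord i g) <= c.
Proof.
move=> mg gc; apply: nrm_le; first exact: Loo_inj_coord gc.
by apply: filterS gc => w; apply: le_trans; exact: norm_inj_coord.
Qed.

Lemma dot_inj_coord i (g : Om -> R) w (a : 'rV[R]_m) :
  dot (inj_coord i g w) a = g w * a ord0 i.
Proof.
rewrite /dot (bigD1 i)//= big1 ?addr0 => [|j ji].
  by rewrite !mxE !eqxx mulr1.
by rewrite !mxE (negbTE ji) andbF mulr0 mul0r.
Qed.

Lemma sum_inj_coord z : z = \sum_i inj_coord i (coord z i).
Proof.
apply/funext => w; rewrite fct_sumE; apply/rowP => j.
rewrite summxE (bigD1 j)//= big1 ?addr0 => [|i ij].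
  by rewrite !mxE !eqxx mulr1.
by rewrite !mxE [j == i]eq_sym (negbTE ij) andbF mulr0.
Qed.

Lemma pairingE x v : Loo P x -> L1 P v -> pairing P x v = (epr x v)%:E.
Proof.
by move=> Lx Lv; rewrite /pairing unlock rintE//; exact: integrable_dot.
Qed.

Lemma epr_linr (a : R) x v v' : Loo P x -> L1 P v -> L1 P v' ->
  epr x (a *: v + v') = a * epr x v + epr x v'.
Proof.
move=> Lx Lv Lv'; have Iv := integrable_dot Lx Lv.
rewrite /epr -rintZ// -rintD//; last exact: integrable_dot.
  by congr rint; apply/funext => w; rewrite dotDr dotZr.
exact: integrZ.
Qed.

Lemma epr_linl v : L1 P v -> linear_on (Loo P) (epr ^~ v).
Proof.
move=> Lv a x x' Lx Lx'; have Ix := integrable_dot Lx Lv.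
rewrite /epr -rintZ// -rintD//; last exact: integrable_dot.
  by congr rint; apply/funext => w; rewrite dotDl dotZl.
exact: integrZ.
Qed.

Lemma epr_bounded v : L1 P v -> bounded_functional (epr ^~ v).
Proof.
move=> Lv; split; first exact: epr_linl.
have Iv : integr P (fun w => \sum_(i < m) `|coord v i w|).
  rewrite /integr (_ : _ \o _ = (fun w => (\sum_(i < m) (`|coord v i w|)%:E)%E)).
    by apply: integrable_sum => // i _; apply: integrable_norm => //; have /L1P := Lv; exact.
  by apply/funext => w /=; rewrite sumEFin.
exists (rint P (fun w => \sum_(i < m) `|coord v i w|)) => z Lz.
have Iz := integrable_dot Lz Lv.
apply: (le_trans (le_norm_rint Iz)); rewrite mulrC -rintZ//.
apply: rint_ae_le; [exact: integrable_norm|exact: integrZ|].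
have := nrm_ae Lz; apply: filterS => w zw.
rewrite /dot mulr_sumr; apply: (le_trans (ler_norm_sum _ _ _)).
apply: ler_sum => i _; rewrite normrM ler_wpM2r//.
exact: le_trans (coord_le_norm _ _) zw.
Qed.

Section linear.
Variable p : (Om -> 'rV[R]_m) -> R.
Hypothesis p_bd : bounded_functional p.

Let plin : linear_on (Loo P) p := p_bd.1.

Lemma bf0 : p 0 = 0.
Proof.
have := plin 1 (@Loo0 _ _ _ P m) (@Loo0 _ _ _ P m).
by rewrite scale1r addr0 mul1r; lra.
Qed.

Lemma bfD u v : Loo P u -> Loo P v -> p (u + v) = p u + p v.
Proof. by move=> Lu Lv; rewrite -[u in LHS]scale1r plin// mul1r. Qed.

Lemma bfZ (a : R) u : Loo P u -> p (a *: u) = a * p u.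
Proof.
by move=> Lu; rewrite -[_ *: _ in LHS]addr0 plin ?bf0 ?addr0//; exact: Loo0.
Qed.

Lemma bfB u v : Loo P u -> Loo P v -> p (u - v) = p u - p v.
Proof.
move=> Lu Lv; rewrite bfD//; last exact: LooN.
by rewrite -scaleN1r bfZ// mulN1r.
Qed.

Lemma bf_ae u v : Loo P u -> Loo P v -> {ae P, forall w, u w = v w} -> p u = p v.
Proof.
move=> Lu Lv uv; apply/eqP; rewrite -subr_eq0 -bfB// -normr_le0.
have [K pK] := p_bd.2; apply: (le_trans (pK _ (LooB Lu Lv))).
rewrite ae_nrm_eq0 ?mulr0//; first exact: LooB.
by apply: filterS uv => w uvw; rewrite fctE uvw subrr.
Qed.

Lemma bf_sum (I : Type) (r : seq I) (u : I -> Om -> 'rV[R]_m) :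
  (forall i, Loo P (u i)) ->
  p (\sum_(i <- r) u i) = \sum_(i <- r) p (u i) /\ Loo P (\sum_(i <- r) u i).
Proof.
move=> Lu; elim: r => [|i r [IH IL]].
  by rewrite !big_nil bf0; split => //; exact: Loo0.
by rewrite !big_cons bfD// IH; split => //; exact: LooD.
Qed.

(** The coordinates of [z] are bounded only a.e.; truncated at [|c|] they become bounded everywhere,
    as [bounded_linear_eq0] requires, and [p] does not see the change. *)
Lemma bf_eq0 : (forall A i, measurable A -> p (inj_coord i \1_A) = 0) ->
  forall z, Loo P z -> p z = 0.
Proof.
move=> p0 z /[dup] Lz /LooP[mz [c zc]].
pose z' : Om -> 'rV[R]_m :=
  \sum_i inj_coord i (fun w => Num.min (Num.max (coord z i w) (- `|c|)) `|c|).
have mt i : measurable_fun setT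
    (fun w => Num.min (Num.max (coord z i w) (- `|c|)) `|c|).
  by apply: measurable_minr => //; apply: measurable_maxr.
have bt i : bounded_by (fun w => Num.min (Num.max (coord z i w) (- `|c|)) `|c|) `|c|.
  move=> w; rewrite ler_norml ge_min lexx orbT andbT le_min le_max lexx orbT /=.
  by have := normr_ge0 c; lra.
have Li i := Loo_inj_coord i (mt i) (aeW P (bt i)).
have [pz' Lz'] := bf_sum (index_enum 'I_m) Li.
rewrite (bf_ae Lz Lz'); last first.
  apply: filterS zc => w zw; rewrite {1}(sum_inj_coord z) !fct_sumE.
  apply: eq_bigr => i _; rewrite /inj_coord; congr (_ *: _).
  have := le_trans (coord_le_norm (z w) i) (le_trans zw (ler_norm c)).
  by rewrite ler_norml => /andP[h1 h2]; rewrite max_l// min_l.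
rewrite pz' big1// => i _.
have [K pK] := p_bd.2.
apply: (@bounded_linear_eq0 _ _ _ (fun g => p (inj_coord i g)) `|K| _ _ _ _ `|c|) => //.
- move=> a b g h e e' mg mh ge he.
  have Lg := Loo_inj_coord i mg (aeW P ge); have Lh := Loo_inj_coord i mh (aeW P he).
  rewrite -bfZ// -[b * _]bfZ// -bfD; [|exact: LooZ..].
  congr p; apply/funext => w; rewrite !fctE /inj_coord /= scalerDl.
  by rewrite !scalerA.
- move=> g e mg ge; apply: (le_trans (pK _ (Loo_inj_coord i mg (aeW P ge)))).
  have := nrm_inj_coord i mg (aeW P ge); have := nrm_ge0 P (inj_coord i g).
  move=> n0 ne; apply: (le_trans (ler_wpM2r n0 (ler_norm K))).
  by rewrite ler_wpM2l.
- by move=> A mA; exact: p0.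
Qed.

End linear.

Lemma bf_sub p q : bounded_functional p -> bounded_functional q ->
  bounded_functional (fun z => p z - q z).
Proof.
move=> [pl [K pK]] [ql [L qL]]; split=> [a u v Lu Lv|].
  by rewrite pl// ql//; ring.
exists (K + L) => z Lz; apply: (le_trans (ler_normB _ _)).
by rewrite mulrDl; apply: lerD; [exact: pK|exact: qL].
Qed.

Lemma bf_add p q : bounded_functional p -> bounded_functional q ->
  bounded_functional (fun z => p z + q z).
Proof.
move=> [pl [K pK]] [ql [L qL]]; split=> [a u v Lu Lv|].
  by rewrite pl// ql//; ring.
exists (K + L) => z Lz; apply: (le_trans (ler_normD _ _)).
by rewrite mulrDl; apply: lerD; [exact: pK|exact: qL].
Qed.

End functionals.

(** * The countably additive part of a bounded functional *)

Section countably_additive_part.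
Context {d : measure_display} {Om : measurableType d} {R : realType}.
Variable P : probability Om R.
Context {m : nat}.
Implicit Types (x y z : Om -> 'rV[R]_m).
Variable p : (Om -> 'rV[R]_m) -> R.
Hypothesis p_bd : bounded_functional P p.

(* [mu] is the total variation of [p]; it is only finitely additive. *)
Let values (A : set Om) :=
  [set p (cut A z) | z in [set z | Loo P z /\ nrm P z <= 1]].

Let mu (A : set Om) : R := sup (values A).

Let values0 A : values A !=set0.
Proof.
exists (p (cut A 0)); exists 0 => //; split; first exact: Loo0.
rewrite (_ : nrm P 0 = 0) ?ler01//; apply: ae_nrm_eq0; first exact: Loo0.
exact: aeW.
Qed.

Let values_ub A : measurable A -> has_ubound (values A).
Proof.
move=> mA; have [K pK] := p_bd.2; exists `|K| => _ [z [Lz z1] <-].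
apply: (le_trans (ler_norm _)); apply: (le_trans (pK _ (Loo_cut mA Lz))).
apply: (le_trans (ler_wpM2r (nrm_ge0 _ _) (ler_norm K))).
by rewrite ler_piMr// (le_trans (nrm_cut mA Lz)).
Qed.

Let mu_ub A z : measurable A -> Loo P z -> nrm P z <= 1 -> p (cut A z) <= mu A.
Proof. by move=> mA Lz z1; apply: ub_le_sup; [exact: values_ub|exists z]. Qed.

Let cutZ A (a : R) z : cut A (a *: z) = a *: cut A z.
Proof. by apply/funext => w; rewrite fctE /cut /= scalerA mulrC -scalerA. Qed.

Let cutN A z : cut A (- z) = - cut A z.
Proof. by rewrite -scaleN1r cutZ scaleN1r. Qed.

Let mu_norm A z : measurable A -> Loo P z -> `|p (cut A z)| <= mu A * nrm P z.
Proof.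
move=> mA.
suff h u : Loo P u -> p (cut A u) <= mu A * nrm P u.
  move=> Lz; rewrite ler_norml h// andbT.
  have := h _ (LooN Lz); rewrite cutN nrmN// -scaleN1r (bfZ p_bd) ?mulN1r; first lra.
  exact: Loo_cut.
move=> Lu; have := nrm_ge0 P u; rewrite le_eqVlt => /predU1P[u0|u0].
  have [K pK] := p_bd.2; rewrite -u0 mulr0.
  apply: (le_trans (ler_norm _)); apply: (le_trans (pK _ (Loo_cut mA Lu))).
  rewrite (_ : nrm P (cut A u) = 0) ?mulr0//; apply: le_anti.
  by rewrite nrm_ge0 andbT u0; exact: nrm_cut.
rewrite -ler_pdivrMr// mulrC -(bfZ p_bd); last exact: Loo_cut.
rewrite -cutZ; apply: mu_ub => //; first exact: LooZ.
apply: (le_trans (nrmZ _ Lu)); rewrite gtr0_norm ?invr_gt0//.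
by rewrite mulVf// gt_eqF.
Qed.

Let mu_ge0 A : measurable A -> 0 <= mu A.
Proof.
move=> mA; have := mu_ub mA (@Loo0 _ _ _ P m).
rewrite (_ : nrm P 0 = 0) ?ler01; last first.
  by apply: ae_nrm_eq0; [exact: Loo0|exact: aeW].
move=> /(_ isT); rewrite (_ : cut A 0 = 0) ?(bf0 p_bd)//.
by apply/funext => w; rewrite /cut scaler0.
Qed.

Let cutU A B z : A `&` B = set0 -> cut (A `|` B) z = cut A z + cut B z.
Proof.
move=> AB; apply/funext => w; rewrite fctE /cut -scalerDl; congr (_ *: _).
rewrite !indicE in_setU; have [wA|wA] := boolP (w \in A); last by rewrite add0r.
have -> : w \in B = false; last by rewrite addr0.
apply/negbTE/negP => /set_mem wB; move/seteqP : AB => [/(_ w) + _]; apply.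
by split => //; exact: set_mem.
Qed.

Let cut_cut A B z : cut A (cut B z) = cut (A `&` B) z.
Proof.
apply/funext => w; rewrite /cut scalerA; congr (_ *: _).
by rewrite !indicE in_setI -natrM mulnb.
Qed.

Let cutD A z z' : cut A (z + z') = cut A z + cut A z'.
Proof. by apply/funext => w; rewrite fctE /cut scalerDr. Qed.

Let cut0 z : cut set0 z = 0.
Proof. by apply/funext => w; rewrite /cut indicE in_set0 scale0r. Qed.

(** For the lower bound, a test vector on [A] and one on [B] are glued; disjointness keeps the sup
    norm of the result at most 1. *)
Let muU A B : measurable A -> measurable B -> A `&` B = set0 ->
  mu (A `|` B) = mu A + mu B.
Proof.
move=> mA mB AB; have mAB := measurableU _ _ mA mB.
apply/eqP; rewrite eq_le; apply/andP; split.
  apply: ge_sup => // _ [z [Lz z1] <-].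
  rewrite cutU// (bfD p_bd) ?lerD ?mu_ub//; exact: Loo_cut.
rewrite -lerBrDr; apply: ge_sup => // _ [z [Lz z1] <-].
rewrite lerBrDr -lerBrDl; apply: ge_sup => // _ [z' [Lz' z1'] <-].
rewrite lerBrDl.
have LA := Loo_cut mA Lz; have LB := Loo_cut mB Lz'.
have -> : p (cut A z) + p (cut B z') = p (cut (A `|` B) (cut A z + cut B z')).
  rewrite -(bfD p_bd)// cutU// !cutD !cut_cut !setIid AB setIC AB !cut0.
  by rewrite addr0 add0r.
apply: mu_ub => //; first exact: LooD.
apply: nrm_le; first exact: LooD.
have := nrm_ae Lz'; have := nrm_ae Lz; apply: filterS2 => w zw zw'.
have [wA|wA] := boolP (w \in A).
  have wB : w \notin B.
    apply/negP => /set_mem wB; move/seteqP : AB => [/(_ w) + _]; apply.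
    by split => //; exact: set_mem.
  rewrite fctE /cut !indicE wA (negbTE wB) scale1r scale0r addr0.
  exact: le_trans zw z1.
rewrite fctE {1}/cut indicE (negbTE wA) scale0r add0r.
exact: le_trans (norm_cut _ _ _) (le_trans zw' z1').
Qed.

Let muD A B : measurable A -> measurable B -> A `<=` B ->
  mu (B `\` A) = mu B - mu A.
Proof.
move=> mA mB AB; rewrite -[in mu B](setDUK AB) muU//; first by lra.
- exact: measurableD.
- by rewrite setDE setICA setICr setI0.
Qed.

Let mu_mono A B : measurable A -> measurable B -> A `<=` B -> mu A <= mu B.
Proof.
move=> mA mB AB; have := mu_ge0 (measurableD mB mA).
by rewrite muD//; lra.
Qed.

Let small (e : R) := [set D | measurable D /\ (P D <= e%:E)%E].
(* The sets [E_ k] below are unions of nearly optimal sets for [best 2^-k]. *)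
Let best (e : R) : R := inf [set mu (~` D) | D in small e].

Let best_lb e : has_lbound [set mu (~` D) | D in small e].
Proof. by exists 0 => _ [D [mD _] <-]; apply: mu_ge0; exact: measurableC. Qed.

Let best0 e : 0 <= e -> [set mu (~` D) | D in small e] !=set0.
Proof.
move=> e0; exists (mu (~` set0)); exists set0 => //; split => //.
by rewrite measure0 lee_fin.
Qed.

Let best_le e D : measurable D -> (P D <= e%:E)%E -> best e <= mu (~` D).
Proof. by move=> mD De; apply: ge_inf => //; exists D. Qed.

(** Since [best e] grows as e decreases, this is its limit for e -> 0: the variation that survives
    the removal of sets of vanishing probability. *)
Let alpha : R := sup [set best e | e in [set e : R | 0 < e]].

Let alpha_ub : has_ubound [set best e | e in [set e : R | 0 < e]].
Proof.
exists (mu (~` set0)) => _ [e /= e0 <-]; apply: best_le => //.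
by rewrite measure0 lee_fin ltW.
Qed.

Let best_alpha e : 0 < e -> best e <= alpha.
Proof. by move=> e0; apply: ub_le_sup; [exact: alpha_ub|exists e]. Qed.

Let best_near e : 0 < e -> exists2 eps : R, 0 < eps & alpha - e < best eps.
Proof.
move=> e0; have hs : has_sup [set best e | e in [set e : R | 0 < e]].
  by split; [exists (best 1), 1 => /=|exact: alpha_ub].
have [_ [eps /= eps0 <-] ?] := sup_adherent e0 hs.
by exists eps.
Qed.

Let exD k : exists D, [/\ measurable D, (P D <= (1 / (2 ^ k.+1)%:R)%:E)%E &
  mu (~` D) <= alpha + 1 / (2 ^ k.+1)%:R].
Proof.
have e0 : 0 < 1 / (2 ^ k.+1)%:R :> R by rewrite divr_gt0// ltr0n expn_gt0.
have [_ [D [mD De] <-] muD'] := inf_adherent e0 (conj (best0 (ltW e0)) (best_lb _)).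
exists D; split => //; apply: (le_trans (ltW muD')).
by rewrite lerD2r best_alpha.
Qed.

Let D_ k := projT1 (cid (exD k)).
Let mD k : measurable (D_ k).
Proof. by have [] := projT2 (cid (exD k)). Qed.
Let E_ k := \bigcup_(j >= k) D_ j.

Let mE k : measurable (E_ k). Proof. exact: bigcup_measurable. Qed.

Let E_dec k l : (k <= l)%N -> E_ l `<=` E_ k.
Proof. by move=> kl w [j /= lj Dw]; exists j => //=; exact: leq_trans lj. Qed.

Let E_null : P (\bigcap_k E_ k) = 0%E.
Proof.
(* Borel-Cantelli: the probabilities of the [D_ k] are at most 2^-(k+1), hence summable. *)
apply: (lim_sup_set_cvg0 (F := D_)) => //.
apply: (@le_lt_trans _ _ (1 : R)%:E); last exact: ltry.
apply: le_trans (epsilon_trick0 (R := R) xpredT ler01).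
apply: lee_nneseries => // k _.
by have [] := projT2 (cid (exD k)).
Qed.

Let E_small (e : R) : 0 < e -> exists N, forall k, (N <= k)%N -> (P (E_ k) < e%:E)%E.
Proof.
move=> e0; have : P \o E_ @ \oo --> P (\bigcap_k E_ k).
  apply: nonincreasing_cvg_mu => //.
  - by apply: (le_lt_trans (probability_le1 P (mE 0%N))); exact: ltry.
  - exact: bigcapT_measurable.
  - by move=> k l kl; apply/subsetPset; exact: E_dec.
rewrite E_null => /fine_cvgP[_ /cvgrPdist_lt /(_ _ e0)] [N _ NE].
exists N => k Nk; have := NE k Nk; rewrite /= sub0r normrN.
rewrite ger0_norm ?fine_ge0// => h.
by rewrite -(@fineK _ (P (E_ k))) ?lte_fin// fin_num_measure.
Qed.

Let mu_E (e : R) : 0 < e -> exists N, forall k, (N <= k)%N -> mu (~` E_ k) <= alpha + e.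
Proof.
move=> e0; have [N _ NE] := near_infty_natSinv_expn_lt (PosNum e0).
exists N => k Nk; have [_ _ h] := projT2 (cid (exD k)).
apply: (@le_trans _ _ (mu (~` D_ k))).
  apply: mu_mono; [exact: measurableC..|].
  by apply: subsetC => w Dw; exists k => //=.
apply: (le_trans h); rewrite lerD2l; apply: ltW; apply: le_lt_trans (NE k Nk).
rewrite natrX ler_wpM2l// lef_pV2 ?posrE ?exprn_gt0//.
by rewrite exprS ler_peMl ?exprn_ge0// ler1n.
Qed.

(* Otherwise removing [A] together with a far tail set would beat [alpha]. *)
Let mu_ac (e : R) : 0 < e -> exists2 del : R, 0 < del &
  forall A k, measurable A -> (P A < del%:E)%E -> mu (A `&` ~` E_ k) <= e.
Proof.
move=> e0; have e20 : 0 < e / 2 by rewrite divr_gt0.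
have [eps eps0 be] := best_near e20.
exists (eps / 2); first by rewrite divr_gt0.
move=> A k mA PA.
have [N1 hN1] := mu_E e20.
have [N2 hN2] := E_small (divr_gt0 eps0 (ltr0n R 2)).
pose l := maxn k (maxn N1 N2).
have kl : (k <= l)%N by rewrite leq_maxl.
have := hN1 l; rewrite /l !leq_max leqnn orbT /= => /(_ isT); rewrite -/l => muEl.
have := hN2 l; rewrite /l !leq_max leqnn !orbT /= => /(_ isT); rewrite -/l => PEl.
have mB : measurable (A `&` ~` E_ k) by apply: measurableI => //; exact: measurableC.
have mDD : measurable (E_ l `|` (A `&` ~` E_ k)) by apply: measurableU.
have PD : (P (E_ l `|` (A `&` ~` E_ k)) <= eps%:E)%E.
  apply: (le_trans (measureU2 _ _ _)) => //.
  rewrite (splitr eps) EFinD; apply: leeD; first exact: ltW.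
  apply: (le_trans _ (ltW PA)); apply: le_measure; rewrite ?inE//.
have := best_le mDD PD; rewrite setCU -setDE muD//; first by lra.
- exact: measurableC.
- by move=> w [_ nE] El; apply: nE; exact: E_dec kl _ El.
Qed.

Let pk k z := p (cut (~` E_ k) z).

(** From [k] to [l] the functional changes by its part on [E_ k] minus [E_ l]. The [del] of [mu_ac]
    does not depend on the index, so this part is small, uniformly in [l], once [P (E_ k)] is below
    [del]. *)
Let pk_cauchy (e : R) : 0 < e -> exists N, forall z k l, Loo P z ->
  (N <= k)%N -> (k <= l)%N -> `|pk l z - pk k z| <= e * nrm P z.
Proof.
move=> e0; have [del del0 hd] := mu_ac e0.
have [N hN] := E_small del0.
exists N => z k l Lz Nk kl.
have -> : pk l z - pk k z = p (cut (E_ k `&` ~` E_ l) z).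
  have Ekl : ~` E_ l = ~` E_ k `|` (E_ k `&` ~` E_ l).
    rewrite setUIr setUC setUCr setTI setUC; apply/esym/setUidPl.
    by apply: subsetC; exact: E_dec.
  rewrite /pk Ekl cutU; last by rewrite setIA setICl set0I.
  rewrite -Ekl (bfD p_bd); [by lra|apply: Loo_cut => //..].
    exact: measurableC.
  by apply: measurableI => //; exact: measurableC.
apply: (le_trans (mu_norm _ Lz)).
  by apply: measurableI => //; exact: measurableC.
by apply: ler_wpM2r; [exact: nrm_ge0|exact: hd (hN k Nk)].
Qed.

Let pinf z := lim (pk k z @[k --> \oo]).

Let pk_cvg z : Loo P z -> pk k z @[k --> \oo] --> pinf z.
Proof.
move=> Lz; apply: cauchy_cvg; apply: cauchy_exP => e e0.
have n0 : 0 < nrm P z + 1 by rewrite ltr_wpDl// nrm_ge0.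
have [N hN] := pk_cauchy (divr_gt0 e0 n0).
exists (pk N z); exists N => // k /= Nk; rewrite /ball/= distrC.
apply: (le_lt_trans (hN z N k Lz (leqnn N) Nk)).
by rewrite -mulrA gtr_pMr// mulrC ltr_pdivrMr// mul1r ltrDl.
Qed.

Let pinf_bd : bounded_functional P pinf.
Proof.
have [K pK] := p_bd.2; split=> [a u v Lu Lv|].
  apply: (@cvg_unique _ (@Rhausdorff R) (pk k (a *: u + v) @[k --> \oo])) => //.
    by apply: pk_cvg; exact: LooS.
  have -> : (fun k => pk k (a *: u + v)) = (fun k => a * pk k u + pk k v).
    apply/funext => k; rewrite /pk cutD cutZ p_bd.1//.
      by apply: Loo_cut => //; exact: measurableC.
    by apply: Loo_cut => //; exact: measurableC.
  by apply: cvgD; [apply: cvgMr|]; exact: pk_cvg.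
exists `|K| => z Lz; rewrite -(ger0_norm (nrm_ge0 P z)) -normrM.
have /cvg_norm cn := pk_cvg Lz.
rewrite -(cvg_lim _ cn)//; apply: limr_le; first by apply: cvgP cn.
apply: nearW => k; rewrite normrM [X in _ * X]ger0_norm ?nrm_ge0//.
have mEk := measurableC (mE k).
apply: (le_trans (pK _ (Loo_cut mEk Lz))).
apply: (le_trans (ler_wpM2r (nrm_ge0 _ _) (ler_norm K))).
by rewrite ler_wpM2l// nrm_cut.
Qed.

Let pinf_ac i (e : R) : 0 < e -> exists2 del : R, 0 < del &
  forall A, measurable A -> (P A < del%:E)%E -> `|pinf (inj_coord i \1_A)| <= e.
Proof.
move=> e0; have [del del0 hd] := mu_ac e0; exists del => // A mA PA.
have b1 : {ae P, forall w, `|\1_A w : R| <= 1}.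
  apply: aeW => w; rewrite indicE; case: (w \in A); rewrite ?normr1 ?normr0//.
have mi : measurable_fun setT (\1_A : Om -> R) by exact: measurable_indic.
have mT : {ae P, forall w, `|(cst 1 : Om -> R) w| <= 1}.
  by apply: aeW => w; rewrite normr1.
have L1 := Loo_inj_coord i (measurable_cst (1 : R)) mT.
have LA := Loo_inj_coord i mi b1.
have /cvg_norm cn := pk_cvg LA.
rewrite -(cvg_lim _ cn)//; apply: limr_le; first by apply: cvgP cn.
apply: nearW => k.
have -> : pk k (inj_coord i \1_A) = p (cut (A `&` ~` E_ k) (inj_coord i (cst 1))).
  rewrite setIC -cut_cut /pk; congr (p (cut _ _)).
  by apply/funext => w; rewrite /cut /inj_coord scale1r.
have mAE : measurable (A `&` ~` E_ k) by apply: measurableI => //; exact: measurableC.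
apply: (le_trans (mu_norm mAE L1)); apply: (@le_trans _ _ (e * 1)); last by rewrite mulr1.
apply: ler_pM; [exact: mu_ge0|exact: nrm_ge0|exact: hd|].
exact: nrm_inj_coord (measurable_cst (1 : R)) mT.
Qed.

(* A form of the Yosida-Hewitt decomposition: the singular part [p - y] lives on
   the sets [E k], which decrease to a null set. *)
Lemma countably_additive_part : exists y (E : nat -> set Om),
  [/\ L1 P y, forall k, measurable (E k),
      forall k l, (k <= l)%N -> E l `<=` E k, P (\bigcap_k E k) = 0%E &
      forall z, Loo P z -> p (cut (~` E k) z) @[k --> \oo] --> epr P z y].
Proof.
have dens i : exists2 g : Om -> R, P.-integrable setT (EFin \o g) &
    forall A, measurable A ->
      (pinf (inj_coord i \1_A))%:E = (\int[P]_(w in A) (g w)%:E)%E.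
  apply: ac_density; last exact: pinf_ac.
  have Li A : measurable A -> Loo P (inj_coord i \1_A).
    move=> mA; apply: (@Loo_inj_coord _ _ _ _ _ _ _ 1); first exact: measurable_indic.
    by apply: aeW => w; rewrite indicE; case: (w \in A); rewrite ?normr1 ?normr0.
  move=> A B mA mB AB; rewrite -(bfD pinf_bd); [|exact: Li..].
  congr pinf; apply/funext => w; rewrite fctE /inj_coord -scalerDl; congr (_ *: _).
  rewrite !indicE in_setU; have [wA|wA] := boolP (w \in A); last by rewrite add0r.
  have -> : w \in B = false; last by rewrite addr0.
  apply/negbTE/negP => /set_mem wB; move/seteqP : AB => [/(_ w) + _]; apply.
  by split => //; exact: set_mem.
have /choice[g_ g_P] : forall i, exists g : Om -> R, P.-integrable setT (EFin \o g) /\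
    forall A, measurable A ->
      (pinf (inj_coord i \1_A))%:E = (\int[P]_(w in A) (g w)%:E)%E.
  by move=> i; have [g gi gA] := dens i; exists g.
pose y w : 'rV[R]_m := \row_i g_ i w.
have cy i : coord y i = g_ i by apply/funext => w; rewrite /coord mxE.
have Ly : L1 P y by apply/L1P => i; rewrite cy; have [] := g_P i.
exists y, E_; split => // z Lz.
suff -> : epr P z y = pinf z by exact: pk_cvg.
apply/eqP; rewrite eq_sym -subr_eq0; apply/eqP.
apply: (bf_eq0 (bf_sub pinf_bd (epr_bounded Ly))) => // A i mA.
have [gi gA] := g_P i.
apply/eqP; rewrite subr_eq0; apply/eqP/EFin_inj; rewrite gA//.
rewrite rint_set//; congr EFin; apply: eq_Rintegral => w _.
by rewrite dot_inj_coord -/(coord y i w) cy.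
Qed.

End countably_additive_part.

(** * Conditional expectations *)

Section conditional_expectation.
Context {d : measure_display} {Om : measurableType d} {R : realType}.
Variables (P : probability Om R) (G : set (set Om)).
Hypothesis G_sigma : sigma_algebra [set: Om] G.
Hypothesis G_sub : G `<=` measurable.
Implicit Types v w : Om -> R.

Local Notation OmG := (g_sigma_algebraType G).

Lemma G_measurableE (A : set Om) : measurable (A : set OmG) <-> G A.
Proof.
by rewrite -[X in X <-> _]/(<<s G >> A) sigma_algebra_id.
Qed.

(** The identity as a measurable map to the coarser space; its law [PG] is the restriction of [P] to
    [G], as a probability on [OmG]. *)
Let idG : Om -> OmG := fun x => x.

Let measurable_idG : measurable_fun setT idG.
Proof.
move=> _ A /G_measurableE GA; rewrite setTI; exact: G_sub.
Qed.

HB.instance Definition _ := isMeasurableFun.Build _ _ _ _ idG measurable_idG.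

Let PG := distribution P [the {mfun Om >-> OmG} of idG].

Lemma G_measurable_fun w : measurable_fun [set: OmG] (w : OmG -> R) ->
  measurable_fun [set: Om] w.
Proof.
move=> mw _ B mB; rewrite setTI; apply: G_sub; apply/G_measurableE.
by rewrite -[X in measurable X]setTI; exact: mw.
Qed.

Lemma cond_exp_rint v w (A : set Om) : integr P v -> integr P w -> G A ->
  (\int[P]_(x in A) (w x)%:E = \int[P]_(x in A) (v x)%:E)%E <->
  rint P (fun x => \1_A x * w x) = rint P (fun x => \1_A x * v x).
Proof.
move=> Iv Iw /G_sub mA; rewrite !rint_set//.
by split=> [[]|->].
Qed.

(** Radon-Nikodym on the coarse space: the density of A |-> E[1_A v] with respect to [PG] is
    measurable for [G] by construction. *)
Lemma cond_exp_exists v : integr P v -> exists w, is_cond_exp P G v w.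
Proof.
move=> Iv.
pose la (A : set OmG) := rint P (fun x => \1_A x * v x).
have laD (A B : set OmG) : measurable A -> measurable B -> A `&` B = set0 ->
    la (A `|` B) = la A + la B.
  move=> /G_measurableE/G_sub mA /G_measurableE/G_sub mB AB.
  rewrite /la -rintD; [|exact: integr_indic..].
  congr rint; apply/funext => x; rewrite -mulrDl; congr (_ * _).
  rewrite !indicE in_setU; have [xA|xA] := boolP (x \in A); last by rewrite add0r.
  have -> : x \in B = false; last by rewrite addr0.
  apply/negbTE/negP => /set_mem xB; move/seteqP : AB => [/(_ x) + _]; apply.
  by split => //; exact: set_mem.
have la_ac (e : R) : 0 < e -> exists2 del : R, 0 < del &
    forall A, measurable A -> (PG A < del%:E)%E -> `|la A| <= e.
  move=> e0; have [del [del0 hd]] := integral_normr_continuous Iv e0.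
  exists del => // A /G_measurableE/G_sub mA PA.
  have := hd A mA PA; rewrite Rintegral_mkcond => /ltW; apply: le_trans.
  apply: (le_trans (le_norm_rint (integr_indic mA Iv))).
  rewrite /rint le_eqVlt; apply/orP; left; apply/eqP; apply: eq_Rintegral => x _.
  by rewrite patchE indicE normrM; case: (x \in A); rewrite ?normr1 ?mul1r ?normr0 ?mul0r.
have [y Iy yE] := ac_density laD la_ac.
have my : measurable_fun [set: OmG] y by apply/measurable_EFinP; exact: (measurable_int PG Iy).
have my' := G_measurable_fun my.
have Iy' : integr P y.
  apply/integrableP; split; first exact/measurable_EFinP.
  have /integrableP[_] := Iy.
  rewrite /PG ge0_integral_distribution//.
  by apply/measurable_EFinP; exact: measurableT_comp.
exists y; split => //; first exact/Lfun1_integrable.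
move=> A GA; apply/cond_exp_rint => //.
have mA : measurable (A : set OmG) by apply/G_measurableE.
apply: EFin_inj; rewrite -[RHS]/(la A)%:E yE// -rintE; last first.
  by apply: integr_indic => //; exact: G_sub.
rewrite [RHS]integral_mkcond.
have -> : (fun x => (y x)%:E) \_ A = EFin \o (fun x => \1_A x * y x).
  apply/funext => x /=; rewrite patchE indicE.
  by case: (x \in A); rewrite ?mul1r ?mul0r.
rewrite /PG integral_distribution//; last exact: (integr_indic (G_sub GA) Iy').
by apply/measurable_EFinP; apply: measurable_funM => //; exact: measurable_indic.
Qed.

Lemma cond_exp_integr v w : is_cond_exp P G v w -> integr P w.
Proof. by case=> _ /Lfun1_integrable. Qed.

(** The difference of the two sides is linear in [g], bounded in sup norm and zero on indicators of
    sets of [G]; [bounded_linear_eq0] applies on the space [OmG]. *)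
Lemma cond_exp_pullout v w (g : Om -> R) (c : R) : integr P v -> is_cond_exp P G v w ->
  measurable_fun [set: OmG] (g : OmG -> R) -> bounded_by g c ->
  rint P (fun x => g x * w x) = rint P (fun x => g x * v x).
Proof.
move=> Iv vw mg gc; have Iw := cond_exp_integr vw.
have IM u h (e : R) : integr P u -> measurable_fun [set: OmG] (h : OmG -> R) ->
    bounded_by h e -> integr P (fun x => h x * u x).
  by move=> Iu mh he; apply: integr_bddM (aeW P he) Iu; exact: G_measurable_fun.
apply/eqP; rewrite -subr_eq0; apply/eqP.
apply: (@bounded_linear_eq0 _ OmG R
  (fun g => rint P (fun x => g x * w x) - rint P (fun x => g x * v x))
  (rint P (fun x => `|w x|) + rint P (fun x => `|v x|)) _ _ _ g c) => //.
- move=> a b h k e e' mh mk he ke.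
  have E u : integr P u -> rint P (fun x => (a * h x + b * k x) * u x) =
      a * rint P (fun x => h x * u x) + b * rint P (fun x => k x * u x).
    move=> Iu; have Ih := IM _ _ _ Iu mh he; have Ik := IM _ _ _ Iu mk ke.
    rewrite -!rintZ// -rintD; [|exact: integrZ..].
    by congr rint; apply/funext => x; ring.
  by rewrite !E//; ring.
- move=> h e mh he; apply: (le_trans (ler_normB _ _)).
  have B u : integr P u -> `|rint P (fun x => h x * u x)| <= rint P (fun x => `|u x|) * e.
    move=> Iu; have In : integr P (fun x => `|u x|) by exact: integrable_norm.
    apply: (le_trans (le_norm_rint (IM _ _ _ Iu mh he))).
    rewrite mulrC -rintZ//; apply: rint_ae_le; last by apply: aeW => x; rewrite normrM ler_wpM2r.
      by apply: integrable_norm => //; exact: IM he.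
    exact: integrZ.
  by rewrite mulrDl lerD// B.
- move=> A /G_measurableE GA; apply/eqP; rewrite subr_eq0; apply/eqP.
  by apply/(cond_exp_rint Iv Iw GA); have [_ _] := vw; apply.
Qed.

Lemma cond_exp_lin (a : R) v w v' w' : integr P v -> integr P v' ->
  is_cond_exp P G v w -> is_cond_exp P G v' w' ->
  is_cond_exp P G (fun x => a * v x + v' x) (fun x => a * w x + w' x).
Proof.
move=> Iv Iv' vw vw'; have Iw := cond_exp_integr vw; have Iw' := cond_exp_integr vw'.
have [mw _ wE] := vw; have [mw' _ wE'] := vw'.
have I1 := integrD (integrZ a Iv) Iv'; have I2 := integrD (integrZ a Iw) Iw'.
split; [|exact/Lfun1_integrable|].
  by apply: measurable_funD => //; apply: measurable_funM.
move=> A GA; apply/cond_exp_rint => //.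
have E u u' : integr P u -> integr P u' ->
    rint P (fun x => \1_A x * (a * u x + u' x)) =
    a * rint P (fun x => \1_A x * u x) + rint P (fun x => \1_A x * u' x).
  move=> Iu Iu'; have J := integr_indic (G_sub GA) Iu.
  rewrite -rintZ// -rintD; [|exact: integrZ|exact: integr_indic (G_sub GA) Iu'].
  by congr rint; apply/funext => x; ring.
rewrite !E//; congr (a * _ + _); apply/cond_exp_rint => //; [exact: wE|exact: wE'].
Qed.

(** The set where w > c belongs to [G]. On it, w - c is positive, yet has the same integral as v -
    c, which is a.e. nonpositive. *)
Lemma cond_exp_ub v w (c : R) : integr P v -> is_cond_exp P G v w ->
  {ae P, forall x, v x <= c} -> {ae P, forall x, w x <= c}.
Proof.
move=> Iv vw vc; have Iw := cond_exp_integr vw; have [mw _ wE] := vw.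
pose A : set Om := [set x | c < w x].
have GA : G A.
  apply/G_measurableE; rewrite (_ : A = setT `&` w @^-1` `]c, +oo[); first exact: mw.
  by rewrite setTI; apply/seteqP; split => x /=; rewrite in_itv/= andbT.
have mA := G_sub GA.
have IA u : integr P u -> integr P (fun x => \1_A x * (u x - c)).
  by move=> Iu; apply: integr_indic => //; apply: integrB => //; exact: integr_cst.
have EA u : integr P u -> rint P (fun x => \1_A x * (u x - c)) =
    rint P (fun x => \1_A x * u x) - rint P (fun x => \1_A x * c).
  move=> Iu; rewrite -rintB; [|exact: integr_indic|]; last first.
    by apply: integr_indic => //; exact: integr_cst.
  by congr rint; apply/funext => x; rewrite mulrBr.
have wv : rint P (fun x => \1_A x * (w x - c)) = rint P (fun x => \1_A x * (v x - c)).
  by rewrite !EA//; congr (_ - _); apply/cond_exp_rint => //; exact: wE.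
have w0 x : 0 <= \1_A x * (w x - c).
  rewrite indicE; have [/set_mem xA|_] := boolP (x \in A); last by rewrite mul0r.
  by rewrite mul1r subr_ge0 ltW.
have : rint P (fun x => \1_A x * (w x - c)) <= 0.
  rewrite wv -(rint_cst P 0); apply: rint_ae_le; [exact: IA|exact: integr_cst|].
  apply: filterS vc => x vxc; rewrite indicE; case: (x \in A); last by rewrite mul0r.
  by rewrite mul1r subr_le0.
move=> le0; have Ie := IA _ Iw.
move: (rint_ae_eq0 Ie (aeW P w0) le0).
apply: filterS => x /eqP; rewrite indicE leNgt; apply: contraL => cw.
by rewrite mem_set// mul1r subr_eq0 gt_eqF.
Qed.

Lemma cond_expN v w : integr P v -> is_cond_exp P G v w ->
  is_cond_exp P G (fun x => - v x) (fun x => - w x).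
Proof.
move=> Iv vw; have I0 := integr_cst P 0.
have c0 : is_cond_exp P G (cst 0) (cst 0).
  by split => //; exact/Lfun1_integrable.
have := cond_exp_lin (-1) Iv I0 vw c0.
by under eq_fun do rewrite mulN1r addr0; under [X in is_cond_exp _ _ _ X]eq_fun do rewrite mulN1r addr0.
Qed.

Lemma cond_exp_bound v w (c : R) : integr P v -> is_cond_exp P G v w ->
  {ae P, forall x, `|v x| <= c} -> {ae P, forall x, `|w x| <= c}.
Proof.
move=> Iv vw vc.
have h1 : {ae P, forall x, w x <= c}.
  by apply: (cond_exp_ub Iv vw); apply: filterS vc => x; exact: le_trans (ler_norm _).
have h2 : {ae P, forall x, - w x <= c}.
  apply: (cond_exp_ub (integrN Iv) (cond_expN Iv vw)).
  by apply: filterS vc => x; apply: le_trans; rewrite -normrN ler_norm.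
move: h1 h2; apply: filterS2 => x h1 h2; rewrite ler_norml h1 andbT; lra.
Qed.

Lemma cond_exp_uniq v w w' : integr P v ->
  is_cond_exp P G v w -> is_cond_exp P G v w' -> {ae P, forall x, w x = w' x}.
Proof.
move=> Iv vw vw'.
have h := cond_exp_lin 1 Iv (integrN Iv) vw (cond_expN Iv vw').
have : {ae P, forall x, `|1 * w x + - w' x| <= 0}.
  apply: (cond_exp_bound _ h); first exact: integrD (integrZ 1 Iv) (integrN Iv).
  by apply: aeW => x; rewrite mul1r subrr normr0.
apply: filterS => x; rewrite normr_le0 mul1r subr_eq0 => /eqP; exact.
Qed.

Lemma cond_exp_id v : measurable_fun [set: OmG] (v : OmG -> R) -> integr P v ->
  is_cond_exp P G v v.
Proof. by move=> mv Iv; split => //; exact/Lfun1_integrable. Qed.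

Definition truncate (c : R) (g : Om -> R) : Om -> R :=
  fun x => Num.min (Num.max (g x) (- c)) c.

Lemma truncate_bounded (c : R) g : 0 <= c -> bounded_by (truncate c g) c.
Proof.
move=> c0 x; rewrite /truncate ler_norml ge_min lexx orbT andbT le_min.
by rewrite le_max lexx orbT /=; lra.
Qed.

Lemma truncate_id (c : R) g x : `|g x| <= c -> truncate c g x = g x.
Proof.
by rewrite ler_norml => /andP[h1 h2]; rewrite /truncate max_l// min_l.
Qed.

Lemma truncate_norm (c : R) g x : 0 <= c -> `|truncate c g x| <= `|g x|.
Proof.
move=> c0; have [gc|cg] := leP `|g x| c; first by rewrite truncate_id.
exact: le_trans (truncate_bounded g c0 x) (ltW cg).
Qed.

Lemma measurable_truncate (c : R) (g : Om -> R) : measurable_fun [set: OmG] (g : OmG -> R) ->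
  measurable_fun [set: OmG] (truncate c g : OmG -> R).
Proof. by move=> mg; apply: measurable_minr => //; exact: measurable_maxr. Qed.

Lemma cond_exp_pullout_ae v w (g : Om -> R) (c : R) : integr P v -> is_cond_exp P G v w ->
  measurable_fun [set: OmG] (g : OmG -> R) -> {ae P, forall x, `|g x| <= c} ->
  rint P (fun x => g x * w x) = rint P (fun x => g x * v x).
Proof.
move=> Iv vw mg gc; have Iw := cond_exp_integr vw.
have mt := measurable_truncate `|c| mg.
have bt := truncate_bounded g (normr_ge0 c).
have gt : {ae P, forall x, truncate `|c| g x = g x}.
  by apply: filterS gc => x gxc; rewrite truncate_id// (le_trans gxc (ler_norm c)).
have E u : integr P u ->
    rint P (fun x => g x * u x) = rint P (fun x => truncate `|c| g x * u x).
  move=> Iu; apply: rint_ae_eq.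
  - exact: integr_bddM (G_measurable_fun mg) gc Iu.
  - exact: integr_bddM (G_measurable_fun mt) (aeW P bt) Iu.
  - by apply: filterS gt => x ->.
by rewrite !E//; exact: cond_exp_pullout bt.
Qed.

Lemma cond_exp_pullout_integr v w (g : Om -> R) (c : R) : integr P v -> is_cond_exp P G v w ->
  {ae P, forall x, `|v x| <= c} -> measurable_fun [set: OmG] (g : OmG -> R) ->
  integr P g -> rint P (fun x => g x * w x) = rint P (fun x => g x * v x).
Proof.
move=> Iv vw vc mg Ig; have Iw := cond_exp_integr vw.
have wc := cond_exp_bound Iv vw vc.
have lim_ u : integr P u -> {ae P, forall x, `|u x| <= c} ->
    rint P (fun x => truncate k%:R g x * u x) @[k --> \oo]
    --> rint P (fun x => g x * u x).
  move=> Iu uc.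
  have mt k := G_measurable_fun (measurable_truncate k%:R mg).
  apply: (@rint_dominated _ _ _ _ (fun k x => truncate k%:R g x * u x) _
    (fun x => `|c| * `|g x|)).
  - by move=> k; apply: measurable_funM => //; exact: integr_meas Iu.
  - by apply: measurable_funM; [exact: G_measurable_fun|exact: integr_meas Iu].
  - by apply: integrZ; exact: integrable_norm.
  - apply: aeW => x; apply: cvgMl; apply: cvg_near_cst.
    exists (Num.bound `|g x|) => // k /= gk; apply: truncate_id.
    by apply/ltW/(lt_le_trans (archi_boundP (normr_ge0 _))); rewrite ler_nat.
  - apply: filterS uc => x ux k; rewrite normrM mulrC; apply: ler_pM => //.
      exact: le_trans ux (ler_norm c).
    exact: truncate_norm.
apply: (@cvg_unique _ (@Rhausdorff R)
  (rint P (fun x => truncate k%:R g x * w x) @[k --> \oo])).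
  exact: lim_.
rewrite (_ : (fun k => rint P (fun x => truncate k%:R g x * w x)) =
    (fun k => rint P (fun x => truncate k%:R g x * v x))); first exact: lim_.
apply/funext => k; apply: (cond_exp_pullout Iv vw (measurable_truncate k%:R mg)).
exact: truncate_bounded.
Qed.

(** Both sides equal E[w w']. As [v] is bounded while [v'] is merely integrable, the two halves need
    different pull-out rules: a bounded multiplier for [v'], an integrable one for [v]. This will
    move E_t from a vector of L^oo to a density in L^1. *)
Lemma cond_exp_selfadjoint v w v' w' (c : R) : integr P v -> integr P v' ->
  is_cond_exp P G v w -> is_cond_exp P G v' w' -> {ae P, forall x, `|v x| <= c} ->
  rint P (fun x => w x * v' x) = rint P (fun x => v x * w' x).
Proof.
move=> Iv Iv' vw vw' vc; have [mw _ _] := vw; have [mw' _ _] := vw'.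
rewrite -(cond_exp_pullout_ae Iv' vw' mw (cond_exp_bound Iv vw vc)).
transitivity (rint P (fun x => w' x * w x)).
  by congr rint; apply/funext => x; rewrite mulrC.
rewrite (cond_exp_pullout_integr Iv vw vc mw' (cond_exp_integr vw')).
by congr rint; apply/funext => x; rewrite mulrC.
Qed.

End conditional_expectation.

(** * Measurable selections and normal integrands *)

Section countable_operations.
Context {d : measure_display} {Om : measurableType d}.

Lemma measurable_exists (I : countType) (Q : I -> Om -> Prop) :
  (forall i, measurable [set w | Q i w]) -> measurable [set w | exists i, Q i w].
Proof.
move=> mQ.
have -> : [set w | exists i, Q i w] = \bigcup_n
    (if unpickle n is Some i then [set w | Q i w] else set0).
  apply/seteqP; split=> [w [i Qi]|w [n _]].
    by exists (pickle i) => //; rewrite pickleK.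
  by case: (unpickle n) => // i Qi; exists i.
by apply: bigcupT_measurable => n; case: (unpickle n).
Qed.

Lemma measurable_forall (I : countType) (Q : I -> Om -> Prop) :
  (forall i, measurable [set w | Q i w]) -> measurable [set w | forall i, Q i w].
Proof.
move=> mQ.
have -> : [set w | forall i, Q i w] = ~` [set w | exists i, ~ Q i w].
  by apply/seteqP; split=> w /=; rewrite -forallNE => h i; have := h i; rewrite ?notK.
apply: measurableC; apply: measurable_exists => i.
exact: measurableC (mQ i).
Qed.

Lemma measurable_and (Q1 Q2 : Om -> Prop) : measurable [set w | Q1 w] ->
  measurable [set w | Q2 w] -> measurable [set w | Q1 w /\ Q2 w].
Proof. by move=> m1 m2; exact: measurableI m1 m2. Qed.

Lemma measurable_const (Q : Prop) : measurable [set w : Om | Q].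
Proof.
by have [q|q] := pselect Q; [rewrite (_ : [set w | Q] = setT)|
  rewrite (_ : [set w | Q] = set0)] => //; apply/seteqP; split.
Qed.

Lemma measurable_ltr (R : realType) (g h : Om -> R) : measurable_fun setT g ->
  measurable_fun setT h -> measurable [set w | g w < h w].
Proof.
move=> mg mh; rewrite (_ : [set w | _] = (fun w => h w - g w) @^-1` `]0, +oo[).
  rewrite -[X in measurable X]setTI; apply: measurable_funB => //.
by apply/seteqP; split => w /=; rewrite in_itv/= andbT subr_gt0.
Qed.

(* The value [0] for an empty predicate is never used. *)
Definition least (Q : nat -> Prop) : nat :=
  if pselect (exists n, `[< Q n >]) is left h then ex_minn h else 0%N.

Lemma leastP (Q : nat -> Prop) : (exists n, Q n) ->
  Q (least Q) /\ forall i, (i < least Q)%N -> ~ Q i.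
Proof.
move=> [n Qn]; rewrite /least; case: pselect => [h|]; last first.
  by case; exists n; apply/asboolP.
case: ex_minnP => k /asboolP Qk kmin; split=> // i ik Qi.
by have := kmin i; rewrite leqNgt ik => /(_ (asboolT Qi)).
Qed.

Lemma measurable_least (Q : nat -> Om -> Prop) n :
  (forall n, measurable [set w | Q n w]) -> (forall w, exists n, Q n w) ->
  measurable [set w | least (Q ^~ w) = n].
Proof.
move=> mQ exQ.
have lE w : least (Q ^~ w) = n <-> Q n w /\ forall i : 'I_n, ~ Q i w.
  have [Ql lmin] := leastP (exQ w); split=> [<-|[Qn nQ]].
    by split; [exact: Ql|move=> i; exact: (lmin i (ltn_ord i))].
  apply/eqP; rewrite eqn_leq; apply/andP; split; rewrite leqNgt; apply/negP => h.
    exact: (lmin _ h Qn).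
  exact: (nQ (Ordinal h) Ql).
have -> : [set w | least (Q ^~ w) = n] =
    [set w | Q n w /\ forall i : 'I_n, ~ Q i w].
  by apply/seteqP; split=> w; rewrite /mkset lE.
apply: measurable_and => //; apply: measurable_forall => i.
exact: measurableC (mQ i).
Qed.

Lemma measurable_fun_nat (R : realType) (N : Om -> nat) (h : nat -> R) :
  (forall n, measurable [set w | N w = n]) -> measurable_fun setT (h \o N).
Proof.
move=> mN _ B mB; rewrite setTI.
have -> : (h \o N) @^-1` B = [set w | exists n, N w = n /\ B (h n)].
  by apply/seteqP; split=> w /= => [Bh|[n [<-]]//]; exists (N w).
apply: measurable_exists => n; apply: measurable_and => //.
exact: measurable_const.
Qed.

End countable_operations.

Section rational_balls.
Context {R : realType} {m : nat}.

Local Notation V := ('rV[R]_m * R^o)%type.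

Lemma prod_ballE (x y : V) (e : R) : ball x e y <->
  [/\ 0 < e, (forall i, `|x.1 ord0 i - y.1 ord0 i| < e) & `|x.2 - y.2| < e].
Proof.
split=> [[[e0 h1] h2]|[e0 h1 h2]]; first by split=> // i; exact: (h1 ord0 i).
by split=> //; split=> // i j; rewrite (ord1 i); exact: h1.
Qed.

Lemma open_prod_ball (x : V) (e : R) : open (ball x e).
Proof. exact: ball_open. Qed.

Definition rat_point (j : 'rV[rat]_m * rat) : V :=
  (map_mx (@ratr R) j.1, ratr j.2).

Lemma rat_point_dense (x : V) (e : R) : 0 < e ->
  exists j, ball (rat_point j) e x.
Proof.
move=> e0.
have near_rat (a : R) : exists q : rat, `|ratr q - a| < e.
  have ae : a - e < a + e by lra.
  have [q] := rat_in_itvoo ae; rewrite in_itv/= => /andP[h1 h2].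
  by exists q; rewrite ltr_norml; apply/andP; split; lra.
have [q qx] := near_rat x.2.
have /choice[g gx] : forall i : 'I_m, exists q : rat, `|ratr q - x.1 ord0 i| < e.
  by move=> i; exact: near_rat.
exists (\row_i g i, q); apply/prod_ballE; split=> //= i.
by rewrite !mxE.
Qed.

Lemma closed_prod (A : set V) (x : V) : closed A ->
  (forall e : R, 0 < e -> exists2 y, A y & ball x e y) -> A x.
Proof.
move=> cA h; apply: cA => B /nbhs_ballP[e /= e0 eB].
by have [y Ay xy] := h e e0; exists y; split=> //; exact: eB.
Qed.

(** The affine function whose supremum over the epigraph of f(.,w) is f^*(v,w). *)
Definition slope (v : 'rV[R]_m) (p : V) : R := dot p.1 v - p.2.

(** The l^1 norm of (v, -1), a Lipschitz constant of [slope v] for the sup norm; the 1 comes from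
    the last coordinate and makes it positive. *)
Definition slope_lip (v : 'rV[R]_m) : R := \sum_i `|v ord0 i| + 1.

Lemma slope_lip_gt0 v : 0 < slope_lip v.
Proof. by rewrite ltr_wpDl//; apply: sumr_ge0 => i _. Qed.

Lemma slope_ball v (x y : V) (e : R) : ball x e y ->
  `|slope v x - slope v y| <= e * slope_lip v.
Proof.
move=> /prod_ballE[e0 h1 h2].
have -> : slope v x - slope v y = dot (x.1 - y.1) v - (x.2 - y.2).
  by rewrite /slope dotBl; lra.
apply: (le_trans (ler_normB _ _)); rewrite /slope_lip mulrDr mulr1.
apply: lerD; last exact: ltW.
rewrite mulr_sumr; apply: (le_trans (ler_norm_sum _ _ _)).
by apply: ler_sum => i _; rewrite normrM !mxE ler_wpM2r// ltW.
Qed.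

End rational_balls.

Section measurable_selection.
Context {d : measure_display} {Om : measurableType d} {R : realType} {m : nat}.

Local Notation V := ('rV[R]_m * R^o)%type.

Let e_ (k : nat) : R := 2^-1 ^+ k.

Let e_gt0 k : 0 < e_ k. Proof. by rewrite exprn_gt0// invr_gt0. Qed.

Let e_S k : e_ k.+1 = e_ k / 2. Proof. by rewrite /e_ exprSr. Qed.

Let e_small (e : R) : 0 < e -> exists k, e_ k < e.
Proof.
move=> e0; have [k _ /(_ k (leqnn k))] := near_infty_natSinv_expn_lt (PosNum e0).
by rewrite /= div1r -exprVn => h; exists k.
Qed.

(** The rate [2 * e_ k] bounds the distance between the centres of two meeting balls of radii [e_ k]
    and [e_ k.+1]; the geometric series sums it to [4 * e_ k]. *)
Lemma geometric_cvg (u : nat -> R) : (forall k, `|u k.+1 - u k| <= 2 * e_ k) ->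
  u k @[k --> \oo] --> lim (u k @[k --> \oo]) /\
  forall k, `|lim (u k @[k --> \oo]) - u k| <= 4 * e_ k.
Proof.
move=> hu.
have key k j : `|u (k + j)%N - u k| <= 4 * (e_ k - e_ (k + j)%N).
  elim: j => [|j IH]; first by rewrite addn0 !subrr normr0 mulr0.
  rewrite addnS; have := hu (k + j)%N; rewrite e_S => h.
  have -> : u (k + j).+1 - u k = (u (k + j).+1 - u (k + j)%N) + (u (k + j)%N - u k) by lra.
  by apply: (le_trans (ler_normD _ _)); lra.
have key' k l : (k <= l)%N -> `|u l - u k| <= 4 * e_ k.
  move=> /subnKC <-; apply: (le_trans (key _ _)).
  by have := e_gt0 (k + (l - k))%N; lra.
have cu : u k @[k --> \oo] --> lim (u k @[k --> \oo]).
  apply: cauchy_cvg; apply: cauchy_exP => e e0.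
  have [k ke] := e_small (divr_gt0 e0 (ltr0n R 4)).
  exists (u k); exists k => // l /= kl; rewrite /ball/= distrC.
  by apply: (le_lt_trans (key' k l kl)); move: ke; rewrite ltr_pdivlMr//; lra.
split=> // k.
have ck : `|u l - u k| @[l --> \oo] --> `|lim (u k @[k --> \oo]) - u k|.
  by apply: cvg_norm; apply: cvgB => //; exact: cvg_cst.
rewrite -(cvg_lim _ ck)//; apply: limr_le; first by apply: cvgP ck.
by exists k => // l /= kl; exact: key'.
Qed.

(* Kuratowski-Ryll-Nardzewski: [N k w] is the first rational point whose ball
   of radius [2^-k] meets [C w] inside the previous ball. *)
Variable C : Om -> set V.
Hypothesis C0 : forall w, C w !=set0.
Hypothesis mC : forall O : set V, open O -> measurable [set w | C w `&` O !=set0].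

Let q_ (n : nat) : V := if unpickle n is Some j then rat_point j else 0.

Let q_dense (x : V) (e : R) : 0 < e -> exists n, ball (q_ n) e x.
Proof.
move=> e0; have [j xj] := rat_point_dense x e0.
by exists (pickle j); rewrite /q_ pickleK.
Qed.

Let Q0 n w := C w `&` ball (q_ n) (e_ 0) !=set0.
Let QS (k i n : nat) w :=
  C w `&` (ball (q_ n) (e_ k.+1) `&` ball (q_ i) (e_ k)) !=set0.

Let Fixpoint N (k : nat) (w : Om) : nat :=
  if k is k'.+1 then least (fun n => QS k' (N k' w) n w)
  else least (Q0 ^~ w).

Let N_hit k w : C w `&` ball (q_ (N k w)) (e_ k) !=set0.
Proof.
elim: k => [|k IH] /=.
  have ex : exists n, Q0 n w.
    by have [p Cp] := C0 w; have [n pn] := q_dense p (e_gt0 0); exists n, p.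
  exact: (leastP ex).1.
have ex : exists n, QS k (N k w) n w.
  have [p [Cp pN]] := IH.
  by have [n pn] := q_dense p (e_gt0 k.+1); exists n, p.
by have [p [Cp [pn _]]] := (leastP ex).1; exists p.
Qed.

Let N_step k w : exists p, ball (q_ (N k.+1 w)) (e_ k.+1) p /\
  ball (q_ (N k w)) (e_ k) p.
Proof.
have ex : exists n, QS k (N k w) n w.
  have [p [Cp pN]] := N_hit k w.
  by have [n pn] := q_dense p (e_gt0 k.+1); exists n, p.
by have [p [Cp [pn pN]]] := (leastP ex).1; exists p.
Qed.

Let mN k n : measurable [set w | N k w = n].
Proof.
elim: k n => [|k IH] n /=.
  apply: measurable_least => [j|w]; first by apply: mC; exact: open_prod_ball.
  by have [p Cp] := C0 w; have [j pj] := q_dense p (e_gt0 0); exists j, p.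
apply: (measurable_least (Q := fun n w => QS k (N k w) n w)) => [j|w].
  have -> : [set w | QS k (N k w) j w] =
      [set w | exists i, N k w = i /\ QS k i j w].
    by apply/seteqP; split=> w /= => [?|[i [<-]]//]; exists (N k w).
  apply: measurable_exists => i; apply: measurable_and => //.
  by apply: mC; apply: openI; exact: open_prod_ball.
have [p [Cp pN]] := N_hit k w.
by have [j pj] := q_dense p (e_gt0 k.+1); exists j, p.
Qed.

(** The sets [C w] may fail to be closed, so the limit only lies in their closure. This allows sets
    cut out by a strict inequality, which are easier to test for measurability. *)
Lemma measurable_selection : exists xi : Om -> 'rV[R]_m, exists al : Om -> R,
  [/\ forall i, measurable_fun setT (coord xi i), measurable_fun setT al &
      forall w (e : R), 0 < e -> exists2 p, C w p & ball ((xi w, al w) : V) e p].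
Proof.
pose u i k w := (q_ (N k w)).1 ord0 i.
pose a k w : R := (q_ (N k w)).2.
have du i w k : `|u i k.+1 w - u i k w| <= 2 * e_ k.
  have [p [/prod_ballE[_ h1 _] /prod_ballE[_ h2 _]]] := N_step k w.
  have := h1 i; have := h2 i; rewrite -/(u i k w) -/(u i k.+1 w) e_S.
  have := e_gt0 k; rewrite !ltr_norml ler_norml => e0 /andP[? ?] /andP[? ?].
  by apply/andP; split; lra.
have da w k : `|a k.+1 w - a k w| <= 2 * e_ k.
  have [p [/prod_ballE[_ _ h1] /prod_ballE[_ _ h2]]] := N_step k w.
  move: h1 h2; rewrite -/(a k w) -/(a k.+1 w) e_S.
  have := e_gt0 k; rewrite !ltr_norml ler_norml => e0 /andP[? ?] /andP[? ?].
  by apply/andP; split; lra.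
pose xi w : 'rV[R]_m := \row_i lim (u i k w @[k --> \oo]).
pose al w : R := lim (a k w @[k --> \oo]).
exists xi, al; split=> [i||w e e0].
- apply: (measurable_fun_cvg (h := u i)) => [k|w _].
    exact: (measurable_fun_nat (fun n => (q_ n).1 ord0 i) (mN k)).
  by rewrite /coord mxE; have [] := geometric_cvg (du i w).
- apply: (measurable_fun_cvg (h := a)) => [k|w _].
    exact: (measurable_fun_nat (fun n => (q_ n).2) (mN k)).
  by have [] := geometric_cvg (da w).
(* The distance from the limit to [p] is at most [4 * e_ k] to the centre plus [e_ k] within the
   ball, below e when [e_ k] < e / 8. *)
have [k ke] := e_small (divr_gt0 e0 (ltr0n R 8)).
have [p [Cp /prod_ballE[_ h1 h2]]] := N_hit k w.
exists p => //; apply/prod_ballE; move: ke; rewrite ltr_pdivlMr// => ke.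
have ek := e_gt0 k.
split=> //= [i|].
  have := (geometric_cvg (du i w)).2 k; have := h1 i; rewrite mxE -/(u i k w).
  rewrite !ltr_norml ler_norml => /andP[? ?] /andP[? ?].
  by apply/andP; split; lra.
have := (geometric_cvg (da w)).2 k; move: h2; rewrite -/(a k w) -/(al w).
rewrite !ltr_norml ler_norml => /andP[? ?] /andP[? ?].
by apply/andP; split; lra.
Qed.

End measurable_selection.

Section normal_integrands.
Context {d : measure_display} {Om : measurableType d} {R : realType} {m : nat}.
Variable f : 'rV[R]_m -> Om -> \bar R.
Hypothesis f_normal : normal_integrand f.
Implicit Types (x v : Om -> 'rV[R]_m).

Local Notation V := ('rV[R]_m * R^o)%type.

Let inv (k : nat) : R := k.+1%:R^-1.

Let inv_gt0 k : 0 < inv k. Proof. by rewrite invr_gt0 ltr0n. Qed.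

Let inv_small (e : R) : 0 < e -> exists k, inv k < e.
Proof.
move=> e0; have [k _ /(_ k (leqnn k))] := near_infty_natSinv_lt (PosNum e0).
by exists k.
Qed.

(** The strict inequality is open in [p]: a point that satisfies it lies in a rational ball
    throughout which the Lipschitz bound guarantees it. For each of these countably many balls only
    the epigraph remains, and normality applies. *)
Lemma measurable_hit_slope v (g : Om -> R) (O : set V) :
  (forall i, measurable_fun setT (coord v i)) -> measurable_fun setT g -> open O ->
  measurable [set w | [set p | epi f w p /\ g w < slope (v w) p] `&` O !=set0].
Proof.
move=> mv mg oO.
pose W (j : 'rV[rat]_m * rat) k := ball (rat_point j : V) (inv k).
have -> : [set w | [set p | epi f w p /\ g w < slope (v w) p] `&` O !=set0] =
    [set w | exists jk : ('rV[rat]_m * rat) * nat,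
      g w < slope (v w) (rat_point jk.1) - inv jk.2 * slope_lip (v w) /\
      epi f w `&` (O `&` W jk.1 jk.2) !=set0].
  apply/seteqP; split=> w /=; last first.
    move=> [[j k] /= [gs [p [Ep [Op Wp]]]]]; exists p; split=> //; split=> //.
    have := slope_ball (v w) Wp; rewrite ler_norml => /andP[h1 h2].
    by move: gs h1 h2; lra.
  move=> [p [[Ep gp] Op]].
  have L0 := slope_lip_gt0 (v w).
  (* The factor 2 pays for two Lipschitz errors: from [p] to the centre, and from the centre to any
     point of the ball. *)
  have s0 : 0 < (slope (v w) p - g w) / (2 * slope_lip (v w)).
    by apply: divr_gt0; rewrite ?mulr_gt0// subr_gt0.
  have [k] := inv_small s0; rewrite ltr_pdivlMr ?mulr_gt0// => hk.
  have [j Wp] := rat_point_dense p (inv_gt0 k).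
  exists (j, k) => /=; split; last by exists p.
  have := slope_ball (v w) Wp; rewrite ler_norml => /andP[h1 h2].
  by move: hk h1 h2; lra.
apply: measurable_exists => -[j k] /=; apply: measurable_and; last first.
  by apply: f_normal.2; apply: openI => //; exact: open_prod_ball.
have mV i : measurable_fun setT (fun w => v w ord0 i) by exact: mv.
apply: measurable_ltr => //; apply: measurable_funB.
  apply: measurable_funB => //; rewrite /dot.
  by apply: measurable_sum => i; apply: measurable_funM.
apply: measurable_funM => //; apply: measurable_funD => //.
by apply: measurable_sum => i; exact: measurableT_comp.
Qed.

Lemma measurable_conj v : (forall i, measurable_fun setT (coord v i)) ->
  measurable_fun setT (fun w => conj_integrand f (v w) w).
Proof.
move=> mv; apply: (measurability _ (ErealGenOInfty.measurableE R)).
move=> /= _ [_ [c ->]] <-; rewrite setTI.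
rewrite (_ : _ @^-1` _ =
  [set w | [set p | epi f w p /\ c < slope (v w) p] `&` setT !=set0]).
  exact: (measurable_hit_slope mv (measurable_cst c) openT).
apply/seteqP; split=> w /=; rewrite in_itv/= andbT.
  rewrite /conj_integrand => /ereal_sup_gt[_ [xi _ <-]].
  case fxi : (f xi w) => [r| |] // h.
    exists (xi, r); split=> //; split; first by rewrite /epi /= fxi.
    by move: h; rewrite -EFinB lte_fin.
  (* If [f xi w] is -oo, every real lies above it; this one gives slope c + 1. *)
  exists (xi, dot xi (v w) - c - 1); split=> //; split; first by rewrite /epi /= fxi leNye.
  by rewrite /slope /=; lra.
move=> [[xi a] [[/= fa ca] _]].
apply: (@lt_le_trans _ _ (slope (v w) (xi, a))%:E); first by rewrite lte_fin.
apply: (@le_trans _ _ ((dot xi (v w))%:E - f xi w)%E).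
  by rewrite /slope /= EFinB leeB.
by apply: ereal_sup_ubound; exists xi.
Qed.

(** As the epigraph is closed, f(x w, w) <= c holds iff arbitrarily small rational balls around (x
    w, c) meet it, which is a countable condition. *)
Lemma measurable_eval x : (forall i, measurable_fun setT (coord x i)) ->
  measurable_fun setT (fun w => f (x w) w).
Proof.
move=> mx; apply: (measurability _ (ErealGenOInfty.measurableE R)).
move=> /= _ [_ [c ->]] <-; rewrite setTI.
pose W (j : 'rV[rat]_m * rat) k := ball (rat_point j : V) (inv k).
have -> : (fun w => f (x w) w) @^-1` `]c%:E, +oo[ =
    ~` [set w | forall k, exists j : 'rV[rat]_m * rat,
       W j k (x w, c) /\ epi f w `&` W j k !=set0].
  rewrite -[LHS]setCK; congr (~` _); apply/seteqP; split=> w /=.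
    rewrite in_itv/= andbT => /negP; rewrite -leNgt => fc k.
    have [j Wj] := rat_point_dense ((x w, c) : V) (inv_gt0 k).
    by exists j; split=> //; exists (x w, c).
  move=> h; rewrite in_itv/= andbT; apply/negP; rewrite -leNgt.
  apply: (closed_prod (x := (x w, c)) (f_normal.1 w)) => e e0.
  have [k] := inv_small (divr_gt0 e0 (ltr0n R 2)); rewrite ltr_pdivlMr// => ke.
  have [j [Wj [p [Ep Wp]]]] := h k.
  exists p => //; have := ball_splitr _ _; apply.
  - by apply: le_ball Wj; lra.
  - by apply: le_ball Wp; lra.
apply: measurableC; apply: measurable_forall => k.
apply: measurable_exists => j; apply: measurable_and; last first.
  by apply: f_normal.2; exact: open_prod_ball.
rewrite (_ : [set w | _] = [set w | (0 < inv k /\ forall i : 'I_m,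
    `|(rat_point (R := R) j).1 ord0 i - coord x i w| < inv k) /\
    `|(rat_point (R := R) j).2 - c| < inv k]); last first.
  apply/seteqP; split=> w; first by move=> /prod_ballE[].
  by move=> [[h1 h2] h3]; apply/prod_ballE.
apply: measurable_and; last exact: measurable_const.
apply: measurable_and; first exact: measurable_const.
apply: measurable_forall => i; apply: measurable_ltr => //.
by apply: measurableT_comp => //; exact: measurable_funB.
Qed.

(** Off [D] the set to select from is the whole space, so it is nonempty everywhere. Passing to the
    closure weakens the strict inequality for [g] to a weak one, while the closed epigraph is
    preserved. *)
Lemma epi_selection v (g : Om -> R) (D : set Om) :
  (forall i, measurable_fun setT (coord v i)) -> measurable_fun setT g ->
  measurable D ->
  (forall w, D w -> ((g w)%:E < conj_integrand f (v w) w)%E) ->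
  exists xi : Om -> 'rV[R]_m, exists al : Om -> R,
  [/\ forall i, measurable_fun setT (coord xi i), measurable_fun setT al &
      forall w, D w ->
        (f (xi w) w <= (al w)%:E)%E /\ g w <= dot (xi w) (v w) - al w].
Proof.
move=> mv mg mD gD.
pose C w : set V := [set p | D w -> epi f w p /\ g w < slope (v w) p].
have C0 w : C w !=set0.
  have [Dw|nDw] := pselect (D w); last by exists (0, 0).
  have := gD w Dw; rewrite /conj_integrand => /ereal_sup_gt[_ [xi _ <-]].
  case fxi : (f xi w) => [r| |] // h.
    exists (xi, r) => _; split; first by rewrite /epi /= fxi.
    by move: h; rewrite -EFinB lte_fin.
  exists (xi, dot xi (v w) - g w - 1) => _; split; first by rewrite /epi /= fxi leNye.
  by rewrite /slope /=; lra.
have mC O : open O -> measurable [set w | C w `&` O !=set0].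
  move=> oO; rewrite (_ : [set w | _] =
    (D `&` [set w | [set p | epi f w p /\ g w < slope (v w) p] `&` O !=set0]) `|`
    (~` D `&` [set w | O !=set0])).
    apply: measurableU; apply: measurableI => //.
    - exact: measurable_hit_slope.
    - exact: measurableC.
    - exact: measurable_const.
  apply/seteqP; split=> w /=.
    move=> [p [Cp Op]]; have [Dw|nDw] := pselect (D w); [left|right].
      by split=> //; exists p; split=> //; exact: Cp.
    by split=> //; exists p.
  by move=> [[Dw [p [pw Op]]]|[nDw [p Op]]]; exists p; split.
have [xi [al [mxi mal h]]] := measurable_selection C0 mC.
exists xi, al; split=> // w Dw; split.
  apply: (closed_prod (x := (xi w, al w)) (f_normal.1 w)) => e e0.
  by have [p /(_ Dw)[Ep _] pe] := h w e e0; exists p.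
apply/ler_addgt0Pl => e e0.
have L0 := slope_lip_gt0 (v w).
have [p /(_ Dw)[_ gp] /(slope_ball (v w))] := h w _ (divr_gt0 e0 L0).
rewrite divfK ?gt_eqF// ler_norml => /andP[h1 h2].
by move: h1 h2 gp; rewrite {1 3}/slope /=; lra.
Qed.

End normal_integrands.

(** * Integral functionals *)

Section extended_expectation.
Context {d : measure_display} {Om : measurableType d} {R : realType}.
Variable P : probability Om R.
Implicit Types (X Y : Om -> \bar R) (g : Om -> R).

Lemma ae_le_integral X Y : measurable_fun setT X -> measurable_fun setT Y ->
  {ae P, forall w, (X w <= Y w)%E} -> (\int[P]_w X w <= \int[P]_w Y w)%E.
Proof.
move=> mX mY XY; rewrite [leLHS]integralE [leRHS]integralE leeB//.
- apply: ae_ge0_le_integral => //; [exact: measurable_funepos..|].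
  by apply: filterS XY => w XYw _; rewrite !funeposE ge_max !le_max lexx orbT XYw.
- apply: ae_ge0_le_integral => //; [exact: measurable_funeneg..|].
  by apply: filterS XY => w XYw _; rewrite !funenegE ge_max !le_max lexx orbT leeN2 XYw.
Qed.

Lemma ext_expectation_integr g : integr P g ->
  ext_expectation P (EFin \o g) = (rint P g)%:E.
Proof.
move=> Ig; rewrite /ext_expectation integral_funepos_lt_pinfty//.
exact: rintE.
Qed.

Lemma ext_expectation_le X Y : measurable_fun setT X -> measurable_fun setT Y ->
  {ae P, forall w, (X w <= Y w)%E} -> (ext_expectation P X <= ext_expectation P Y)%E.
Proof.
move=> mX mY XY; rewrite /ext_expectation; case: ifPn => [XP|]; last first.
  case: ifPn => // YP /negP[]; apply: le_lt_trans YP.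
  apply: ae_ge0_le_integral => //; [exact: measurable_funepos..|].
  by apply: filterS XY => w XYw _; rewrite !funeposE ge_max !le_max lexx orbT XYw.
by case: ifPn => _; [exact: ae_le_integral|exact: leey].
Qed.

Lemma ext_expectation_ub X g : measurable_fun setT X -> integr P g ->
  {ae P, forall w, (X w <= (g w)%:E)%E} -> (ext_expectation P X <= (rint P g)%:E)%E.
Proof.
move=> mX Ig Xg; rewrite -ext_expectation_integr//; apply: ext_expectation_le => //.
exact: measurable_int Ig.
Qed.

Lemma ext_expectation_lb X g : measurable_fun setT X -> integr P g ->
  {ae P, forall w, ((g w)%:E <= X w)%E} -> ((rint P g)%:E <= ext_expectation P X)%E.
Proof.
move=> mX Ig Xg; rewrite -ext_expectation_integr//; apply: ext_expectation_le => //.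
exact: measurable_int Ig.
Qed.

Lemma ext_expectation_fin X : measurable_fun setT X ->
  ext_expectation P X \is a fin_num ->
  [/\ integr P (fine \o X), {ae P, forall w, X w = (fine (X w))%:E} &
      ext_expectation P X = (rint P (fine \o X))%:E].
Proof.
move=> mX; rewrite /ext_expectation; case: ifPn => // XP Xfin.
have IX : P.-integrable setT X.
  apply/integrableP; split => //.
  rewrite -[fun w => _]/(abse \o X) fune_abse ge0_integralD//;
    [|exact: measurable_funepos|exact: measurable_funeneg].
  rewrite lte_add_pinfty//.
  have := Xfin; rewrite [X in X \is a fin_num -> _]integralE fin_numE => /andP[+ _].
  by rewrite ltey; apply: contra => /eqP ->; rewrite /= addeNy.
have aeX : {ae P, forall w, X w = (fine (X w))%:E}.
  have := integrable_ae measurableT IX; apply: filterS => w /(_ I) h.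
  by rewrite fineK.
have Ifine : integr P (fine \o X).
  apply/integrableP; split.
    by apply/measurable_EFinP; exact: measurableT_comp mX.
  have /integrableP[_] := IX; apply: le_lt_trans.
  apply: ae_ge0_le_integral => //.
  - by apply: measurableT_comp => //; apply/measurable_EFinP; exact: measurableT_comp mX.
  - exact: measurableT_comp.
  - by apply: filterS aeX => w Xw _; rewrite Xw /= lexx.
split => //; rewrite -rintE//; apply: ae_eq_integral => //.
- exact: measurable_int Ifine.
- by apply: filterS aeX => w Xw _.
Qed.

Lemma ext_expectation_ltNy X g : measurable_fun setT X -> integr P g ->
  {ae P, forall w, ((g w)%:E <= X w)%E} -> (ext_expectation P X < +oo)%E ->
  ext_expectation P X \is a fin_num.
Proof.
move=> mX Ig gX Xlt; rewrite fin_numElt Xlt andbT.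
by apply: lt_le_trans (ext_expectation_lb mX Ig gX); rewrite ltNyr.
Qed.

Lemma ext_expectation_lt_ae X : measurable_fun setT X ->
  (ext_expectation P X < +oo)%E ->
  exists2 g, integr P g & {ae P, forall w, (X w <= (g w)%:E)%E}.
Proof.
move=> mX; rewrite /ext_expectation; case: ifPn => // XP _.
have XPP : ((X^\+)^\+ = X^\+)%E.
  by apply/funext => w; rewrite !funeposE -maxA maxxx.
have [|Ig gX _] := ext_expectation_fin (measurable_funepos mX).
  rewrite /ext_expectation XPP XP ge0_fin_numE//; exact: integral_ge0.
exists (fine \o X^\+)%E => //; apply: filterS gX => w /= <-.
by rewrite funeposE le_max lexx.
Qed.

End extended_expectation.

Section convexity.
Context {d : measure_display} {Om : measurableType d} {R : realType} {m : nat}.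
Variable f : 'rV[R]_m -> Om -> \bar R.
Hypothesis f_convex : convex_integrand f.

Lemma convex_integrand_le w (a b1 b2 : R) (x1 x2 : 'rV[R]_m) : 0 <= a -> a <= 1 ->
  (f x1 w <= b1%:E)%E -> (f x2 w <= b2%:E)%E ->
  (f (a *: x1 + (1 - a) *: x2)%R w <= (a * b1 + (1 - a) * b2)%:E)%E.
Proof.
move=> a0 a1 h1 h2.
exact: (set_mem (@f_convex w (x1, b1) (x2, b2) (Itv01 a0 a1) (mem_set h1) (mem_set h2))).
Qed.

End convexity.

Section proper_integral_functional.
Context {d : measure_display} {Om : measurableType d} {R : realType} {m : nat}.
Variables (P : probability Om R) (f : 'rV[R]_m -> Om -> \bar R).
Hypothesis f_normal : normal_integrand f.
Hypothesis f_convex : convex_integrand f.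
Hypothesis f_proper : forall z, dom_Loo P f z -> int_functional P f z \is a fin_num.
Implicit Types x y z v : Om -> 'rV[R]_m.

(* Real-valued versions of [f (z w) w] and [E f z]; they are meaningful for [z]
   in the domain only, since [fine] sends infinite values to [0]. *)
Definition fval z (w : Om) : R := fine (f (z w) w).

Definition phi z : R := rint P (fval z).

Let dom := dom_Loo P f.

Lemma Loo_coord z i : Loo P z -> measurable_fun setT (coord z i).
Proof. by move=> /LooP[]. Qed.

Lemma L1_coord v i : L1 P v -> measurable_fun setT (coord v i).
Proof. by move=> /L1P Lv; exact: integr_meas (Lv i). Qed.

Lemma measurable_eval_Loo z : Loo P z -> measurable_fun setT (fun w => f (z w) w).
Proof. by move=> Lz; apply: measurable_eval => // i; exact: Loo_coord. Qed.

Lemma dom_val z : dom z -> [/\ integr P (fval z),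
  {ae P, forall w, f (z w) w = (fval z w)%:E} & int_functional P f z = (phi z)%:E].
Proof.
move=> dz; have [Lz _] := dz.
exact: (ext_expectation_fin (measurable_eval_Loo Lz) (f_proper dz)).
Qed.

Lemma dom_intro z (g : Om -> R) : Loo P z -> integr P g ->
  {ae P, forall w, (f (z w) w <= (g w)%:E)%E} -> dom z /\ phi z <= rint P g.
Proof.
move=> Lz Ig zg.
have ub := ext_expectation_ub (measurable_eval_Loo Lz) Ig zg.
have dz : dom z by split=> //; apply: (le_lt_trans ub); exact: ltry.
split=> //; have [_ _ E] := dom_val dz.
by rewrite -lee_fin -E.
Qed.

Lemma phi_convex (a : R) z z' : 0 <= a -> a <= 1 -> dom z -> dom z' ->
  dom (a *: z + (1 - a) *: z') /\
  phi (a *: z + (1 - a) *: z') <= a * phi z + (1 - a) * phi z'.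
Proof.
move=> a0 a1 dz dz'.
have [Iz zE _] := dom_val dz; have [Iz' zE' _] := dom_val dz'.
have [Lz _] := dz; have [Lz' _] := dz'.
have Ia := integrZ a Iz; have Ia' := integrZ (1 - a) Iz'.
rewrite /phi -!rintZ// -rintD//; apply: dom_intro.
- by apply: LooD; exact: LooZ.
- exact: integrD.
- move: zE zE'; apply: filterS2 => w e e'.
  by apply: convex_integrand_le => //; rewrite ?e ?e'.
Qed.

(** Decomposability of L^oo; N^oo does not have it, as [E] is measurable only for the full
    sigma-algebra. *)
Lemma dom_patch z z' (E : set Om) : measurable E -> dom z -> dom z' ->
  dom (cut (~` E) z + cut E z') /\
  phi (cut (~` E) z + cut E z') <=
    rint P (fun w => \1_(~` E) w * fval z w + \1_E w * fval z' w).
Proof.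
move=> mE dz dz'; have mEC := measurableC mE.
have [Iz zE _] := dom_val dz; have [Iz' zE' _] := dom_val dz'.
have [Lz _] := dz; have [Lz' _] := dz'.
apply: dom_intro.
- by apply: LooD; exact: Loo_cut.
- by apply: integrD; exact: integr_indic.
- move: zE zE'; apply: filterS2 => w e e'.
  rewrite fctE /cut !indicE in_setC; case: (w \in E) => /=.
    by rewrite scale0r scale1r add0r mul0r mul1r add0r e'.
  by rewrite scale0r scale1r addr0 mul0r mul1r addr0 e.
Qed.

(* Testing [p] on the patched vectors [1_{~E_k} z + 1_{E_k} z'] separates
   the countably additive part from the remainder. *)
Lemma separate_singular_part (p : (Om -> 'rV[R]_m) -> R) (c : R) y
    (E : nat -> set Om) : bounded_functional P p ->
  (forall z, dom z -> p z - phi z <= c) ->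
  L1 P y -> (forall k, measurable (E k)) ->
  (forall k l, (k <= l)%N -> E l `<=` E k) -> P (\bigcap_k E k) = 0%E ->
  (forall z, Loo P z -> p (cut (~` E k) z) @[k --> \oo] --> epr P z y) ->
  forall z z', dom z -> dom z' ->
  epr P z y - phi z + (p z' - epr P z' y) <= c.
Proof.
move=> p_bd pc Ly mE E_dec E0 pE z z' dz dz'.
have [Iz zE _] := dom_val dz; have [Iz' zE' _] := dom_val dz'.
have [Lz _] := dz; have [Lz' _] := dz'.
pose u k w := \1_(~` E k) w * fval z w + \1_(E k) w * fval z' w.
have Iu k : integr P (u k).
  by apply: integrD; apply: integr_indic => //; exact: measurableC.
have cu : rint P (u k) @[k --> \oo] --> phi z.
  apply: (@rint_dominated _ _ _ _ u _ (fun w => `|fval z w| + `|fval z' w|)).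
  - by move=> k; exact: integr_meas.
  - exact: integr_meas Iz.
  - by apply: integrD; apply: integrable_norm.
  - exists (\bigcap_k E k); split=> //; first exact: bigcapT_measurable.
    move=> w /= nc k _; apply: contrapT => nEk; apply: nc.
    apply: cvg_near_cst; exists k => // l /= kl.
    have nEl : w \notin E l.
      by apply/negP => /set_mem El; apply: nEk; exact: E_dec kl _ El.
    by rewrite /u !indicE in_setC nEl (negbTE nEl) mul1r mul0r addr0.
  - apply: aeW => w k; rewrite /u !indicE in_setC; case: (w \in E k) => /=.
      by rewrite mul0r add0r mul1r lerDr.
    by rewrite mul0r addr0 mul1r lerDl.
have cp : p (cut (~` E k) z) - p (cut (~` E k) z') + p z' - rint P (u k) @[k --> \oo]
    --> epr P z y - epr P z' y + p z' - phi z.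
  apply: cvgB => //; apply: cvgD; last exact: cvg_cst.
  by apply: cvgB; exact: pE.
have -> : epr P z y - phi z + (p z' - epr P z' y) =
    epr P z y - epr P z' y + p z' - phi z by ring.
rewrite -(cvg_lim _ cp)//; apply: limr_le; first by apply: cvgP cp.
apply: nearW => k; have mEC := measurableC (mE k).
have [dk phik] := dom_patch (mE k) dz dz'.
apply: le_trans (pc _ dk).
have L1 := Loo_cut mEC Lz; have L2 := Loo_cut mEC Lz'; have L3 := Loo_cut (mE k) Lz'.
have -> : p z' = p (cut (~` E k) z') + p (cut (E k) z').
  rewrite -(bfD p_bd)//; congr p; apply/funext => w; rewrite fctE /cut -scalerDl.
  by rewrite !indicE in_setC; case: (w \in E k); rewrite /= ?add0r ?addr0 scale1r.
rewrite (bfD p_bd)//; move: phik; rewrite -/(u k); lra.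
Qed.

Lemma fenchel_young (xi v : 'rV[R]_m) w :
  ((dot xi v)%:E - f xi w <= conj_integrand f v w)%E.
Proof. by apply: ereal_sup_ubound; exists xi. Qed.

(** * Interchange of supremum and expectation *)

Section interchange.
Variables (y x0 : Om -> 'rV[R]_m) (c : R).
Hypothesis Ly : L1 P y.
Hypothesis dx0 : dom x0.
Hypothesis yc : forall z, dom z -> epr P z y - phi z <= c.

Let h w : \bar R := conj_integrand f (y w) w.
Let b w : R := dot (x0 w) (y w) - fval x0 w.

Let mh : measurable_fun setT h.
Proof. by apply: measurable_conj => // i; exact: L1_coord. Qed.

Let Ib : integr P b.
Proof.
have [Ix0 _ _] := dom_val dx0; apply: integrB => //.
by apply: integrable_dot => //; have [] := dx0.
Qed.

Let bh : {ae P, forall w, ((b w)%:E <= h w)%E}.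
Proof.
have [_ e _] := dom_val dx0; apply: filterS e => w e.
by have := fenchel_young (x0 w) (y w) w; rewrite e -EFinB.
Qed.

(** The conjugate may be +oo or non-integrable; capped at b + j, it lies a.e. between two integrable
    functions. *)
Let g (j : nat) w : R := fine (mine (h w) (b w + j%:R)%:E).

Let gE j w : ((b w)%:E <= h w)%E -> [/\ mine (h w) (b w + j%:R)%:E = (g j w)%:E,
  b w <= g j w & g j w <= b w + j%:R].
Proof.
move=> bhw; have j0 : 0 <= j%:R :> R by [].
have lb : ((b w)%:E <= mine (h w) (b w + j%:R)%:E)%E.
  by rewrite le_min bhw lee_fin lerDl.
have ub : (mine (h w) (b w + j%:R)%:E <= (b w + j%:R)%:E)%E by rewrite ge_min lexx orbT.
have E : mine (h w) (b w + j%:R)%:E = (g j w)%:E.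
  rewrite /g fineK// fin_numElt (lt_le_trans _ lb) ?ltNyr//=.
  by apply: (le_lt_trans ub); exact: ltry.
by split=> //; rewrite -lee_fin -E.
Qed.

Let mg j : measurable_fun setT (g j).
Proof.
apply: measurableT_comp => //; apply: measurable_mine => //.
apply/measurable_EFinP; apply: measurable_funD => //; exact: integr_meas Ib.
Qed.

Let Ig j : integr P (g j).
Proof.
apply: (@ae_le_integrable _ _ _ _ _ (fun w => `|b w| + j%:R)) => //.
  by apply: integrD; [exact: integrable_norm|exact: integr_cst].
apply: filterS bh => w bhw; have [_ h1 h2] := gE j bhw.
rewrite [leRHS]ger0_norm ?addr_ge0// ler_norml.
have := ler_norm (b w); have := ler_norm (- b w); rewrite normrN => n1 n2.
by have j0 : 0 <= j%:R :> R by []; apply/andP; split; lra.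
Qed.

(** A measurable near-maximizer [xi] need not be bounded or have an integrable value [al]. It is
    used on [D k] only, where both are below k, and replaced by [x0] elsewhere; the sets [D k]
    exhaust the complement of the null set [N]. *)
Let g_le j (e : R) : 0 < e -> rint P (g j) - e <= c.
Proof.
move=> e0; have [N [mN PN nN]] := bh.
have bhN w : (~` N) w -> ((b w)%:E <= h w)%E.
  by move=> nNw; apply: contrapT => nb; apply: nNw; exact: nN.
(* Subtracting [e] gives the strict inequality required by the selection, even where [g j] equals
   the conjugate. *)
pose gg w := g j w - e.
have mgg : measurable_fun setT gg by apply: measurable_funB.
have [xi [al [mxi mal sel]]] : exists xi : Om -> 'rV[R]_m, exists al : Om -> R,
  [/\ forall i, measurable_fun setT (coord xi i), measurable_fun setT al &
      forall w, (~` N) w ->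
        (f (xi w) w <= (al w)%:E)%E /\ gg w <= dot (xi w) (y w) - al w].
  apply: epi_selection => //; [by move=> i; exact: L1_coord|exact: measurableC|].
  move=> w /bhN bhw; have [E _ _] := gE j bhw.
  apply: (@lt_le_trans _ _ (g j w)%:E); first by rewrite lte_fin /gg; lra.
  by rewrite -E ge_min lexx.
pose D (k : nat) : set Om := [set w | (~` N) w /\
  ((forall i, `|coord xi i w| < k%:R) /\ `|al w| < k%:R)].
have mD k : measurable (D k).
  apply: measurable_and; first exact: measurableC.
  apply: measurable_and; last first.
    by apply: measurable_ltr => //; exact: measurableT_comp.
  by apply: measurable_forall => i; apply: measurable_ltr => //; exact: measurableT_comp.
have mDC k := measurableC (mD k).
have [Lx0 _] := dx0; have [Ix0 x0E _] := dom_val dx0.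
have Lxi k : Loo P (cut (D k) xi).
  apply/LooP; split=> [i|].
    by rewrite coord_cut; apply: measurable_funM => //; exact: measurable_indic.
  exists k%:R; apply: aeW => w; rewrite /cut indicE.
  have [/set_mem [_ [xik _]]|_] := boolP (w \in D k); last by rewrite scale0r normr0.
  by rewrite scale1r; apply: norm_le_coord => // i; exact: ltW (xik i).
pose z k := cut (D k) xi + cut (~` D k) x0.
have Lz k : Loo P (z k) by apply: LooD => //; exact: Loo_cut.
have zE k w : z k w = if w \in D k then xi w else x0 w.
  rewrite /z fctE /cut !indicE in_setC; case: (w \in D k) => /=.
    by rewrite scale0r scale1r addr0.
  by rewrite scale0r scale1r add0r.
pose G k w := \1_(D k) w * al w + \1_(~` D k) w * fval x0 w.
have IG k : integr P (G k).
  apply: integrD; last exact: integr_indic.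
  apply: (@ae_le_integrable _ _ _ _ _ (cst k%:R)).
  - by apply: measurable_funM => //; exact: measurable_indic.
  - exact: integr_cst.
  apply: aeW => w /=; rewrite indicE [leRHS]ger0_norm//.
  have [/set_mem [_ [_ alk]]|_] := boolP (w \in D k); last by rewrite mul0r normr0.
  by rewrite mul1r ltW.
have [dz phiz] : (forall k, dom (z k)) /\ forall k, phi (z k) <= rint P (G k).
  suff h1 k : dom (z k) /\ phi (z k) <= rint P (G k) by split=> k; have [] := h1 k.
  apply: dom_intro => //; apply: filterS x0E => w x0w; rewrite zE /G !indicE in_setC.
  have [/set_mem [Nw _]|_] := boolP (w \in D k) => /=.
    by rewrite mul1r mul0r addr0; have [] := sel w Nw.
  by rewrite mul0r mul1r add0r x0w.
pose u k w := \1_(D k) w * gg w + \1_(~` D k) w * b w.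
have Igg : integr P gg by apply: integrB => //; exact: integr_cst.
have Iu k : integr P (u k) by apply: integrD; exact: integr_indic.
have u_le k : rint P (u k) <= c.
  apply: le_trans (yc (dz k)).
  apply: (@le_trans _ _ (epr P (z k) y - rint P (G k))); last by rewrite lerD2l lerN2.
  have Izy := integrable_dot (Lz k) Ly.
  rewrite /epr -rintB//; apply: rint_ae_le => //; first exact: integrB.
  apply: aeW => w; rewrite zE /G /u !indicE in_setC.
  have [/set_mem [Nw _]|_] := boolP (w \in D k) => /=.
    by rewrite !mul1r !mul0r !addr0; have [] := sel w Nw.
  by rewrite !mul1r !mul0r !add0r.
have cu : rint P (u k) @[k --> \oo] --> rint P gg.
  apply: (@rint_dominated _ _ _ _ u _ (fun w => `|b w| + `|gg w|)).
  - by move=> k; exact: integr_meas.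
  - exact: mgg.
  - by apply: integrD; apply: integrable_norm.
  - exists N; split=> // w /= nc; apply: contrapT => Nw; apply: nc.
    pose M := \sum_i `|coord xi i w| + `|al w|.
    have M0 : 0 <= M by rewrite addr_ge0//; apply: sumr_ge0.
    apply: cvg_near_cst; exists (Num.bound M) => // k /= Mk.
    have Mk' : M < k%:R.
      by apply: (lt_le_trans (archi_boundP M0)); rewrite ler_nat.
    have Dkw : w \in D k.
      apply/mem_set; split=> //; split=> [i|]; apply: le_lt_trans Mk'.
        rewrite /M (bigD1 i)//= -addrA lerDl addr_ge0//.
        by apply: sumr_ge0.
      by rewrite /M lerDr; apply: sumr_ge0.
    by rewrite /u !indicE in_setC Dkw mul1r mul0r addr0.
  - apply: aeW => w k; rewrite /u !indicE in_setC; case: (w \in D k) => /=.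
      by rewrite mul0r addr0 mul1r lerDr.
    by rewrite mul0r add0r mul1r lerDl.
rewrite (_ : rint P (g j) - e = rint P gg); last first.
  by rewrite /gg rintB ?rint_cst//; exact: integr_cst.
rewrite -(cvg_lim _ cu)//; apply: limr_le; first by apply: cvgP cu.
exact: nearW.
Qed.

(** Monotone convergence for min(H, j), which is a.e. equal to g_j - b and so has integral at most c
    - E[b]. The maximum with 0 in [H] makes it nonnegative everywhere, although h >= b holds only
    a.e. *)
Lemma interchange : (int_functional P (conj_integrand f) y <= c%:E)%E.
Proof.
have gc j : rint P (g j) <= c.
  by apply/ler_addgt0Pl => e e0; have := g_le j e0; lra.
pose H w : \bar R := maxe (h w - (b w)%:E)%E 0%E.
have mb : measurable_fun setT (EFin \o b) by apply: measurable_int Ib.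
have mH : measurable_fun setT H.
  by apply: measurable_maxe => //; apply: emeasurable_funB.
have H0 w : (0 <= H w)%E by rewrite le_max lexx orbT.
pose Fj (j : nat) w : \bar R := mine (H w) (j%:R : R)%:E.
have mF j : measurable_fun setT (Fj j) by apply: measurable_mine.
have F0 j w : (0 <= Fj j w)%E by rewrite /Fj le_min H0 lee_fin ler0n.
have ndF w : {homo Fj^~ w : i j / (i <= j)%N >-> (i <= j)%E}.
  move=> i j ij; rewrite /Fj le_min ge_min lexx /=.
  by rewrite ge_min lee_fin ler_nat ij orbT.
have limF w : lim (Fj j w @[j --> \oo]) = H w.
  apply/cvg_lim => //.
  rewrite (_ : H w = ereal_sup (range (Fj^~ w))).
    exact: ereal_nondecreasing_cvgn (ndF w).
  apply/le_anti/andP; split; last first.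
    by apply: ge_ereal_sup => _ [j _ <-]; rewrite ge_min lexx.
  have jle j : (Fj j w <= ereal_sup (range (Fj^~ w)))%E.
    by apply: ereal_sup_ubound; exists j.
  case Hw : (H w) => [r| |].
  - apply: le_trans (jle (Num.bound r)); rewrite /Fj Hw le_min lexx lee_fin /=.
    by apply/ltW/archi_boundP; rewrite -lee_fin -Hw.
  - rewrite leye_eq; apply/eqP/eqyP => r r0.
    apply: le_trans (jle (Num.bound r)); rewrite /Fj Hw le_min leey lee_fin /=.
    by apply/ltW/archi_boundP/ltW.
  - exact: leNye.
have FE j : (\int[P]_w Fj j w <= (c - rint P b)%:E)%E.
  apply: (@le_trans _ _ (rint P (g j) - rint P b)%:E); last by rewrite lee_fin lerD2r.
  rewrite -rintB// -rintE; last exact: integrB.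
  rewrite le_eqVlt; apply/orP; left; apply/eqP; apply: ae_eq_integral => //.
    by apply/measurable_EFinP; apply: measurable_funB => //; exact: integr_meas Ib.
  apply: filterS bh => w bhw _; have [E _ _] := gE j bhw.
  rewrite EFinB -E /Fj /H max_l ?sube_ge0//.
  case: (h w) bhw => [r| |] //= brw.
    by rewrite -!EFin_min /= -?EFinB; congr EFin; rewrite addr_minl addrAC subrr add0r.
  by rewrite /= addye// !minye -EFinB; congr EFin; lra.
have IH : (\int[P]_w H w <= (c - rint P b)%:E)%E.
  under eq_integral do rewrite -limF.
  rewrite (monotone_convergence P measurableT mF (fun j w _ => F0 j w) (fun w _ => ndF w)).
  apply: lime_le; last exact: nearW.
  apply: ereal_nondecreasing_is_cvgn => i j ij.
  by apply: ge0_le_integral => // w _; exact: ndF.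
have HP : (H^\+ = H)%E.
  by apply/funext => w; rewrite funeposE max_l.
have IHlt : (\int[P]_w H w < +oo)%E by apply: (le_lt_trans IH); exact: ltry.
have eH : ext_expectation P H = (\int[P]_w H w)%E.
  by rewrite /ext_expectation HP IHlt.
have Hfin : ext_expectation P H \is a fin_num.
  by rewrite eH ge0_fin_numE//; exact: integral_ge0.
have [IfH HE eHE] := ext_expectation_fin mH Hfin.
apply: (@le_trans _ _ (rint P (fun w => fine (H w) + b w))%:E).
  apply: ext_expectation_ub => //; first exact: integrD.
  apply: filterS HE => w HEw; rewrite EFinD -HEw -leeBlDr//.
  by rewrite le_max lexx.
rewrite rintD// lee_fin -lerBrDr -lee_fin.
by rewrite -[X in (X%:E <= _)%E]/(rint P (fine \o H)) -eHE eH.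
Qed.

End interchange.

End proper_integral_functional.

(** * Nonanticipativity *)

Section coordinatewise_projection.
Context {d : measure_display} {Om : measurableType d} {R : realType} {m : nat}.
Variable P : probability Om R.
Implicit Types (x y z u v : Om -> 'rV[R]_m).

(** A version fixed by choice; the default [v] is reached only if no version exists. *)
Definition cexp (G : set (set Om)) (v : Om -> R) : Om -> R :=
  if pselect (exists w, is_cond_exp P G v w) is left h then projT1 (cid h) else v.

Lemma cexpP (G : set (set Om)) (v : Om -> R) : sigma_algebra [set: Om] G ->
  G `<=` measurable -> integr P v -> is_cond_exp P G v (cexp G v).
Proof.
move=> sG subG Iv; rewrite /cexp; case: pselect => [h|[]].
  exact: projT2 (cid h).
exact: cond_exp_exists.
Qed.

Lemma nrm_ae_eq u v : Loo P u -> Loo P v -> {ae P, forall w, u w = v w} ->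
  nrm P u = nrm P v.
Proof.
move=> Lu Lv uv; apply/le_anti/andP; split; apply: nrm_le => //.
  by have := nrm_ae Lv; move: uv; apply: filterS2 => w ->.
by have := nrm_ae Lu; move: uv; apply: filterS2 => w ->.
Qed.

Lemma Loo_bound z i : Loo P z -> {ae P, forall w, `|coord z i w| <= nrm P z}.
Proof.
move=> /nrm_ae; apply: filterS => w; apply: le_trans; exact: coord_le_norm.
Qed.

Lemma Loo_integr z i : Loo P z -> integr P (coord z i).
Proof. by move=> /Loo_L1/L1P; exact. Qed.

Lemma eprE z v : Loo P z -> L1 P v ->
  epr P z v = \sum_i rint P (fun w => coord z i w * coord v i w).
Proof.
move=> Lz /[dup] Lv /L1P Iv.
have I i : integr P (fun w => coord z i w * coord v i w).
  by apply: integr_bddM (Loo_bound i Lz) (Iv i); exact: Loo_coord.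
apply: EFin_inj; rewrite -rintE; last exact: integrable_dot.
rewrite -sumEFin; under eq_integral do rewrite /dot -sumEFin.
rewrite integral_sum//; apply: eq_bigr => i _; exact: (rintE (I i)).
Qed.

Lemma ae_coord u v : (forall i, {ae P, forall w, coord u i w = coord v i w}) ->
  {ae P, forall w, u w = v w}.
Proof.
move=> uv; have : {ae P, forall w, forall i : 'I_m, coord u i w = coord v i w}.
  exact: filter_forall.
by apply: filterS => w uvw; apply/rowP => i; exact: uvw.
Qed.

Variables (G : 'I_m -> set (set Om)) (b : 'I_m -> bool).
Hypothesis G_sigma : forall i, sigma_algebra [set: Om] (G i).
Hypothesis G_sub : forall i, G i `<=` measurable.

(** One operator with sigma-algebras [G] and mask [b] covers three uses: the adapted projection, z
    |-> E_t z^t with zero after stage t, and E_t applied to stage t alone. *)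
Definition cproj z : Om -> 'rV[R]_m :=
  fun w => \row_i if b i then cexp (G i) (coord z i) w else 0.

Lemma coord_cproj z i :
  coord (cproj z) i = if b i then cexp (G i) (coord z i) else cst 0.
Proof. by apply/funext => w; rewrite /coord mxE; case: (b i). Qed.

Lemma cproj_bound z i : Loo P z ->
  {ae P, forall w, `|coord (cproj z) i w| <= nrm P z}.
Proof.
move=> Lz; rewrite coord_cproj; case: (b i); last first.
  by apply: aeW => w; rewrite normr0 nrm_ge0.
apply: (cond_exp_bound (G_sigma i) (@G_sub i) (Loo_integr i Lz)).
  exact: cexpP (Loo_integr i Lz).
exact: Loo_bound.
Qed.

Lemma cproj_norm z : Loo P z -> {ae P, forall w, `|cproj z w| <= nrm P z}.
Proof.
move=> Lz; have : {ae P, forall w, forall i, `|coord (cproj z) i w| <= nrm P z}.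
  by apply: filter_forall => i; exact: cproj_bound.
by apply: filterS => w; apply: norm_le_coord; exact: nrm_ge0.
Qed.

Lemma Loo_cproj z : Loo P z -> Loo P (cproj z).
Proof.
move=> Lz; apply/LooP; split=> [i|]; last by exists (nrm P z); exact: cproj_norm.
rewrite coord_cproj; case: (b i); last exact: measurable_cst.
have [mw _ _] := cexpP (G_sigma i) (@G_sub i) (Loo_integr i Lz).
exact: (G_measurable_fun (G_sigma i) (@G_sub i) mw).
Qed.

Lemma nrm_cproj z : Loo P z -> nrm P (cproj z) <= nrm P z.
Proof. by move=> Lz; apply: nrm_le; [exact: Loo_cproj|exact: cproj_norm]. Qed.

(** Versions are chosen separately for each vector, so linearity holds only a.e. *)
Lemma cproj_lin (a : R) u v : Loo P u -> Loo P v ->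
  {ae P, forall w, cproj (a *: u + v) w = (a *: cproj u + cproj v) w}.
Proof.
move=> Lu Lv; apply: ae_coord => i.
have -> : coord (a *: cproj u + cproj v) i =
    fun w => a * coord (cproj u) i w + coord (cproj v) i w.
  by apply/funext => w; rewrite /coord !fctE !mxE.
rewrite !coord_cproj; case: (b i); last by apply: aeW => w; rewrite /= mulr0 addr0.
have Iu := Loo_integr i Lu; have Iv := Loo_integr i Lv.
have Iuv := Loo_integr i (LooS a Lu Lv).
apply: (cond_exp_uniq (G_sigma i) (@G_sub i) Iuv).
  exact: cexpP.
have -> : coord (a *: u + v) i = fun w => a * coord u i w + coord v i w.
  by apply/funext => w; rewrite /coord !fctE !mxE.
by apply: cond_exp_lin => //; exact: cexpP.
Qed.

Lemma bf_cproj p : bounded_functional P p -> bounded_functional P (p \o cproj).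
Proof.
move=> p_bd; have [plin [K pK]] := p_bd; split=> [a u v Lu Lv|].
  rewrite /= -plin; [|exact: Loo_cproj..].
  apply: (bf_ae p_bd); last exact: cproj_lin.
    by apply: Loo_cproj; exact: LooS.
  by apply: LooS; exact: Loo_cproj.
exists `|K| => z Lz; apply: (le_trans (pK _ (Loo_cproj Lz))).
apply: (le_trans (ler_wpM2r (nrm_ge0 _ _) (ler_norm K))).
by rewrite ler_wpM2l// nrm_cproj.
Qed.

Lemma cproj_uniq z u : Loo P z -> (forall i, b i -> is_cond_exp P (G i) (coord z i) (coord u i)) ->
  (forall i, ~~ b i -> {ae P, forall w, coord u i w = 0}) ->
  {ae P, forall w, cproj z w = u w}.
Proof.
move=> Lz zu u0; apply: ae_coord => i; rewrite coord_cproj.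
have [bi|nbi] := boolP (b i); last by apply: filterS (u0 i nbi) => w ->.
apply: (cond_exp_uniq (G_sigma i) (@G_sub i) (Loo_integr i Lz)); last exact: zu.
exact: cexpP (Loo_integr i Lz).
Qed.

End coordinatewise_projection.

Section affine_hull.
Context {R : realType} {E : lmodType R}.
Variable S : set E.

Lemma sub_aff_hull : S `<=` aff_hull S.
Proof.
move=> x Sx; exists 1%N, (fun=> 1), (fun=> x); split=> //.
  by rewrite big_ord1.
by rewrite big_ord1 scale1r.
Qed.

Lemma aff_hull_affine (a : R) u v : aff_hull S u -> aff_hull S v ->
  aff_hull S (a *: u + (1 - a) *: v).
Proof.
move=> [k [l [y [Sy l1 ->]]]] [k' [l' [y' [Sy' l1' ->]]]].
exists (k + k')%N, (fun i : 'I_(k + k') => match fintype.split i with inl j => a * l j | inr j => (1 - a) * l' j end),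
  (fun i : 'I_(k + k') => match fintype.split i with inl j => y j | inr j => y' j end).
have sl (j : 'I_k) : fintype.split (lshift k' j) = inl j by exact: (unsplitK (inl j)).
have sr (j : 'I_k') : fintype.split (rshift k j) = inr j by exact: (unsplitK (inr j)).
split=> [i||].
- by case: (fintype.split i).
- rewrite big_split_ord /=; under eq_bigr do rewrite sl.
  under [X in _ + X]eq_bigr do rewrite sr.
  by rewrite -!mulr_sumr l1 l1' !mulr1; lra.
- rewrite big_split_ord /=; under [X in _ = X + _]eq_bigr do rewrite sl.
  under [X in _ = _ + X]eq_bigr do rewrite sr.
  by rewrite !scaler_sumr; congr (_ + _); apply: eq_bigr => i _; rewrite scalerA.
Qed.

Lemma aff_hull_shift (s : R) x u v : 0 <= s -> aff_hull S x -> aff_hull S u ->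
  aff_hull S v -> aff_hull S (x + s *: (u - v)).
Proof.
move=> s0 Sx Su Sv; have s1 : 1 + s != 0 by rewrite gt_eqF// ltr_wpDr.
(* With m = (x + s u) / (1 + s), the point is (1 + s) m - s v: two affine combinations of two points
   each. *)
have := aff_hull_affine (1 + s) (aff_hull_affine (1 + s)^-1 Sx Su) Sv.
rewrite scalerDr !scalerA mulfV// scale1r.
have -> : (1 + s) * (1 - (1 + s)^-1) = s by rewrite mulrBr mulfV// mulr1; lra.
have -> : 1 - (1 + s) = - s by lra.
by rewrite scaleNr scalerBr addrA.
Qed.

Lemma aff_hull_sub (L : set E) : (forall (a : R) u v, L u -> L v -> L (a *: u + v)) ->
  L 0 -> S `<=` L -> aff_hull S `<=` L.
Proof.
move=> Llin L0 SL _ [k [l [y [Sy _ ->]]]].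
elim/big_ind : _ => //; first exact: subspace_add.
by move=> i _; apply: (subspace_scale Llin L0); exact: SL.
Qed.

End affine_hull.

(** * Filtrations and the removal of the singular part *)

Section multistage.
Context {d : measure_display} {Om : measurableType d} {R : realType}.
Variables (P : probability Om R) (T : nat) (n_ : 'I_T.+1 -> nat).
Variable F : 'I_T.+1 -> set (set Om).
Hypothesis F_filt : filtration F.

Local Notation n := (\sum_(t < T.+1) n_ t)%N.
Implicit Types (x z u v : Om -> 'rV[R]_n) (i : 'I_n).

Let F_sigma t : sigma_algebra [set: Om] (F t). Proof. by case: F_filt. Qed.

Let F_sub t : F t `<=` measurable. Proof. by case: F_filt => _ + _; exact. Qed.

Let F_mono (s t : 'I_T.+1) : (s <= t)%N -> F s `<=` F t.
Proof. by case: F_filt => _ _; exact. Qed.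

Lemma measurable_mono (s t : 'I_T.+1) (g : Om -> R) : (s <= t)%N ->
  measurable_fun [set: g_sigma_algebraType (F s)] (g : g_sigma_algebraType (F s) -> R) ->
  measurable_fun [set: g_sigma_algebraType (F t)] (g : g_sigma_algebraType (F t) -> R).
Proof.
move=> st mg _ B mB; rewrite setTI; apply/(G_measurableE (F_sigma t)).
apply: (F_mono st); apply/(G_measurableE (F_sigma s)).
by rewrite -[X in measurable X]setTI; exact: mg.
Qed.

Lemma NooS (a : R) x z : Noo P F x -> Noo P F z -> Noo P F (a *: x + z).
Proof.
move=> [ax Lx] [az Lz]; split; last exact: LooS.
move=> i; rewrite (_ : (fun w => _) = (fun w => a * x w ord0 i + z w ord0 i)).
  by apply: measurable_funD => //; apply: measurable_funM.
by apply/funext => w; rewrite !fctE !mxE.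
Qed.

Lemma Noo0 : Noo P F (0 : Om -> 'rV[R]_n).
Proof.
split; last exact: Loo0.
move=> i; rewrite (_ : (fun w => _) = cst 0); first exact: measurable_cst.
by apply/funext => w; rewrite !fctE !mxE.
Qed.

Lemma NooB x z : Noo P F x -> Noo P F z -> Noo P F (x - z).
Proof. by move=> Nx Nz; apply: (subspace_add (@NooS)) => //; exact: (subspace_opp (@NooS) Noo0). Qed.

Lemma NooD x z : Noo P F x -> Noo P F z -> Noo P F (x + z).
Proof. exact: subspace_add (@NooS) x z. Qed.

Lemma NooZ (a : R) x : Noo P F x -> Noo P F (a *: x).
Proof. exact: subspace_scale (@NooS) Noo0 a x. Qed.

Lemma Noo_indic i (A : set Om) : F (stage i) A -> Noo P F (inj_coord i \1_A).
Proof.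
move=> FA; split; last first.
  apply: (@Loo_inj_coord _ _ _ _ _ _ _ 1).
    by apply: measurable_indic; exact: F_sub FA.
  by apply: aeW => w; rewrite indicE; case: (w \in A); rewrite ?normr1 ?normr0.
move=> j; rewrite -/(coord (inj_coord i \1_A) j) coord_inj_coord.
have [->|ji] := eqVneq j i; last first.
  under eq_fun do rewrite mulr0; exact: measurable_cst.
under eq_fun do rewrite mulr1.
by apply: measurable_indic; apply/(G_measurableE (F_sigma _)).
Qed.

Definition aproj z := cproj P (fun i => F (stage i)) xpredT z.

Lemma aprojP z : Loo P z -> is_adapted_proj P F z (aproj z).
Proof.
move=> Lz i; have := cexpP (F_sigma (stage i)) (@F_sub (stage i)) (Loo_integr i Lz).
have := coord_cproj P (fun i => F (stage i)) xpredT z i.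
by rewrite /coord => ->.
Qed.

Lemma aproj_Noo x : Noo P F x -> {ae P, forall w, aproj x w = x w}.
Proof.
move=> [ax Lx]; apply: cproj_uniq => // i _; apply: cond_exp_id; [exact: ax|exact: Loo_integr].
Qed.

Lemma epr_adapted_proj z v av : Noo P F z -> L1 P v -> is_adapted_proj P F v av ->
  L1 P av /\ epr P z v = epr P z av.
Proof.
move=> [az Lz] Lv vav.
have Lav : L1 P av by move=> i; have [_ ] := vav i.
split=> //; rewrite !eprE//; apply: eq_bigr => i _; apply/esym.
apply: (cond_exp_pullout_ae (F_sigma (stage i)) (@F_sub _) _ (vav i) (az i)).
  by have /L1P := Lv; exact.
exact: Loo_bound.
Qed.

Variable f : 'rV[R]_n -> Om -> \bar R.
Hypothesis f_normal : normal_integrand f.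
Hypothesis f_convex : convex_integrand f.

Let dom := dom_Loo P f.

Hypothesis f_proper : forall z, dom z -> int_functional P f z \is a fin_num.

Section removal_of_singular_part.
Hypothesis dom_cond_exp : forall z, dom z -> forall t : 'I_T.+1,
  exists2 zh, dom zh & cond_exp_upto P F t z zh.
Variables (xs : Om -> 'rV[R]_n) (c : R).
Hypothesis xsN1 : N1 P F xs.

Let uproj (t : 'I_T.+1) z := cproj P (fun=> F t) (fun i => (stage i <= t)%N) z.

(* The functional [p] has no singular part on the stages [>= k]. *)
Let regular_from (k : nat) := exists p : (Om -> 'rV[R]_n) -> R,
  [/\ bounded_functional P p, forall z, dom z -> p z - phi P f z <= c,
      forall x, Noo P F x -> p x = epr P x xs &
      exists2 y, L1 P y & forall z, Loo P z ->
        (forall i w, (stage i < k)%N -> z w ord0 i = 0) -> p z = epr P z y].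

Lemma epr_cut_cvg (E : nat -> set Om) z v : Loo P z -> L1 P v ->
  (forall k, measurable (E k)) -> (forall k l, (k <= l)%N -> E l `<=` E k) ->
  P (\bigcap_k E k) = 0%E ->
  epr P (cut (~` E k) z) v @[k --> \oo] --> epr P z v.
Proof.
move=> Lz Lv mE E_dec E0; have I := integrable_dot Lz Lv.
have cE k w : dot (cut (~` E k) z w) (v w) = \1_(~` E k) w * dot (z w) (v w).
  by rewrite dotZl.
apply: (@rint_dominated _ _ _ _ _ _ (fun w => `|dot (z w) (v w)|)).
- move=> k; under eq_fun do rewrite cE.
  by exact: integr_meas (integr_indic (measurableC (mE k)) I).
- exact: integr_meas I.
- exact: integrable_norm.
- exists (\bigcap_k E k); split=> //; first exact: bigcapT_measurable.
  move=> w /= nc k _; apply: contrapT => nEk; apply: nc.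
  apply: cvg_near_cst; exists k => // l /= kl.
  have nEl : w \notin E l.
    by apply/negP => /set_mem El; apply: nEk; exact: E_dec kl _ El.
  by rewrite cE indicE in_setC nEl mul1r.
- apply: aeW => w k; rewrite cE normrM indicE; case: (w \in _).
    by rewrite normr1 mul1r.
  by rewrite normr0 mul0r.
Qed.

(* Writing [s] for the singular part of [p], the new functional is
   [z |-> E[z.y] + s (E_t z^t)]; on stage [t] the second term is absolutely
   continuous because there [s = xs - y] on F_t-measurable vectors. *)
Lemma regular_step (t : 'I_T.+1) : regular_from t.+1 -> regular_from t.
Proof.
move=> [p [p_bd pc pN [y0 Ly0 py0]]].
have [y [E [Ly mE E_dec E0 pE]]] := countably_additive_part p_bd.
have sep := separate_singular_part f_normal f_proper p_bd pc Ly mE E_dec E0 pE.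
pose s z := p z - epr P z y.
have s_bd : bounded_functional P s := bf_sub p_bd (epr_bounded Ly).
(* On the stages after [t], [p] has the density [y0], so it coincides with its countably additive
   part there. *)
have s_late z : Loo P z -> (forall i w, (stage i < t.+1)%N -> z w ord0 i = 0) -> s z = 0.
  move=> Lz z0; rewrite /s py0//; apply/eqP; rewrite subr_eq0; apply/eqP.
  apply: (@cvg_unique _ (@Rhausdorff R) (p (cut (~` E k) z) @[k --> \oo])); last exact: pE.
  rewrite (_ : (fun k => _) = (fun k => epr P (cut (~` E k) z) y0)).
    exact: epr_cut_cvg.
  apply/funext => k; apply: py0; first by apply: Loo_cut => //; exact: measurableC.
  by move=> i w it; rewrite /cut mxE z0// mulr0.
(* The vector [msk] keeps the later stages of z - z' and is exactly 0 up to [t], as [s_late]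
   demands; it is a.e. equal to z - z'. *)
have s_dep z z' : Loo P z -> Loo P z' ->
    (forall i, (stage i <= t)%N -> {ae P, forall w, coord z i w = coord z' i w}) ->
    s z = s z'.
  move=> Lz Lz' zz'; have LB := LooB Lz Lz'.
  pose msk : Om -> 'rV[R]_n := fun w =>
    \row_i if (stage i <= t)%N then 0 else (z - z') w ord0 i.
  have Lm : Loo P msk.
    apply/LooP; split=> [i|].
      rewrite (_ : coord _ i = if (stage i <= t)%N then cst 0 else coord (z - z') i).
        by case: ifP => _; [exact: measurable_cst|exact: Loo_coord].
      by apply/funext => w; rewrite /coord mxE; case: ifP.
    have /LooP[_ [e ze]] := LB; exists e; apply: filterS ze => w ze.
    have e0 : 0 <= e by apply: le_trans ze.
    apply: norm_le_coord => // i; rewrite mxE; case: ifP => _; first by rewrite normr0.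
    exact: le_trans (coord_le_norm _ _) ze.
  apply/eqP; rewrite -subr_eq0 -(bfB s_bd)//; apply/eqP.
  rewrite (bf_ae s_bd LB Lm).
    by apply: s_late => // i w; rewrite ltnS mxE => ->.
  apply: ae_coord => i; rewrite /coord.
  have [it|it] := leqP (stage i) t; last first.
    by apply: aeW => w; rewrite [in RHS]mxE leqNgt it.
  apply: filterS (zz' i it) => w; rewrite /coord => e.
  by rewrite [in RHS]mxE it !fctE !mxE e subrr.
have L1B : L1 P (xs - y) by apply: L1B => //; have [] := xsN1.
have Lup z : Loo P z -> Loo P (uproj t z).
  by move=> Lz; apply: Loo_cproj => // i; exact: F_sub.
exists (fun z => epr P z y + s (uproj t z)); split.
- apply: (bf_add (epr_bounded Ly)); exact: (bf_cproj _ (fun=> F_sigma t) (fun=> @F_sub t) s_bd).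
(* By condition (1) [uproj t z] agrees a.e. up to stage [t] with a point [zh] of the domain; [s]
   cannot tell them apart, and [sep] applies to the pair z, zh. *)
- move=> z dz; have [zh dzh zzh] := dom_cond_exp dz t.
  have [Lz _] := dz; have [Lzh _] := dzh.
  rewrite (s_dep _ zh)//; last 2 first.
  + exact: Lup.
  + move=> i it; rewrite coord_cproj it.
    apply: (cond_exp_uniq (F_sigma t) (@F_sub t) (Loo_integr i Lz)).
      exact: cexpP (Loo_integr i Lz).
    exact: zzh.
  by have := sep z zh dz dzh; rewrite -/(s zh); lra.
- move=> x Nx; have [ax Lx] := Nx.
  rewrite (s_dep _ x)//; last 2 first.
  + exact: Lup.
  + move=> i it; rewrite coord_cproj it.
    apply: (cond_exp_uniq (F_sigma t) (@F_sub t) (Loo_integr i Lx)).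
      exact: cexpP (Loo_integr i Lx).
    apply: cond_exp_id; last exact: Loo_integr.
    exact: measurable_mono it (ax i).
  by rewrite /s pN//; lra.
(* The density of the second term on stage [t] is E_t(xs - y): on adapted vectors [s] is the pairing
   with xs - y, and E_t is self-adjoint. *)
pose gv : Om -> 'rV[R]_n := fun w =>
  \row_i if stage i == t then cexp P (F t) (coord (xs - y) i) w else 0.
have cgv i : coord gv i =
    if stage i == t then cexp P (F t) (coord (xs - y) i) else cst 0.
  by apply/funext => w; rewrite /coord mxE; case: ifP.
have IB i : integr P (coord (xs - y) i) by have /L1P := L1B; exact.
have Lgv : L1 P gv.
  apply/L1P => i; rewrite cgv; case: ifP => _; last exact: integr_cst.
  exact: cond_exp_integr (cexpP (F_sigma t) (@F_sub t) (IB i)).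
exists (y + gv); first exact: L1D.
move=> z Lz z0.
(* When the stages before [t] vanish, [uproj t z] reduces to its stage [t], which is F_t-measurable;
   so [q] is adapted and [s q] is known. *)
pose q := cproj P (fun=> F t) (fun i => stage i == t) z.
have Lq : Loo P q by apply: Loo_cproj => // i; exact: F_sub.
have Nq : Noo P F q.
  split=> // i; rewrite -/(coord q i) coord_cproj; case: eqP => [->|_]; last exact: measurable_cst.
  by have [] := cexpP (F_sigma t) (@F_sub t) (Loo_integr i Lz).
rewrite (bf_ae s_bd (Lup z Lz) Lq); last first.
  apply: cproj_uniq => // i.
    move=> it; rewrite coord_cproj; case: eqP => [_|/eqP sit].
      exact: cexpP (Loo_integr i Lz).
    rewrite (_ : coord z i = cst 0).
      by apply: cond_exp_id; [exact: measurable_cst|exact: integr_cst].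
    by apply/funext => w; rewrite /coord z0// ltn_neqAle it andbT.
  rewrite -ltnNge coord_cproj => it; apply: aeW => w.
  by case: eqP => // e; move: it; rewrite e ltnn.
have -> : epr P z (y + gv) = epr P z y + epr P z gv.
  by rewrite -[y in LHS]scale1r epr_linr// mul1r.
congr (_ + _); rewrite /s pN//.
have -> : epr P q xs - epr P q y = epr P q (xs - y).
  rewrite addrC -[- y]scaleN1r [xs + _]addrC epr_linr ?mulN1r//.
  by have [] := xsN1.
rewrite !eprE//; apply: eq_bigr => i _; rewrite cgv coord_cproj.
case: eqP => [_|_]; last first.
  rewrite (_ : (fun w => _) = cst 0) ?rint_cst; last by apply/funext => w; rewrite mul0r.
  by rewrite (_ : (fun w => _) = cst 0) ?rint_cst//; apply/funext => w; rewrite mulr0.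
have Iz := Loo_integr i Lz.
apply: (cond_exp_selfadjoint (F_sigma t) (@F_sub t) Iz (IB i)); last exact: (Loo_bound i Lz).
  exact: cexpP Iz.
exact: cexpP (IB i).
Qed.

Lemma dual_of_functional (p : (Om -> 'rV[R]_n) -> R) x0 : dom x0 ->
  bounded_functional P p -> (forall z, dom z -> p z - phi P f z <= c) ->
  (forall x, Noo P F x -> p x = epr P x xs) ->
  exists2 v, Nperp P F v &
    (int_functional P (conj_integrand f) (xs + v)%R <= c%:E)%E.
Proof.
move=> dx0 p_bd pc pN.
have reg0 : regular_from 0.
  (* No stage is beyond T, so only the zero vector is tested and the density 0 serves. *)
  have : regular_from T.+1.
    exists p; split=> //; exists 0; first exact: L10.
    move=> z Lz z0; have -> : z = 0.
      by apply/funext => w; apply/rowP => i; rewrite z0// mxE.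
    by rewrite (bf0 p_bd) (bf0 (epr_bounded (@L10 _ _ _ P n))).
  have : (T.+1 <= T.+1)%N by [].
  elim: {1 3}T.+1 => [//|k IH] kT reg; apply: IH; first exact: ltnW.
  exact: (regular_step (t := Ordinal kT)) reg.
have [q [q_bd qc qN [y Ly qy]]] := reg0.
have qE z : Loo P z -> q z = epr P z y by move=> Lz; apply: qy.
have Lxs : L1 P xs by have [] := xsN1.
exists (y - xs).
  split; first exact: L1B.
  move=> z Nz; have [_ Lz] := Nz; rewrite pairingE//; last exact: L1B.
  rewrite -[- xs]scaleN1r addrC epr_linr// -qE// qN// mulN1r.
  by rewrite addrC subrr.
rewrite addrC subrK; apply: (interchange f_normal f_proper Ly dx0) => z dz.
by rewrite -qE; [exact: qc|have [] := dz].
Qed.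

End removal_of_singular_part.

End multistage.

(** * Local boundedness and properness *)

Section relative_continuity.
Context {d : measure_display} {Om : measurableType d} {R : realType} {m : nat}.
Variables (P : probability Om R) (f : 'rV[R]_m -> Om -> \bar R).
Hypothesis f_normal : normal_integrand f.
Hypothesis f_convex : convex_integrand f.

Let dom := dom_Loo P f.
Let A := aff_hull dom.

Lemma aff_dom_Loo : A `<=` Loo P.
Proof.
by apply: aff_hull_sub => [a u v|| z []//]; [exact: LooS|exact: Loo0].
Qed.

Variable xb : Om -> 'rV[R]_m.
Hypothesis Axb : A xb.
Hypothesis xb_fin : int_functional P f xb \is a fin_num.
Hypothesis xb_cont : Loo_continuous_at P A (int_functional P f) xb.

Lemma locally_bounded : exists delta M : R, 0 < delta /\
  forall z, A z -> nrm P (z - xb) <= delta -> (int_functional P f z < M%:E)%E.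
Proof.
have fx : (int_functional P f xb < (fine (int_functional P f xb) + 1)%:E)%E.
  by rewrite -[X in (X < _)%E](fineK xb_fin) lte_fin ltrDl.
have [delta delta0 hd] := xb_cont (open_ereal_lt' fx).
(* Dividing by m + 1 rather than m turns a weak bound on [nrm] into a strict bound on the Euclidean
   [Loo_norm], also when m = 0. *)
have m0 : 0 < m%:R + 1 :> R by rewrite ltr_wpDl.
exists (delta / (m%:R + 1)), (fine (int_functional P f xb) + 1).
split=> [|z Az zx]; first by rewrite divr_gt0.
apply: hd => //.
have LB := LooB (aff_dom_Loo Az) (aff_dom_Loo Axb).
apply: (le_lt_trans (Loo_norm_nrm LB)); rewrite lte_fin.
apply: (@le_lt_trans _ _ (m%:R * (delta / (m%:R + 1)))); first by rewrite ler_wpM2l.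
by rewrite mulrCA gtr_pMr// ltr_pdivrMr// mul1r ltrDl.
Qed.

(** The point [u], slightly beyond [xb] as seen from [z], still has Ef < +oo. Convexity at xb = (u +
    e z) / (1 + e) then bounds f(z) from below by ((1 + e) f(xb) - g) / e, where [g] is an
    integrable majorant of f(u). *)
Lemma proper_of_continuity z : dom z -> int_functional P f z \is a fin_num.
Proof.
move=> dz; have [delta [M [delta0 hM]]] := locally_bounded.
have [Lz zlt] := dz; have Lx := aff_dom_Loo Axb; have LB := LooB Lx Lz.
pose e := delta / (nrm P (xb - z) + 1).
have n0 : 0 < nrm P (xb - z) + 1 by rewrite ltr_wpDl// nrm_ge0.
have e0 : 0 < e by rewrite divr_gt0.
pose u := xb + e *: (xb - z).
have Au : A u by apply: aff_hull_shift => //; [exact: ltW|exact: sub_aff_hull].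
have Lu := aff_dom_Loo Au.
have ult : (int_functional P f u < +oo)%E.
  apply: (lt_trans (hM u Au _)); last exact: ltry.
  rewrite /u addrAC subrr add0r; apply: (le_trans (nrmZ e LB)).
  rewrite gtr0_norm// /e -mulrA ler_piMr ?(ltW delta0)// mulrC.
  by rewrite ler_pdivrMr// mul1r lerDl.
have [g Ig ug] := ext_expectation_lt_ae (measurable_eval_Loo f_normal Lu) ult.
have [Ix xE _] := ext_expectation_fin (measurable_eval_Loo f_normal Lx) xb_fin.
pose L w := e^-1 * ((1 + e) * fval f xb w - g w).
apply: (@ext_expectation_ltNy _ _ _ P _ L _ _ _ zlt).
- exact: measurable_eval_Loo.
- by apply: integrZ; apply: integrB => //; exact: integrZ.
move: ug xE; apply: filterS2 => w ugw xw; rewrite leNgt; apply/negP => zL.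
(* The value may be -oo, so a real [b] between it and [L w] is used in the convexity inequality. *)
have [b fzb bL] : exists2 b : R, (f (z w) w <= b%:E)%E & b < L w.
  case fz : (f (z w) w) zL => [r| |] zL //.
    by exists r => //; rewrite -lte_fin.
  by exists (L w - 1); [exact: leNye|lra].
pose a := (1 + e)^-1.
have e1 : 0 < 1 + e by lra.
have a0 : 0 <= a by rewrite invr_ge0 ltW.
have a1 : a <= 1 by rewrite invf_le1// lerDl ltW.
have := convex_integrand_le f_convex a0 a1 ugw fzb.
have -> : a *: u w + (1 - a) *: z w = xb w.
  rewrite /u !fctE scalerDr scalerA.
  have -> : a * e = 1 - a by rewrite /a; field; rewrite gt_eqF.
  rewrite -addrA -scalerDr subrK -scalerDl.
  by rewrite addrC subrK scale1r.
rewrite xw lee_fin; apply/negP; rewrite -ltNge.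
have e1' : 1 + e != 0 by rewrite gt_eqF.
rewrite /a -(ltr_pM2l e1).
have -> : (1 + e) * ((1 + e)^-1 * g w + (1 - (1 + e)^-1) * b) = g w + e * b.
  by field.
have := bL; rewrite /L ltr_pdivlMl//.
by rewrite -/(fval f xb w); lra.
Qed.

End relative_continuity.

(** * The exact penalty bound *)

Section exact_penalty.
Context {d : measure_display} {Om : measurableType d} {R : realType}.
Variables (P : probability Om R) (T : nat) (n_ : 'I_T.+1 -> nat).
Variable F : 'I_T.+1 -> set (set Om).
Hypothesis F_filt : filtration F.

Local Notation n := (\sum_(t < T.+1) n_ t)%N.
Implicit Types (x z u v : Om -> 'rV[R]_n).

Variable f : 'rV[R]_n -> Om -> \bar R.
Hypothesis f_normal : normal_integrand f.
Hypothesis f_convex : convex_integrand f.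

Let dom := dom_Loo P f.
Let A := aff_hull dom.

Hypothesis f_proper : forall z, dom z -> int_functional P f z \is a fin_num.
Hypothesis adapted_approx : exists rho : R, forall z, A z ->
  forall az, is_adapted_proj P F z az ->
    exists2 x, (A `&` Noo P F) x &
      (Loo_norm P (x - z)%R <= rho%:E * Loo_norm P (az - z)%R)%E.
Variable xb : Om -> 'rV[R]_n.
Hypothesis xb_in : (A `&` Noo P F) xb.
Hypothesis xb_bound : exists delta M : R, 0 < delta /\
  forall z, A z -> nrm P (z - xb) <= delta -> (int_functional P f z < M%:E)%E.

Variables (xs : Om -> 'rV[R]_n) (c : R).
Hypothesis Lxs : L1 P xs.
Hypothesis xs_le : forall x, Noo P F x -> dom x -> epr P x xs - phi P f x <= c.

Let F_sub t : F t `<=` measurable. Proof. by case: F_filt => _ + _; exact. Qed.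

Let F_sigma t : sigma_algebra [set: Om] (F t). Proof. by case: F_filt. Qed.

Let N u : R := nrm P (aproj P F u - u).

Let L_aproj u : Loo P u -> Loo P (aproj P F u).
Proof. by move=> Lu; apply: Loo_cproj. Qed.

Let N_ge0 u : 0 <= N u. Proof. exact: nrm_ge0. Qed.

Let N_lin (a b : R) u v : Loo P u -> Loo P v ->
  N (a *: u + b *: v) <= `|a| * N u + `|b| * N v.
Proof.
move=> Lu Lv.
have LBu := LooB (L_aproj Lu) Lu; have LBv := LooB (L_aproj Lv) Lv.
have Lbv := LooZ b Lv; have Lauv := LooS a Lu Lbv.
rewrite /N (@nrm_ae_eq _ _ _ _ _ _
    (a *: (aproj P F u - u) + b *: (aproj P F v - v))).
- apply: (le_trans (nrmD (LooZ a LBu) (LooZ b LBv))).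
  by apply: lerD; exact: nrmZ.
- by apply: LooB => //; exact: L_aproj.
- by apply: LooD; exact: LooZ.
have h1 := cproj_lin (fun=> true) (fun i => F_sigma (stage i)) (fun i => @F_sub (stage i)) a Lu Lbv.
have h2 := cproj_lin (fun=> true) (fun i => F_sigma (stage i)) (fun i => @F_sub (stage i)) b Lv (@Loo0 _ _ _ P n).
have h3 := aproj_Noo F_filt (@Noo0 _ _ _ P T n_ F).
move: h2 h3; rewrite addr0 => h2 h3.
move: h1 h2 h3; apply: filterS3 => w; rewrite -!/(aproj P F _) !fctE => -> -> ->.
by rewrite addr0 !scalerBr addrACA opprD.
Qed.

Let N_sub : sublinear_on (Loo P) N.
Proof.
split=> [u v Lu Lv|t u t0 Lu].
  by have := N_lin 1 1 Lu Lv; rewrite !scale1r normr1 !mul1r.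
have := N_lin t 0 Lu Lu; rewrite scale0r addr0 normr0 mul0r addr0.
by rewrite gtr0_norm.
Qed.

Let N_opp u : Loo P u -> N (- u) <= N u.
Proof.
move=> Lu; have := N_lin (- 1) 0 Lu Lu.
by rewrite scale0r addr0 normr0 mul0r addr0 scaleN1r normrN1 mul1r.
Qed.

Let A_Loo z : A z -> Loo P z.
Proof. exact: aff_dom_Loo. Qed.

Let psi z : R := phi P f z - epr P z xs + c.

(** Condition (2) in terms of [nrm]: the factor n compares the Euclidean with the sup norm, and
    [|rho|] is taken because [rho] has no given sign. *)
Let approx : exists2 r : R, 0 <= r & forall z, A z ->
  exists x, [/\ A x, Noo P F x & nrm P (x - z) <= r * N z].
Proof.
have [rho hrho] := adapted_approx.
exists (`|rho| * n%:R) => [|z Az]; first by rewrite mulr_ge0.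
have Lz := A_Loo Az.
have [x [Ax Nx] xz] := hrho z Az _ (aprojP F_filt Lz).
exists x; split=> //; have Lxz := LooB (A_Loo Ax) Lz.
rewrite -lee_fin; apply: (le_trans (nrm_Loo_norm Lxz)); apply: (le_trans xz).
have LN := LooB (L_aproj Lz) Lz.
apply: (@le_trans _ _ (`|rho|%:E * Loo_norm P (aproj P F z - z)%R)%E).
  by apply: lee_wpmul2r; [exact: Lnorm_ge0|rewrite lee_fin ler_norm].
rewrite -mulrA EFinM; apply: lee_wpmul2l; first by rewrite lee_fin.
exact: Loo_norm_nrm.
Qed.

Let psi_convex (a : R) u v : 0 <= a -> a <= 1 -> dom u -> dom v ->
  dom (a *: u + (1 - a) *: v) /\
  psi (a *: u + (1 - a) *: v) <= a * psi u + (1 - a) * psi v.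
Proof.
move=> a0 a1 du dv.
have [duv h] := phi_convex f_normal f_convex f_proper a0 a1 du dv.
split=> //; have [Lu _] := du; have [Lv _] := dv.
rewrite /psi (epr_linl Lxs)//; last exact: LooZ.
by rewrite (bfZ (epr_bounded Lxs))//; lra.
Qed.

(* With [x] the adapted approximation of [z], the convex combination
   [(1 - l) z + l (xb + (1 - l) / l (x - z)) = (1 - l) x + l xb] is adapted,
   so [psi >= 0] there. *)
Let penalty : exists2 K : R, 0 <= K & forall z, dom z -> - (K * N z) <= psi z.
Proof.
have [Axb Nxb] := xb_in; have Lxb := A_Loo Axb.
have [r r0 hr] := approx.
have [delta [M [delta0 hM]]] := xb_bound.
have [_ [Kx hKx]] := epr_bounded Lxs.
(* A bound for [psi] at every domain point within [delta] of [xb]: one term for Ef, two for the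
   pairing with [xs], one for [c]. *)
pose M' := `|M| + `|epr P xb xs| + `|Kx| * delta + `|c|.
have M'0 : 0 <= M' by rewrite !addr_ge0// mulr_ge0// ltW.
exists (M' / delta * r); first by rewrite mulr_ge0// divr_ge0// ltW.
move=> z dz; have Az : A z by exact: sub_aff_hull.
have Lz := A_Loo Az.
have [x [Ax Nx xz]] := hr z Az; have Lx := A_Loo Ax.
have LB := LooB Lx Lz.
(* The slack [eta] keeps the divisor [th] positive when r * N z is 0. *)
suff h (eta : R) : 0 < eta -> - (M' / delta * (r * N z + eta)) <= psi z.
  rewrite -mulrA; apply/ler_addgt0Pl => eta eta0.
  have M'd : 0 < M' / delta + 1 by rewrite ltr_wpDl// divr_ge0// ltW.
  have := h _ (divr_gt0 eta0 M'd); rewrite mulrDr.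
  have : M' / delta * (eta / (M' / delta + 1)) <= eta.
    rewrite mulrCA ger_pMr// ler_pdivrMr// mul1r.
    by rewrite lerDl.
  lra.
move=> eta0; set th := r * N z + eta.
have th0 : 0 < th by rewrite ltr_wpDl// mulr_ge0.
have dth : 0 < delta + th by lra.
pose u := xb + (delta / th) *: (x - z).
have Au : A u by apply: aff_hull_shift => //; rewrite divr_ge0// ltW.
have ux : nrm P (u - xb) <= delta.
  rewrite /u addrAC subrr add0r; apply: (le_trans (nrmZ _ LB)).
  have dt0 : 0 <= delta / th by rewrite divr_ge0// ltW.
  rewrite (ger0_norm dt0) mulrAC ler_pdivrMr// ler_wpM2l ?(ltW delta0)//.
  by apply: (le_trans xz); rewrite /th lerDl ltW.
have Lu := A_Loo Au.
have ult := hM u Au ux.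
have du : dom u by split=> //; apply: (lt_trans ult); exact: ltry.
have [_ _ phiu] := dom_val f_normal f_proper du.
have uM : phi P f u < M by rewrite -lte_fin -phiu.
have psiu : psi u <= M'.
  have : `|epr P (u - xb) xs| <= `|Kx| * delta.
    apply: (le_trans (hKx _ (LooB Lu Lxb))).
    apply: (le_trans (ler_wpM2r (nrm_ge0 _ _) (ler_norm Kx))).
    by rewrite ler_wpM2l.
  rewrite (bfB (epr_bounded Lxs))// ler_norml => /andP[h1 h2].
  have := ler_norm M; have := ler_norm c; have := ler_norm (- epr P xb xs).
  by rewrite normrN /psi /M'; lra.
(* Chosen so that l * (delta / th) = 1 - l: then [z] cancels from l u + (1 - l) z. *)
pose l := th / (delta + th).
have l0 : 0 <= l by rewrite divr_ge0// ltW.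
have l1 : l <= 1 by rewrite ler_pdivrMr// mul1r lerDr ltW.
have [dy psiy] := psi_convex l0 l1 du dz.
have yE : l *: u + (1 - l) *: z = l *: xb + (1 - l) *: x.
  rewrite /u scalerDr scalerA.
  have -> : l * (delta / th) = 1 - l.
    by rewrite /l; field; rewrite !gt_eqF.
  by rewrite -addrA -scalerDr subrK.
have Ny : Noo P F (l *: u + (1 - l) *: z).
  by rewrite yE; apply: NooD; exact: NooZ.
have psi0 : 0 <= psi (l *: u + (1 - l) *: z).
  by rewrite /psi; have := xs_le Ny dy; lra.
have l1E : 1 - l = delta / (delta + th) by rewrite /l; field; rewrite gt_eqF.
have : 0 <= l * psi u + (1 - l) * psi z by exact: le_trans psi0 psiy.
rewrite l1E /l -!mulrA ![(delta + th)^-1 * _]mulrC !mulrA -mulrDl.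
rewrite pmulr_lge0 ?invr_gt0// => h0.
have h1 : th * psi u <= th * M' by rewrite ler_wpM2l// ltW.
rewrite -(ler_pM2l delta0) mulrN.
have -> : delta * (M' / delta * th) = th * M' by field; rewrite gt_eqF.
lra.
Qed.

(** The sandwich theorem for [K * N] and [psi] gives [p0] with |p0| <= K N. As [N] vanishes on
    adapted vectors, so does [p0], and adding the pairing with [xs] gives [p]. *)
Lemma functional_exists : dom !=set0 -> exists p : (Om -> 'rV[R]_n) -> R,
  [/\ bounded_functional P p, forall z, dom z -> p z - phi P f z <= c &
      forall x, Noo P F x -> p x = epr P x xs].
Proof.
move=> dom0; have [K K0 hK] := penalty.
have KN_sub : sublinear_on (Loo P) (fun u => K * N u).
  split=> [u v Lu Lv|t u t0 Lu].
    by rewrite -mulrDr ler_wpM2l// N_sub.1.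
  by rewrite mulrCA ler_wpM2l// N_sub.2.
have psi_lb z : dom z -> - (K * N (- z)) <= psi z.
  move=> dz; apply: le_trans (hK z dz); rewrite lerN2 ler_wpM2l//.
  rewrite -{1}[z]opprK; apply: N_opp; apply: LooN; exact: proj1 dz.
have [p0 [plin pN ppsi]] := linear_sandwich (@LooS _ _ _ P n) (@Loo0 _ _ _ P n)
  KN_sub (fun z (dz : dom z) => proj1 dz) dom0 psi_convex psi_lb.
have p0_abs z : Loo P z -> `|p0 z| <= K * N z.
    move=> Lz; rewrite ler_norml pN// andbT lerNl.
    have <- : p0 (- z) = - p0 z.
      have := plin (- 1) _ _ Lz (@Loo0 _ _ _ P n).
      have := plin 1 _ _ (@Loo0 _ _ _ P n) (@Loo0 _ _ _ P n).
      by rewrite scaleN1r scale1r !addr0 mul1r mulN1r; lra.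
    by apply: (le_trans (pN _ (LooN Lz))); rewrite ler_wpM2l// N_opp.
  have p0_bd : bounded_functional P p0.
    split=> //; exists (K * 2) => z Lz; apply: (le_trans (p0_abs z Lz)).
    rewrite -mulrA ler_wpM2l//; apply: (le_trans (nrmD (L_aproj Lz) (LooN Lz))).
    rewrite nrmN// mulrDl mul1r lerD2r.
    by apply: nrm_cproj => //.
  exists (fun z => p0 z + epr P z xs); split.
  + exact: bf_add p0_bd (epr_bounded Lxs).
  + by move=> z dz; have := ppsi z dz; rewrite /psi; lra.
  + move=> x Nx; have [_ Lx] := Nx.
    have : `|p0 x| <= 0.
      apply: (le_trans (p0_abs x Lx)); rewrite /N ae_nrm_eq0 ?mulr0//.
        by apply: LooB => //; exact: L_aproj.
      by apply: filterS (aproj_Noo F_filt Nx) => w e; rewrite !fctE e subrr.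
    by rewrite normr_le0 => /eqP ->; rewrite add0r.
Qed.

End exact_penalty.

(** * Conjugates and subdifferentials *)

Section duality.
Context {d : measure_display} {Om : measurableType d} {R : realType}.
Variables (P : probability Om R) (T : nat) (n_ : 'I_T.+1 -> nat).
Variable F : 'I_T.+1 -> set (set Om).
Hypothesis F_filt : filtration F.

Local Notation n := (\sum_(t < T.+1) n_ t)%N.
Implicit Types (x z u v : Om -> 'rV[R]_n).

Variable f : 'rV[R]_n -> Om -> \bar R.
Hypothesis f_normal : normal_integrand f.
Hypothesis f_convex : convex_integrand f.

Let dom := dom_Loo P f.

Hypothesis f_proper : forall z, dom z -> int_functional P f z \is a fin_num.
Hypothesis dom_Noo : dom `&` Noo P F !=set0.
(** Stated for any upper bound [c], so that it serves both the conjugate and, with c = E[x.xs] -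
    Ef(x), the subdifferential at x. *)
Hypothesis strong_duality : forall xs (c : R), N1 P F xs ->
  (forall x, Noo P F x -> dom x -> epr P x xs - phi P f x <= c) ->
  exists2 v, Nperp P F v &
    (int_functional P (conj_integrand f) (xs + v)%R <= c%:E)%E.

Let F_sub t : F t `<=` measurable. Proof. by case: F_filt => _ + _; exact. Qed.

Let F_sigma t : sigma_algebra [set: Om] (F t). Proof. by case: F_filt. Qed.

Lemma NperpE v x : Nperp P F v -> Noo P F x -> epr P x v = 0.
Proof.
move=> [Lv v0] Nx; have [_ Lx] := Nx.
by apply: EFin_inj; rewrite -pairingE// v0.
Qed.

Lemma Nperp0 : Nperp P F (0 : Om -> 'rV[R]_n).
Proof.
split=> [|z [_ Lz]]; first exact: L10.
rewrite pairingE//; last exact: L10.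
by congr EFin; rewrite /epr -[RHS](rint_cst P 0); congr rint; apply/funext => w;
  rewrite /dot big1// => i _; rewrite -[X in _ * X]/((0 : 'rV[R]_n) ord0 i) mxE mulr0.
Qed.

Lemma epr_Nperp xs v x : L1 P xs -> Nperp P F v -> Noo P F x ->
  epr P x (xs + v) = epr P x xs.
Proof.
move=> Lxs Pv Nx; have [_ Lx] := Nx; have [Lv _] := Pv.
by rewrite -[xs in LHS]scale1r epr_linr// mul1r (NperpE Pv Nx) addr0.
Qed.

Lemma fenchel_inequality x y : dom x -> L1 P y ->
  ((epr P x y - phi P f x)%:E <= int_functional P (conj_integrand f) y)%E.
Proof.
move=> dx Ly; have [Lx _] := dx.
have [Ix xE _] := dom_val f_normal f_proper dx.
have Ixy := integrable_dot Lx Ly.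
rewrite /epr -rintB//; apply: ext_expectation_lb.
- by apply: (measurable_conj f_normal) => i; exact: L1_coord.
- exact: integrB.
- apply: filterS xE => w e.
  by have := fenchel_young f (x w) (y w) w; rewrite e -EFinB.
Qed.

Lemma weak_duality xs v : L1 P xs -> Nperp P F v ->
  (conj_functional P F (int_functional P f) xs <=
   int_functional P (conj_integrand f) (xs + v)%R)%E.
Proof.
move=> Lxs Pv; apply: ge_ereal_sup => _ [x Nx <-]; have [_ Lx] := Nx.
rewrite pairingE//; have [xlt|] := ltP (int_functional P f x) +oo%E; last first.
  by rewrite leye_eq => /eqP ->; exact: leNye.
have dx : dom x by split.
have [_ _ ->] := dom_val f_normal f_proper dx.
rewrite -EFinB -(epr_Nperp Lxs Pv Nx); apply: fenchel_inequality => //.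
by apply: L1D => //; have [] := Pv.
Qed.

Lemma conjugate_duality xs : N1 P F xs ->
  exists2 v, Nperp P F v & int_functional P (conj_integrand f) (xs + v)%R =
    conj_functional P F (int_functional P f) xs.
Proof.
move=> Nxs; have [_ Lxs] := Nxs.
have conj_ub x : Noo P F x -> dom x ->
    ((epr P x xs - phi P f x)%:E <= conj_functional P F (int_functional P f) xs)%E.
  move=> Nx dx; have [_ Lx] := Nx; apply: ereal_sup_ubound; exists x => //.
  by rewrite pairingE//; have [_ _ ->] := dom_val f_normal f_proper dx.
suff [v Pv le] : exists2 v, Nperp P F v &
    (int_functional P (conj_integrand f) (xs + v)%R <=
     conj_functional P F (int_functional P f) xs)%E.
  by exists v => //; apply/le_anti; rewrite le weak_duality.
case E : (conj_functional P F (int_functional P f) xs) => [c| |].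
- apply: strong_duality => // x Nx dx; rewrite -lee_fin -E; exact: conj_ub.
- by exists 0; [exact: Nperp0|exact: leey].
- have [x0 [dx0 Nx0]] := dom_Noo; have := conj_ub _ Nx0 dx0.
  by rewrite E leeNy_eq.
Qed.

(** The indicator of a set of [F (stage i)] placed in coordinate i belongs to N^oo; pairing [v] with
    it gives the defining identity of the conditional expectation. *)
Lemma Nperp_adapted_proj xs v : N1 P F xs -> Nperp P F v ->
  is_adapted_proj P F (xs + v) xs.
Proof.
move=> [axs Lxs] Pv i; have [Lv _] := Pv; have Lxv := L1D Lxs Lv.
split; [exact: axs|exact: Lxs|].
move=> A FA; apply/(cond_exp_rint (@F_sub (stage i)) _ _ FA).
- by have /L1P := Lxv; exact.
- by have /L1P := Lxs; exact.
have Ni := Noo_indic P F_filt FA; have [_ Li] := Ni.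
have E u : L1 P u -> epr P (inj_coord i \1_A) u =
    rint P (fun w => \1_A w * u w ord0 i).
  by move=> Lu; congr rint; apply/funext => w; rewrite dot_inj_coord.
by rewrite -!E// epr_Nperp.
Qed.

Lemma subdiff_sub x : Noo P F x ->
  subdiff_functional P F (int_functional P f) x `<=`
  adapted_proj_set P F (L1_subdiff P f x).
Proof.
move=> Nx xs [Nxs xfin xsub]; have [_ Lxs] := Nxs; have [_ Lx] := Nx.
have dx : dom x by split=> //; move: xfin; rewrite fin_numElt => /andP[].
have [Ix xE phix] := dom_val f_normal f_proper dx.
have [v Pv hv] : exists2 v, Nperp P F v &
    (int_functional P (conj_integrand f) (xs + v)%R <= (epr P x xs - phi P f x)%:E)%E.
  apply: strong_duality => // x' Nx' dx'; have [_ Lx'] := Nx'.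
  have := xsub x' Nx'; have [_ _ ->] := dom_val f_normal f_proper dx'.
  rewrite phix pairingE//; last exact: LooB.
  by rewrite -EFinD lee_fin (bfB (epr_bounded Lxs))//; lra.
have [Lv _] := Pv; have Lxv := L1D Lxs Lv.
exists (xs + v); last exact: Nperp_adapted_proj.
split=> //; set y := xs + v.
pose h w := conj_integrand f (y w) w.
have mh : measurable_fun setT h.
  by apply: (measurable_conj f_normal) => i; exact: L1_coord.
pose b w := dot (x w) (y w) - fval f x w.
have Ixy := integrable_dot Lx Lxv.
have Ib : integr P b by exact: integrB.
have bh : {ae P, forall w, ((b w)%:E <= h w)%E}.
  apply: filterS xE => w e.
  by have := fenchel_young f (x w) (y w) w; rewrite e -EFinB.
have rb : rint P b = epr P x xs - phi P f x.
  by rewrite /b rintB// -(epr_Nperp Lxs Pv Nx).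
have hfin : ext_expectation P h \is a fin_num.
  by apply: (ext_expectation_ltNy mh Ib bh); apply: (le_lt_trans hv); exact: ltry.
have [Ih hE rh] := ext_expectation_fin mh hfin.
(* The Fenchel gap is a.e. nonnegative, and its integral is at most 0 by the choice of [v]. *)
have : {ae P, forall w, fine (h w) - b w = 0}.
  apply: rint_ae_eq0; first exact: integrB.
    move: bh hE; apply: filterS2 => w bhw e.
    by rewrite subr_ge0 -lee_fin -e.
  by rewrite rintB// rb subr_le0 -lee_fin -[X in (X%:E <= _)%E]/(rint P (fine \o h)) -rh.
move: hE xE; apply: filterS3 => w hE xE hb; split; first by rewrite xE.
move=> x'; have := fenchel_young f x' (y w) w.
rewrite -/(h w) hE xE; have -> : fine (h w) = b w by lra.
rewrite /b dotBl; case: (f x' w) => [r| |] //=.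
  by rewrite -!EFinB -EFinD !lee_fin; lra.
by rewrite leey.
Qed.

Lemma sup_subdiff x : Noo P F x ->
  adapted_proj_set P F (L1_subdiff P f x) `<=`
  subdiff_functional P F (int_functional P f) x.
Proof.
move=> Nx av [v [Lv vsub] vav]; have [_ Lx] := Nx.
(* A subgradient only makes f(x) finite a.e. The subgradient inequality at a point x0 of the domain
   gives the integrable majorant f(x0) - (x0 - x).v of f(x). *)
have dx : dom x.
  have [x0 [dx0 [_ Lx0]]] := dom_Noo.
  have [Ix0 x0E _] := dom_val f_normal f_proper dx0.
  have LB := LooB Lx0 Lx.
  have IB : integr P (fun w => fval f x0 w - dot ((x0 - x) w) (v w)).
    by apply: integrB => //; exact: integrable_dot.
  apply: (proj1 (dom_intro f_normal f_proper Lx IB _)).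
  move: vsub x0E; apply: filterS2 => w [xfin vs] e.
  have := vs (x0 w); rewrite e -leeBrDr//.
have [Ix xE phix] := dom_val f_normal f_proper dx.
have [Lav _] := epr_adapted_proj F_filt Nx Lv vav.
split; [|by rewrite phix|].
  by split=> // i; have [] := vav i.
move=> x' Nx'; have [_ Lx'] := Nx'.
have NB := NooB Nx' Nx; have [_ LB] := NB.
have [_ eav] := epr_adapted_proj F_filt NB Lv vav.
rewrite pairingE// -eav phix -EFinD.
have [xlt|] := ltP (int_functional P f x') +oo%E; last first.
  by rewrite leye_eq => /eqP ->; exact: leey.
have dx' : dom x' by split.
have [Ix' xE' ->] := dom_val f_normal f_proper dx'.
have Idot := integrable_dot LB Lv.
rewrite lee_fin /phi /epr -rintD//; apply: rint_ae_le => //.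
  exact: integrD.
move: vsub xE xE'; apply: filterS3 => w [_ vs] e e'.
by rewrite -lee_fin EFinD -e -e'; exact: vs.
Qed.

End duality.

Local Open Scope ereal_scope.

Theorem corollary8 (d : measure_display) (Om : measurableType d)
  (R : realType) (P : probability Om R)
  (T : nat) (n_ : 'I_T.+1 -> nat) (F : 'I_T.+1 -> set (set Om))
  (f : 'rV[R]_(\sum_(t < T.+1) n_ t)%N -> Om -> \bar R) :
  filtration F ->
  normal_integrand f ->
  convex_integrand f ->
  (dom_Loo P f `&` Noo P F) !=set0 ->
  (forall z, dom_Loo P f z -> forall t : 'I_T.+1,
     exists2 zh, dom_Loo P f zh & cond_exp_upto P F t z zh) ->
  (exists rho : R, forall z, aff_hull (dom_Loo P f) z ->
     forall az, is_adapted_proj P F z az ->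
       exists2 x, (aff_hull (dom_Loo P f) `&` Noo P F) x &
         Loo_norm P (x - z)%R <= rho%:E * Loo_norm P (az - z)%R) ->
  (exists xb, [/\ (aff_hull (dom_Loo P f) `&` Noo P F) xb,
     int_functional P f xb \is a fin_num &
     Loo_continuous_at P (aff_hull (dom_Loo P f)) (int_functional P f) xb]) ->
  (forall xs, N1 P F xs ->
     conj_functional P F (int_functional P f) xs =
       ereal_inf [set int_functional P (conj_integrand f) (xs + v)%R
                 | v in Nperp P F] /\
     exists2 v, Nperp P F v &
       int_functional P (conj_integrand f) (xs + v)%R =
       ereal_inf [set int_functional P (conj_integrand f) (xs + v')%R
                 | v' in Nperp P F]) /\
  (forall x, Noo P F x ->
     subdiff_functional P F (int_functional P f) x =
     adapted_proj_set P F (L1_subdiff P f x)).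
Proof.
move=> F_filt f_normal f_convex dom_Noo dom_ce adapted_approx.
move=> [xb [xb_in xb_fin xb_cont]].
have [Axb _] := xb_in.
have f_proper := proper_of_continuity f_normal f_convex Axb xb_fin xb_cont.
have xb_bound := locally_bounded Axb xb_fin xb_cont.
have strong xs (c : R) : N1 P F xs ->
    (forall x, Noo P F x -> dom_Loo P f x -> (epr P x xs - phi P f x <= c)%R) ->
    exists2 v, Nperp P F v &
      int_functional P (conj_integrand f) (xs + v)%R <= c%:E.
  move=> Nxs xs_le; have [_ Lxs] := Nxs; have [x0 [dx0 _]] := dom_Noo.
  have [p [p_bd pc pN]] := functional_exists F_filt f_normal f_convex f_proper
    adapted_approx xb_in xb_bound Lxs xs_le (ex_intro _ x0 dx0).
  exact: (dual_of_functional F_filt f_normal f_proper dom_ce Nxs dx0 p_bd pc pN).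
split=> [xs Nxs|x Nx].
  have [v Pv vE] := conjugate_duality f_normal f_proper dom_Noo strong Nxs.
  have infE : ereal_inf [set int_functional P (conj_integrand f) (xs + v')%R
      | v' in Nperp P F] = conj_functional P F (int_functional P f) xs.
    apply/le_anti/andP; split.
      by rewrite -vE; apply: ereal_inf_lbound; exists v.
    apply: le_ereal_inf_tmp => _ [v' Pv' <-].
    by apply: weak_duality => //; have [] := Nxs.
  by split; [|exists v]; rewrite ?infE.
apply/seteqP; split.
- exact: subdiff_sub.
- exact: sup_subdiff.
Qed.
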